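(* Let $\varepsilon>0$. Suppose the standing assumptions on $(X,Y,f,F)$, the stochastic oracle assumption, and the $\mu$-strong concavity assumption of the context hold, and let $\overline B\ge B$ be a known bound. Run unregularized SPDE (see context) with the parameters $h_{\rm sc},\alpha_{\rm sc},k_{\rm sc},\beta_{\rm sc}$ and with $$T=\max\left\{1,\left\lceil\frac{128L\overline B}{\beta_{\rm sc}\varepsilon^2}\right\rceil\right\},\qquad m=\max\left\{1,\left\lceil\frac{38400\sigma^2}{\beta_{\rm sc}\varepsilon^2}\right\rceil\right\}.$$ Then the output $(x_{\rm out},y_{\rm out})=(x_{J+1},y_{J+1})$ satisfies $\mathbb E[\mathcal R(x_{\rm out},y_{\rm out})^2]\le\varepsilon^2$, and the number $N_{\rm sc}$ of SFO calls satisfies $$N_{\rm sc}\le3\left(1+\frac{128L\overline B}{\beta_{\rm sc}\varepsilon^2}\right)\left(1+\frac{38400\sigma^2}{\beta_{\rm sc}\varepsilon^2}\right)=O\!\left(1+\frac{(L\overline B+\sigma^2)\sqrt\kappa}{\varepsilon^2}+\frac{L\overline B\sigma^2\kappa}{\varepsilon^4}\right).$$ For fixed $L,\overline B$ and $\sigma>0$, this gives $T=O(\sqrt\kappa\,\varepsilon^{-2})$, $m=O(\sqrt\kappa\,\varepsilon^{-2})$, $N_{\rm sc}=O(\kappa\varepsilon^{-4})$. If $\sigma=0$, then $m=1$ and $N_{\rm sc}=O(\sqrt\kappa\,\varepsilon^{-2})$.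
   Context: **Standing assumptions.** All norms are Euclidean. $X\subseteq\mathbb R^n$ is nonempty, closed, convex; $Y\subseteq\mathbb R^p$ is nonempty, compact, convex with $D_Y:=\max_{y\in Y}\|y\|>0$. $\omega\sim\mathcal D$ is random and $F(x,y)=\mathbb E_{\omega\sim\mathcal D}[f(x,y;\omega)]$. For almost every $\omega$, $f(\cdot,\cdot;\omega)$ is differentiable on a neighborhood of $X\times Y$. $F$ is continuously differentiable on a neighborhood of $X\times Y$ and $\nabla F$ is $L$-Lipschitz on $X\times Y$ for some $L>0$. For every $x\in X$, $F(x,\cdot)$ is concave on $Y$. $\phi(x):=\max_{y\in Y}F(x,y)$ and $\phi_{\inf}:=\inf_{x\in X}\phi(x)>-\infty$. $\Pi_C$ and $N_C$ denote Euclidean projection onto, and the normal cone of, a closed convex set $C$. **Strong concavity.** There is $\mu>0$ such that for all $x\in X$, $y,y'\in Y$: $F(x,y')\le F(x,y)+\langle\nabla_yF(x,y),y'-y\rangle-\frac\mu2\|y'-y\|^2$; moreover $0<\mu\le L$, and $\kappa:=L/\mu\ge1$. **Stochastic oracle.** There is a constant $\sigma\ge0$ such that for every sigma-algebra $\mathcal A$ of pre-query information and every $\mathcal A$-measurable $u\in X\times Y$, a fresh sample $\omega\sim\mathcal D$ independent of $\mathcal A$ satisfies $\mathbb E[\nabla f(u;\omega)\mid\mathcal A]=\nabla F(u)$ and $\mathbb E[\|\nabla f(u;\omega)-\nabla F(u)\|^2\mid\mathcal A]\le\sigma^2$. Samples within a batch are independent draws from $\mathcal D$, independent of all information available before the batch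 is queried. Each evaluation of $\nabla f(u;\omega)$ is one stochastic first-order oracle (SFO) call. **Residual.** For $(x,y)\in X\times Y$, $\mathcal R(x,y)^2:=\operatorname{dist}^2(0,\nabla_xF(x,y)+N_X(x))+\operatorname{dist}^2(0,-\nabla_yF(x,y)+N_Y(y))$. **Unregularized SPDE.** Given deterministic $x_0\in X$, $y_0\in Y$, integers $m,T\ge1$, and parameters $h,\alpha,k,\beta$, set $z_0=x_0$, $\xi_0=0$, $n_0=v_0=0$. For $t=0,\dots,T-1$ (each estimate below is the average of $\nabla f(\cdot;\omega)$ over a fresh batch of $m$ samples at the indicated point, with components $\widehat g=(\widehat g_x,\widehat g_y)$): (1) $\widehat g^{(0)}_t$ at $(x_t,y_t)$; $\widetilde x_t=\Pi_X(x_t-h(\widehat g^{(0)}_{x,t}+2L(x_t-z_t)+\xi_t))$, $\widetilde y_t=\Pi_Y(y_t+h(\widehat g^{(0)}_{y,t}-n_t+v_t))$. (2) $\widehat g^{(1)}_t$ at $(\widetilde x_t,\widetilde y_t)$; $\bar v_t=\alpha v_t+k\widehat g^{(1)}_{y,t}$; $x_{t+1}=\Pi_X(x_t-h(\widehat g^{(1)}_{x,t}+2L(\widetilde x_t-z_t)))$; $\xi_{t+1}=\frac{x_t-x_{t+1}}h-\widehat g^{(1)}_{x,t}-2L(\widetilde x_t-z_t)$; $y_{t+1}=\Pi_Y(y_t+h(\widehat g^{(1)}_{y,t}+\bar v_t))$; $n_{t+1}=\frac1{1+k}\left(\frac{y_t-y_{t+1}}h+\widehat g^{(1)}_{y,t}+\bar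 v_t\right)$. (3) $\widehat g^{(2)}_t$ at $(x_{t+1},y_{t+1})$; $v_{t+1}=\alpha v_t+k(\widehat g^{(2)}_{y,t}-n_{t+1})$; $z_{t+1}=z_t+\beta(x_{t+1}-z_t)$. Finally $J\sim\operatorname{Unif}\{0,\dots,T-1\}$ is drawn independently of all oracle samples and the output is $(x_{J+1},y_{J+1})$. The total number of SFO calls is at most $3mT$. **Parameters.** $s_{\rm sc}=\sqrt{2L\mu}$, $h=h_{\rm sc}=\frac1{192L}$, $\alpha=\alpha_{\rm sc}=(1+h_{\rm sc}s_{\rm sc}/16)^{-1}$, $k=k_{\rm sc}=\frac{h_{\rm sc}(8L-s_{\rm sc})}{16+h_{\rm sc}s_{\rm sc}}$, $\beta=\beta_{\rm sc}=\frac{h_{\rm sc}s_{\rm sc}}{4096}=\frac{\sqrt2}{786432}\kappa^{-1/2}$. **Initial quantity.** $B:=\phi(x_0)-\phi_{\inf}+2D_Y\|\nabla_yF(x_0,y_0)\|+\frac{\|\nabla_xF(x_0,y_0)\|^2+2\|\nabla_yF(x_0,y_0)\|^2}{L}+\left(3+\frac1{64}\right)LD_Y^2$. **Asymptotic notation.** $O(\cdot)$ suppresses constants independent of $\varepsilon$ and of any parameters whose dependence is displayed (in particular of $\kappa$); orders in $\varepsilon$ alone (without the additive $1$) are for $\varepsilon\downarrow0$, with the quantities declared fixed held fixed. *)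

(* Defs.v *)
From HB Require Import structures.
From mathcomp Require Import all_boot all_order all_algebra finmap.
From mathcomp Require Import all_classical all_reals all_analysis.

Set Implicit Arguments.
Unset Strict Implicit.
Unset Printing Implicit Defensive.

Import Order.TTheory GRing.Theory Num.Theory.
Import numFieldNormedType.Exports.

Local Open Scope classical_set_scope.
Local Open Scope ring_scope.

Section euclidean.
Context {R : realType}.

Definition dot {n} (u v : 'rV[R]_n) : R := \sum_(i < n) u 0 i * v 0 i.

(* The library norm `|v| on row vectors is the sup norm, which induces the same
   topology; every quantitative statement below uses the Euclidean norm. *)
Definition enorm {n} (v : 'rV[R]_n) : R := Num.sqrt (dot v v).

(* Euclidean norm of R^n x R^p, identified with R^(n+p). *)
Definition penorm {n p} (u : 'rV[R]_n * 'rV[R]_p) : R :=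
  Num.sqrt (enorm u.1 ^+ 2 + enorm u.2 ^+ 2).

Definition edist {n} (a : 'rV[R]_n) (A : set 'rV[R]_n) : R :=
  inf [set enorm (a - v) | v in A].

Definition proj {n} (C : set 'rV[R]_n) (v : 'rV[R]_n) : 'rV[R]_n :=
  get [set c | C c /\ forall c', C c' -> enorm (v - c) <= enorm (v - c')].

Definition normal_cone {n} (C : set 'rV[R]_n) (c : 'rV[R]_n) : set 'rV[R]_n :=
  [set g | C c /\ forall c', C c' -> dot g (c' - c) <= 0].

(* Riesz representative of the differential, split along R^n x R^p. *)
Definition grad {n p} (F : 'rV[R]_n * 'rV[R]_p -> R) (u : 'rV[R]_n * 'rV[R]_p) :
    'rV[R]_n * 'rV[R]_p :=
  (\row_i ('d F u (delta_mx 0 i, 0)), \row_j ('d F u (0, delta_mx 0 j))).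

Definition gradx {n p} (F : 'rV[R]_n * 'rV[R]_p -> R) u := (grad F u).1.
Definition grady {n p} (F : 'rV[R]_n * 'rV[R]_p -> R) u := (grad F u).2.

End euclidean.

Section minimax.
Context {R : realType} {n p : nat}.
Variables (X : set 'rV[R]_n) (Y : set 'rV[R]_p).
Variable F : 'rV[R]_n * 'rV[R]_p -> R.

(* The suprema below are attained: Y is compact nonempty and F is
   continuous around X x Y. *)
Definition max_norm : R := sup [set enorm y | y in Y].

Definition phi (x : 'rV[R]_n) : R := sup [set F (x, y) | y in Y].

Definition phi_inf : R := inf [set phi x | x in X].

Definition residual_sq (u : 'rV[R]_n * 'rV[R]_p) : R :=
  edist 0 [set gradx F u + v | v in normal_cone X u.1] ^+ 2 +
  edist 0 [set - grady F u + v | v in normal_cone Y u.2] ^+ 2.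

Definition strongly_concave (mu : R) : Prop :=
  forall x y y', X x -> Y y -> Y y' ->
    F (x, y') <= F (x, y) + dot (grady F (x, y)) (y' - y)
                 - mu / 2 * enorm (y' - y) ^+ 2.

Definition initial_quantity (L : R) (x0 : 'rV[R]_n) (y0 : 'rV[R]_p) : R :=
  phi x0 - phi_inf + 2 * max_norm * enorm (grady F (x0, y0))
  + (enorm (gradx F (x0, y0)) ^+ 2 + 2 * enorm (grady F (x0, y0)) ^+ 2) / L
  + (3 + 1 / 64) * L * max_norm ^+ 2.

End minimax.

(* R^n x R^p with its Borel sigma-algebra. *)
Notation borel_pair R n p :=
  (g_sigma_algebraType (@open ('rV[R]_n * 'rV[R]_p)%type)).

Section problem.
Context {R : realType} {n p : nat} {dS : measure_display} {S : measurableType dS}.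
Variables (D : probability S R) (f : 'rV[R]_n * 'rV[R]_p -> S -> R).

Definition expected (u : 'rV[R]_n * 'rV[R]_p) : R := (\int[D]_w f u w)%R.

Definition sgrad (u : 'rV[R]_n * 'rV[R]_p) (w : S) := grad (f^~ w) u.

Variables (X : set 'rV[R]_n) (Y : set 'rV[R]_p).

Record standing_assumptions (L : R) : Prop := StandingAssumptions {
  X_neq0 : X !=set0;
  X_closed : closed X;
  X_convex : convex_set (X : set (convex_lmodType 'rV[R]_n));
  Y_neq0 : Y !=set0;
  Y_compact : compact Y;
  Y_convex : convex_set (Y : set (convex_lmodType 'rV[R]_p));
  max_norm_gt0 : 0 < max_norm Y;
  (* the neighborhood may depend on the sample *)
  f_diff : {ae D, forall w, exists U : set ('rV[R]_n * 'rV[R]_p),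
    [/\ open U, X `*` Y `<=` U & forall u, U u -> differentiable (f^~ w) u]};
  F_C1 : exists U : set ('rV[R]_n * 'rV[R]_p),
    [/\ open U, X `*` Y `<=` U,
        (forall u, U u -> D.-integrable setT (EFin \o f u)),
        (forall u, U u -> differentiable expected u) &
        (forall u, U u -> {for u, continuous (grad expected)})];
  (* measurability of the oracle answers, implicit in the conditional
     expectations of [stochastic_oracle] *)
  sgrad_measurable :
    measurable_fun ((X `*` Y) `*` setT
                      : set (borel_pair R n p * S))
      (fun q => sgrad q.1 q.2 : borel_pair R n p);
  L_gt0 : 0 < L;
  F_smooth : forall u u', (X `*` Y) u -> (X `*` Y) u' ->
    penorm (grad expected u - grad expected u') <= L * penorm (u - u');
  F_concave : forall x, X x ->
    convex_function (Y : set (convex_lmodType 'rV[R]_p))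
      (fun y => - expected (x, y));
  phi_bounded : has_lbound [set phi Y expected x | x in X]
}.

End problem.

Section probability_notions.
Context {R : realType} {d : measure_display} {Omega : measurableType d}.
Variable P : probability Omega R.

Definition sub_sigma_algebra (A : set (set Omega)) : Prop :=
  sigma_algebra setT A /\ A `<=` measurable.

Definition measurable_wrt {d'} {T : measurableType d'} (A : set (set Omega))
    (u : Omega -> T) : Prop :=
  forall B, measurable B -> A (u @^-1` B).

(* H is a version of E[G | A].  G is not required to be integrable but only
   integrable on each set of a countable cover of Omega by elements of A: a
   stochastic gradient at an arbitrary A-measurable point of an unbounded set
   need not be integrable.  For integrable G this is the usual notion. *)
Definition is_cond_exp (A : set (set Omega)) (G H : Omega -> R) : Prop :=
  [/\ measurable_fun setT G,
      measurable_wrt A H,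
      exists A_ : (set Omega)^nat, [/\ forall k, A (A_ k), \bigcup_k A_ k = setT
        & forall k, P.-integrable (A_ k) (EFin \o G)] &
      forall E, A E -> P.-integrable E (EFin \o G) ->
        P.-integrable E (EFin \o H) /\
        (\int[P]_(w in E) (G w)%:E = \int[P]_(w in E) (H w)%:E)%E].

Definition independent (A B : set (set Omega)) : Prop :=
  forall E E', A E -> B E' -> P (E `&` E') = (P E * P E')%E.

Definition mutually_independent {I : choiceType} (K : set I)
    (G : I -> set (set Omega)) : Prop :=
  forall (A : {fset I}) (E : I -> set Omega),
    [set` A] `<=` K -> (forall i, i \in A -> G i (E i)) ->
    P (\bigcap_(i in [set` A]) E i) = (\prod_(i <- A) P (E i))%E.

End probability_notions.

Definition stochastic_oracle {R : realType} {n p : nat}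
    {dS : measure_display} {S : measurableType dS} (D : probability S R)
    (f : 'rV[R]_n * 'rV[R]_p -> S -> R)
    (X : set 'rV[R]_n) (Y : set 'rV[R]_p) (sigma : R)
    {d : measure_display} {Omega : measurableType d} (P : probability Omega R) :
    Prop :=
  forall (A : set (set Omega)) (u : Omega -> borel_pair R n p)
      (s : {mfun Omega >-> S}),
    sub_sigma_algebra A -> measurable_wrt A u -> (forall w, (X `*` Y) (u w)) ->
    (forall B, measurable B -> distribution P s B = D B) ->
    independent P A (g_sigma_algebra_preimage s) ->
    let G w := sgrad f (u w) (s w) in
    let H w := grad (expected D f) (u w) in
    [/\ forall i, is_cond_exp P A (fun w => (G w).1 0 i) (fun w => (H w).1 0 i),
        forall j, is_cond_exp P A (fun w => (G w).2 0 j) (fun w => (H w).2 0 j)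
      & exists V : Omega -> R,
          is_cond_exp P A (fun w => penorm (G w - H w) ^+ 2) V /\
          {ae P, forall w, V w <= sigma ^+ 2}].

Section spde.
Context {R : realType} {n p : nat} {S : Type}.

Record state := State {
  st_x : 'rV[R]_n; st_z : 'rV[R]_n; st_xi : 'rV[R]_n;
  st_y : 'rV[R]_p; st_n : 'rV[R]_p; st_v : 'rV[R]_p;
  st_calls : nat (* number of SFO calls made so far *)
}.

Variables (X : set 'rV[R]_n) (Y : set 'rV[R]_p).
(* g u w is the answer of the stochastic first-order oracle at u, sample w *)
Variable g : 'rV[R]_n * 'rV[R]_p -> S -> 'rV[R]_n * 'rV[R]_p.
Variables L h alpha k beta : R.

(* batch average, and number of oracle calls it costs *)
Definition minibatch (u : 'rV[R]_n * 'rV[R]_p) (b : seq S) :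
    ('rV[R]_n * 'rV[R]_p) * nat :=
  ((size b)%:R^-1 *: \sum_(w <- b) g u w, size b).

Definition spde_step (b0 b1 b2 : seq S) (st : state) : state :=
  let: State x z xi y nn v calls := st in
  let: (g0, c0) := minibatch (x, y) b0 in
  let xt := proj X (x - h *: (g0.1 + (2 * L) *: (x - z) + xi)) in
  let yt := proj Y (y + h *: (g0.2 - nn + v)) in
  let: (g1, c1) := minibatch (xt, yt) b1 in
  let vbar := alpha *: v + k *: g1.2 in
  let x' := proj X (x - h *: (g1.1 + (2 * L) *: (xt - z))) in
  let xi' := h^-1 *: (x - x') - g1.1 - (2 * L) *: (xt - z) in
  let y' := proj Y (y + h *: (g1.2 + vbar)) in
  let nn' := (1 + k)^-1 *: (h^-1 *: (y - y') + g1.2 + vbar) in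
  let: (g2, c2) := minibatch (x', y') b2 in
  let v' := alpha *: v + k *: (g2.2 - nn') in
  let z' := z + beta *: (x' - z) in
  State x' z' xi' y' nn' v' (calls + c0 + c1 + c2).

(* s t j i is the i-th sample of the j-th batch of iteration t. *)
Definition batch (m : nat) (s : nat -> nat -> nat -> S) (t j : nat) : seq S :=
  mkseq (s t j) m.

Fixpoint spde (m : nat) (s : nat -> nat -> nat -> S) (x0 : 'rV[R]_n)
    (y0 : 'rV[R]_p) (t : nat) : state :=
  if t is t'.+1 then
    spde_step (batch m s t' 0) (batch m s t' 1) (batch m s t' 2)
      (spde m s x0 y0 t')
  else State x0 x0 0 y0 0 0 0.

End spde.

Section parameters.
Context {R : realType}.
Variables L mu : R.

Definition s_sc : R := Num.sqrt (2 * L * mu).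
Definition h_sc : R := 1 / (192 * L).
Definition alpha_sc : R := (1 + h_sc * s_sc / 16)^-1.
Definition k_sc : R := h_sc * (8 * L - s_sc) / (16 + h_sc * s_sc).
(* Ring numerals are unary, so large constants are factored:
   2 ^+ 12 is 4096, and 384 * 10 ^+ 2 below is 38400. *)
Definition beta_sc : R := h_sc * s_sc / 2 ^+ 12.

Definition max1ceil (r : R) : nat := `|Num.max 1%Z (Num.ceil r)|%N.

Definition T_sc (Bbar eps : R) : nat :=
  max1ceil (128 * L * Bbar / (beta_sc * eps ^+ 2)).

Definition m_sc (sigma eps : R) : nat :=
  max1ceil (384 * 10 ^+ 2 * sigma ^+ 2 / (beta_sc * eps ^+ 2)).

End parameters.

Section sampling.
Context {R : realType} {d : measure_display} {Omega : measurableType d}.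
Variable P : probability Omega R.
Context {dS : measure_display} {S : measurableType dS}.
Variables (D : probability S R) (m T : nat).
Variables (s : nat -> nat -> nat -> {mfun Omega >-> S}) (J : {mfun Omega >-> nat}).

Definition used : set (nat * nat * nat) :=
  [set q | [/\ (q.1.1 < T)%N, (q.1.2 < 3)%N & (q.2 < m)%N]].

Definition sample_algebra (q : nat * nat * nat) : set (set Omega) :=
  g_sigma_algebra_preimage (s q.1.1 q.1.2 q.2).

(* x0 and y0 are deterministic, so the information available before a batch is
   carried by the earlier samples: the batches being i.i.d. and independent of
   it amounts to all the samples being i.i.d. *)
Record sampling_scheme : Prop := SamplingScheme {
  sample_law : forall q, used q -> forall B, measurable B ->
    distribution P (s q.1.1 q.1.2 q.2) B = D B;
  sample_indep : mutually_independent P used sample_algebra;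
  index_unif : forall j, (j < T)%N -> P (J @^-1` [set j]) = (T%:R^-1)%:E;
  index_indep : independent P (g_sigma_algebra_preimage J)
    <<s \bigcup_(q in used) sample_algebra q >>
}.

End sampling.

(* Main.v *)
Require Import Defs.
From HB Require Import structures.
From mathcomp Require Import all_boot all_order all_algebra finmap.
From mathcomp Require Import all_classical all_reals all_analysis.
From mathcomp Require Import measurable_realfun ring lra.

Set Implicit Arguments.
Unset Strict Implicit.
Unset Printing Implicit Defensive.

Import Order.TTheory GRing.Theory Num.Theory.
Import numFieldNormedType.Exports.

Local Open Scope classical_set_scope.
Local Open Scope ring_scope.

(** The method is an extragradient discretisation of a second-order system with
    momentum in [y], run on the objective regularised by [L * sq (x - z)] around
    a slowly moving centre [z].  The regularised objective is strongly convex in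
    [x] and strongly concave in [y]; hence it has a unique saddle point
    ([exists_saddle]), which depends on [z] in a Lipschitz way, and its value
    there, the [envelope], lies between [phi_inf] and [phi] and obeys a quadratic
    upper bound in [z] ([envelope_smooth]).

    The proof follows a Lyapunov function, [energy]: the envelope at the centre,
    plus the kinetic energy of the primal and dual velocities, plus a small
    multiple of the distance to the saddle point coupled with the momentum.  The
    multipliers [xi] and [n] kept by the method are normal vectors of [X] and
    [Y] at the new iterate ([iteration_normal]), so they make the updates exact
    implicit steps up to two errors: the gradients are taken at the predictor
    instead of the corrector, and they are sampled.  Nonexpansiveness of the
    projections makes the first error of second order in the step, so that it is
    absorbed by the squared increments of the velocities.  What remains of one
    iteration ([energy_step]) is a decrease by [beta / 64] times the squared
    residual, at most 20 times the squared sampling errors, and the pairings of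
    the sampling errors of the two later batches with vectors that are known
    before the batch is drawn.

    For the expectation, let [past r] be the algebra of the first [r] samples.  A
    pi-lambda argument ([generated_independent]) shows that the next sample is
    independent of it, so the oracle assumption applies to the current iterate:
    the error of a gradient is orthogonal to all square integrable [past]
    variables ([noise_orthogonal]).  Consequently the variance of a batch is
    divided by its size ([averaged_noise_bound]) and the pairings have mean zero.
    All the maps of the method being Lipschitz, the state stays square integrable
    ([known_step]).  Summing over the iterations ([mean_residual]) bounds the
    mean of the squared residuals by a multiple of [L * B / (beta * T)] plus a
    multiple of [sigma ^+ 2 / (beta * m)]; the prescribed [T] and [m] make them
    at most a half and a tenth of [eps ^+ 2].  Finally the index is independent
    of the samples and uniform, so the mean at the output is that average
    ([uniform_output]).

    The complexity bounds follow from [1 / beta] being at most a constant times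
    the square root of the condition number ([inv_beta_le]). *)


Local Notation proj := Defs.proj.

(** * Euclidean geometry *)

Section inner_product.
Context {R : realType}.

Definition sq {n} (v : 'rV[R]_n) : R := dot v v.

Section fixed_dimension.
Context {n : nat}.
Implicit Types (u v w : 'rV[R]_n) (t : R).

Lemma dotC u v : dot u v = dot v u.
Proof. by apply: eq_bigr => i _; rewrite mulrC. Qed.

Lemma dotDl u v w : dot (u + v) w = dot u w + dot v w.
Proof.
by rewrite /dot -big_split; apply: eq_bigr => i _; rewrite mxE mulrDl.
Qed.

Lemma dotZl t u v : dot (t *: u) v = t * dot u v.
Proof.
by rewrite /dot mulr_sumr; apply: eq_bigr => i _; rewrite mxE mulrA.
Qed.

Lemma dotDr u v w : dot u (v + w) = dot u v + dot u w.
Proof. by rewrite dotC dotDl !(dotC _ u). Qed.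

Lemma dotZr t u v : dot u (t *: v) = t * dot u v.
Proof. by rewrite dotC dotZl dotC. Qed.

Lemma dotNl u v : dot (- u) v = - dot u v.
Proof. by rewrite -scaleN1r dotZl mulN1r. Qed.

Lemma dotNr u v : dot u (- v) = - dot u v.
Proof. by rewrite dotC dotNl dotC. Qed.

Lemma dot0l v : dot 0 v = 0.
Proof. by rewrite -(scale0r 0) dotZl mul0r. Qed.

Lemma dot0r v : dot v 0 = 0.
Proof. by rewrite dotC dot0l. Qed.

Definition dotE := (@dotDl, @dotDr, @dotNl, @dotNr, @dotZl, @dotZr).

Lemma sq_ge0 v : 0 <= sq v.
Proof. by apply: sumr_ge0 => i _; rewrite -expr2 sqr_ge0. Qed.

Lemma sq0 : sq (0 : 'rV[R]_n) = 0.
Proof. exact: dot0l. Qed.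

Lemma sq_eq0 v : (sq v == 0) = (v == 0).
Proof.
apply/idP/eqP => [|->]; last by rewrite /sq dot0l.
rewrite psumr_eq0 => [/allP v0|i _]; last by rewrite -expr2 sqr_ge0.
apply/rowP => i; rewrite mxE; apply/eqP.
by have := v0 i (mem_index_enum i); rewrite /= mulf_eq0 orbb.
Qed.

Lemma sqN v : sq (- v) = sq v.
Proof. by rewrite /sq dotNl dotNr opprK. Qed.

Lemma sqZ t v : sq (t *: v) = t ^+ 2 * sq v.
Proof. by rewrite /sq dotZl dotZr mulrA. Qed.

Lemma sqD u v : sq (u + v) = sq u + 2 * dot u v + sq v.
Proof. rewrite /sq !dotE (dotC v u); ring. Qed.

Lemma sqB u v : sq (u - v) = sq u - 2 * dot u v + sq v.
Proof. rewrite sqD sqN dotNr; ring. Qed.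

Lemma sq_sym u v : sq (u - v) = sq (v - u).
Proof. by rewrite -sqN opprB. Qed.

Lemma sq_coord v i : v 0 i ^+ 2 <= sq v.
Proof.
rewrite /sq /dot (bigD1 i)//= -expr2 lerDl.
by apply: sumr_ge0 => j _; rewrite -expr2 sqr_ge0.
Qed.

Lemma enorm_ge0 v : 0 <= enorm v.
Proof. exact: sqrtr_ge0. Qed.

Lemma enorm_sq v : enorm v ^+ 2 = sq v.
Proof. by rewrite sqr_sqrtr ?sq_ge0. Qed.

Lemma ler_enorm u v : (enorm u <= enorm v) = (sq u <= sq v).
Proof. by rewrite ler_sqrt ?sq_ge0. Qed.

(** Young's inequality with two free weights: every cross term of the energy
    estimates below is split by it. *)
Lemma young (a b : R) u v : 0 <= a -> 0 <= b -> 1 <= 4 * a * b ->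
  `|dot u v| <= a * sq u + b * sq v.
Proof.
move=> a0 b0 ab.
have a_gt0 : 0 < a by rewrite lt_neqAle a0 andbT; apply/eqP => a0'; nra.
have key (w : 'rV[R]_n) : dot u w <= a * sq u + b * sq w.
  have /(mulr_ge0 (ltW a_gt0)) := sq_ge0 (u - (2 * a)^-1 *: w).
  rewrite sqB sqZ dotZr => H.
  have E : a * (2 * ((2 * a)^-1 * dot u w)) = dot u w.
    by field; rewrite gt_eqF.
  have E' : a * ((2 * a)^-1 ^+ 2 * sq w) = (4 * a)^-1 * sq w.
    by field; rewrite gt_eqF.
  have : (4 * a)^-1 * sq w <= b * sq w.
    rewrite ler_wpM2r ?sq_ge0// -[leLHS]mulr1 ler_pdivrMl; last lra.
    by move: ab; rewrite -mulrA; lra.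
  move: H; rewrite mulrDr mulrBr E E'; lra.
rewrite ler_norml key andbT.
have := key (- v); rewrite dotNr sqN; lra.
Qed.

Lemma dot_CauchySchwarz u v : `|dot u v| <= enorm u * enorm v.
Proof.
have [/eqP u0|u_gt0] := eqVneq (sq u) 0.
  move: u0; rewrite sq_eq0 => /eqP->; rewrite dot0l normr0.
  by rewrite mulr_ge0 ?enorm_ge0.
have su : 0 < enorm u by rewrite sqrtr_gt0 lt_neqAle eq_sym u_gt0 sq_ge0.
have [/eqP v0|v_gt0] := eqVneq (sq v) 0.
  move: v0; rewrite sq_eq0 => /eqP->; rewrite dot0r normr0.
  by rewrite mulr_ge0 ?enorm_ge0.
have sv : 0 < enorm v by rewrite sqrtr_gt0 lt_neqAle eq_sym v_gt0 sq_ge0.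
have := @young (enorm v / (2 * enorm u)) (enorm u / (2 * enorm v)) u v.
rewrite -!enorm_sq.
have -> : enorm v / (2 * enorm u) * enorm u ^+ 2 +
    enorm u / (2 * enorm v) * enorm v ^+ 2 = enorm u * enorm v.
  by field; rewrite !gt_eqF.
apply.
- by rewrite divr_ge0 ?mulr_ge0 ?enorm_ge0.
- by rewrite divr_ge0 ?mulr_ge0 ?enorm_ge0.
- by rewrite le_eqVlt; apply/orP; left; apply/eqP; field; rewrite !gt_eqF.
Qed.

Lemma sq_sum2 u v : sq (u + v) <= 2 * (sq u + sq v).
Proof. by have := sq_ge0 (u - v); rewrite sqB sqD; lra. Qed.

Lemma sq_sum3 u v w : sq (u + v + w) <= 3 * (sq u + sq v + sq w).
Proof.
have := sq_ge0 (u - v); have := sq_ge0 (u - w); have := sq_ge0 (v - w).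
rewrite !sqB !sqD dotDl; lra.
Qed.

Lemma sq_mxnorm v : sq v <= n%:R * `|v| ^+ 2.
Proof.
rewrite /sq /dot; apply: (@le_trans _ _ (\sum_(i < n) `|v| ^+ 2)); last first.
  by rewrite sumr_const card_ord mulr_natl.
apply: ler_sum => i _; rewrite -expr2 -(real_normK (num_real (v 0 i))) lerXn2r ?nnegrE//.
rewrite [leRHS]/Num.norm /= mx_normrE; apply/bigmax_geP; right => /=.
by exists (0, i).
Qed.

Lemma mxnorm_sq v : `|v| ^+ 2 <= sq v.
Proof.
rewrite -enorm_sq lerXn2r ?nnegrE ?enorm_ge0//.
rewrite [leLHS]/Num.norm /= mx_normrE; apply/bigmax_leP; split => [|[i j] _ /=].
  exact: enorm_ge0.
rewrite -(@ler_pXn2r _ 2)// ?nnegrE ?enorm_ge0// enorm_sq real_normK ?num_real//.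
by rewrite ?(ord1 i) sq_coord.
Qed.

End fixed_dimension.

Lemma sq_row_mx {n p} (a : 'rV[R]_n) (b : 'rV[R]_p) :
  sq (row_mx a b) = sq a + sq b.
Proof.
rewrite /sq /dot big_split_ord /=.
by congr (_ + _); apply: eq_bigr => i _; rewrite ?row_mxEl ?row_mxEr.
Qed.

Lemma dot_row_mx {n p} (a a' : 'rV[R]_n) (b b' : 'rV[R]_p) :
  dot (row_mx a b) (row_mx a' b') = dot a a' + dot b b'.
Proof.
rewrite /dot big_split_ord /=.
by congr (_ + _); apply: eq_bigr => i _; rewrite ?row_mxEl ?row_mxEr.
Qed.

Lemma penorm_sq {n p} (u : 'rV[R]_n * 'rV[R]_p) :
  penorm u ^+ 2 = sq u.1 + sq u.2.
Proof. by rewrite sqr_sqrtr ?addr_ge0 ?sqr_ge0// !enorm_sq. Qed.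

(** A function that is Lipschitz for the Euclidean norm is continuous for the
    sup-norm topology, both norms being equivalent. *)
Lemma lipschitz_sq_continuous {n} (f : 'rV[R]_n -> R) (K : R) :
  (forall u v, (f u - f v) ^+ 2 <= K * sq (u - v)) -> continuous f.
Proof.
move=> fK x; pose M := `|K| * n%:R + 1.
have M_gt0 : 0 < M by rewrite ltr_wpDl ?mulr_ge0.
apply/(@cvgrPdist_lt _ _ _ (nbhs x) (nbhs_filter x)) => e e0.
apply/(nbhs_ballP x); exists (e / Num.sqrt M) => /=.
  by rewrite divr_gt0 ?sqrtr_gt0.
move=> y; rewrite mx_norm_ball /ball_/= ltr_pdivlMr ?sqrtr_gt0// => H.
rewrite -(@ltr_pXn2r _ 2)// ?nnegrE ?ltW// real_normK ?num_real//.
apply: (le_lt_trans (fK _ _)).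
apply: (@le_lt_trans _ _ (M * `|x - y| ^+ 2)).
  apply: (@le_trans _ _ (`|K| * (n%:R * `|x - y| ^+ 2))).
    apply: (@le_trans _ _ (`|K| * sq (x - y))).
      by rewrite ler_wpM2r ?sq_ge0 ?ler_norm.
    by rewrite ler_wpM2l ?sq_mxnorm.
  by rewrite mulrA ler_wpM2r ?sqr_ge0// /M lerDl.
rewrite -(sqr_sqrtr (ltW M_gt0)) -exprMn mulrC ltrXn2r//.
Qed.

Lemma enorm_lipschitz {n} (u v : 'rV[R]_n) :
  (enorm u - enorm v) ^+ 2 <= sq (u - v).
Proof.
have := dot_CauchySchwarz u v; rewrite ler_norml => /andP[_].
by rewrite sqB sqrrB !enorm_sq; lra.
Qed.

Lemma enorm_continuous {n} : continuous (@enorm R n).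
Proof.
apply: (@lipschitz_sq_continuous _ _ 1) => u v.
by rewrite mul1r enorm_lipschitz.
Qed.

Lemma sq_dist_continuous {n} (v : 'rV[R]_n) : continuous (fun c : 'rV[R]_n => sq (v - c)).
Proof.
have -> : (fun c : 'rV[R]_n => sq (v - c)) = (fun c => enorm (v - c) * enorm (v - c)).
  by apply/funext => c; rewrite -expr2 enorm_sq.
have H : continuous (fun c : 'rV[R]_n => enorm (v - c)).
  apply: (@lipschitz_sq_continuous _ _ 1) => a b.
  rewrite mul1r (le_trans (enorm_lipschitz _ _))// sq_sym.
  by rewrite opprB addrC addrA subrK.
by move=> x; exact: (cvgM (H x) (H x)).
Qed.

End inner_product.

(** * Projection on a closed convex set and variational inequalities *)

Section projection.
Context {R : realType} {n : nat}.
Implicit Types (C : set 'rV[R]_n) (u v w c : 'rV[R]_n).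

Definition segment_closed C : Prop :=
  forall a b t, C a -> C b -> 0 <= t -> t <= 1 -> C (a + t *: (b - a)).

Lemma convex_segment_closed C :
  convex_set (C : set (convex_lmodType 'rV[R]_n)) -> segment_closed C.
Proof.
move=> cC a b t Ca Cb t0 t1.
have t01 : (0 <= t <= 1)%R by rewrite t0.
have := cC b a (Itv01 t0 t1) (mem_set Cb) (mem_set Ca).
rewrite inE /conv /=.
suff -> : a + t *: (b - a) = t *: b + (1 - t) *: a by [].
by rewrite scalerBl scale1r scalerBr addrCA.
Qed.

Lemma sq_bounded_compact C (v : 'rV[R]_n) (r : R) :
  closed C -> (forall c, C c -> sq (v - c) <= r) -> compact C.
Proof.
move=> cC Cr; apply: bounded_closed_compact cC.
exists (Num.sqrt r + `|v|); split; first exact: num_real.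
move=> M rM c Cc /=; apply: le_trans (ltW rM).
rewrite -[c in `|c|](subKr v) (le_trans (ler_normB _ _))// addrC lerD2r.
have r0 : 0 <= r := le_trans (sq_ge0 _) (Cr _ Cc).
rewrite -(@ler_pXn2r _ 2)// ?nnegrE ?sqrtr_ge0// sqr_sqrtr//.
exact: le_trans (mxnorm_sq _) (Cr _ Cc).
Qed.

Lemma exists_nearest C v : C !=set0 -> closed C ->
  exists c, C c /\ forall c', C c' -> sq (v - c) <= sq (v - c').
Proof.
move=> [c0 Cc0] clC.
pose B := C `&` [set c | sq (v - c) <= sq (v - c0)].
have clB : closed B.
  apply: closedI => //.
  apply: (@closed_comp _ _ (fun c => sq (v - c)) [set r | r <= sq (v - c0)]).
    by move=> c _; exact: sq_dist_continuous.
  exact: closed_le.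
have [|||c] := @EVT_min_rV R n (fun c => sq (v - c)) B.
- by exists c0; split => /=.
- by apply: (@sq_bounded_compact _ v (sq (v - c0))) => // c [].
- by apply: continuous_subspaceT => c; exact: sq_dist_continuous.
rewrite inE => -[Cc cc0] cm; exists c; split=> // c' Cc'.
have [H|H] := leP (sq (v - c')) (sq (v - c0)).
  by apply: cm; rewrite inE.
exact: le_trans cc0 (ltW H).
Qed.

Lemma projP C v : C !=set0 -> closed C ->
  C (proj C v) /\ forall c, C c -> sq (v - proj C v) <= sq (v - c).
Proof.
move=> C0 /(exists_nearest v C0)[c [Cc cm]]; rewrite /proj.
set Q := [set _ | _]; have : Q (get Q).
  by apply: (@getPex _ Q); exists c; split=> // c' Cc'; rewrite ler_enorm cm.
move=> [H1 H2]; split=> // c' /H2; by rewrite ler_enorm.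
Qed.

(** First-order optimality of the nearest point, from comparing it with points
    of the segment towards [c]. *)
Lemma proj_normal C v : C !=set0 -> closed C -> segment_closed C ->
  normal_cone C (proj C v) (v - proj C v).
Proof.
move=> C0 clC sC; have [Cp pm] := projP v C0 clC; split=> // c Cc.
set p := proj C v in Cp pm *; rewrite leNgt; apply/negP => H.
have sp : 0 < sq (c - p).
  rewrite lt_neqAle sq_ge0 andbT eq_sym sq_eq0; apply/eqP => c0.
  by move: H; rewrite c0 dot0r ltxx.
pose t := Num.min 1 (dot (v - p) (c - p) / sq (c - p)).
have t0 : 0 < t by rewrite lt_min ltr01 divr_gt0.
have t1 : t <= 1 by rewrite ge_min lexx.
have tb : t * sq (c - p) <= dot (v - p) (c - p).
  by rewrite -ler_pdivlMr// ge_min lexx orbT.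
have := pm _ (sC _ _ t Cp Cc (ltW t0) t1).
have -> : v - (p + t *: (c - p)) = (v - p) - t *: (c - p).
  by rewrite opprD addrA.
rewrite (sqB (v - p)) sqZ dotZr; nra.
Qed.

Lemma normal_cone0 C c : C c -> normal_cone C c 0.
Proof. by move=> Cc; split=> // c' _; rewrite dot0l. Qed.

Lemma normal_coneZ C c g (t : R) : 0 <= t ->
  normal_cone C c g -> normal_cone C c (t *: g).
Proof.
by move=> t0 [Cc H]; split=> // c' /H H'; rewrite dotZl mulr_ge0_le0.
Qed.

Lemma normal_cone_proj C c g : C !=set0 -> closed C -> segment_closed C ->
  normal_cone C c g -> proj C (c + g) = c.
Proof.
move=> C0 clC sC [Cc H].
have [Cp Hp] := proj_normal (c + g) C0 clC sC.
apply/eqP; rewrite -subr_eq0 -sq_eq0 eq_le sq_ge0 andbT.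
have := H _ Cp; have := Hp _ Cc; set p := proj _ _.
have -> : c + g - p = g - (p - c) by apply/rowP => i; rewrite !mxE; ring.
rewrite -[c - p]opprB dotNr dotDl dotNl -/(sq _); lra.
Qed.

Lemma proj_nonexpansive C u v : C !=set0 -> closed C -> segment_closed C ->
  sq (proj C u - proj C v) <= sq (u - v).
Proof.
move=> C0 clC sC.
have [Cp Hp] := proj_normal u C0 clC sC; have [Cq Hq] := proj_normal v C0 clC sC.
set p := proj C u in Cp Hp *; set q := proj C v in Cq Hq *.
have -> : u - v = (p - q) + ((u - p) - (v - q)).
  by apply/rowP => i; rewrite !mxE; ring.
rewrite (sqD (p - q)).
have H1 := Hp _ Cq; have H2 := Hq _ Cp.
have := sq_ge0 ((u - p) - (v - q)).
have -> : dot (p - q) (u - p - (v - q)) =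
    - dot (u - p) (q - p) - dot (v - q) (p - q).
  by rewrite dotC -(opprB p q) dotNr !(dotDl, dotNl); ring.
lra.
Qed.

(** A strongly monotone Lipschitz field has a solution of its variational
    inequality: the projected step [u |-> proj C (u - t M u)] contracts, and a
    minimiser of the squared displacement [sq (u - T u)] over a large ball can
    only be a fixed point. *)
Lemma exists_variational_solution C (M : 'rV[R]_n -> 'rV[R]_n) (m K : R) :
  C !=set0 -> closed C -> segment_closed C -> 0 < m ->
  (forall u v, C u -> C v -> m * sq (u - v) <= dot (M u - M v) (u - v)) ->
  (forall u v, C u -> C v -> sq (M u - M v) <= K * sq (u - v)) ->
  exists u, C u /\ forall v, C v -> 0 <= dot (M u) (v - u).
Proof.
move=> C0 clC sC m0 Mm ML.
pose K' : R := `|K| + m ^+ 2.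
have K'0 : 0 < K' by rewrite ltr_wpDl// exprn_gt0.
pose t := m / K'; have t0 : 0 < t by rewrite divr_gt0.
pose a : R := 1 - m ^+ 2 / K'.
have a1 : a < 1 by rewrite ltrBlDr ltrDl divr_gt0// exprn_gt0.
have a0 : 0 <= a by rewrite subr_ge0 ler_pdivrMr// mul1r lerDr.
pose T u := proj C (u - t *: M u).
have TC u : C (T u) by case: (projP (u - t *: M u) C0 clC).
have Tcontr u v : C u -> C v -> sq (T u - T v) <= a * sq (u - v).
  move=> Cu Cv; apply: (le_trans (proj_nonexpansive _ _ C0 clC sC)).
  have -> : u - t *: M u - (v - t *: M v) = (u - v) - t *: (M u - M v).
    by apply/rowP => i; rewrite !mxE; ring.
  rewrite (sqB (u - v)) sqZ dotZr (dotC (u - v)).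
  have H1 := Mm _ _ Cu Cv.
  have H2 : sq (M u - M v) <= K' * sq (u - v).
    apply: (le_trans (ML _ _ Cu Cv)); rewrite ler_wpM2r ?sq_ge0//.
    by rewrite (le_trans (ler_norm _))// lerDl sqr_ge0.
  have H3 : t ^+ 2 * sq (M u - M v) <= t ^+ 2 * (K' * sq (u - v)).
    by rewrite ler_wpM2l ?sqr_ge0.
  have H4 : t * (m * sq (u - v)) <= t * dot (M u - M v) (u - v).
    by rewrite (ler_wpM2l (ltW t0)).
  have E : a * sq (u - v) =
      sq (u - v) - 2 * (t * (m * sq (u - v))) + t ^+ 2 * (K' * sq (u - v)).
    by rewrite /a /t; field; rewrite gt_eqF.
  by rewrite E; lra.
have TE u : T u = proj C (u - t *: M u) by [].
clearbody T.
have [c0 Cc0] := C0.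
pose th : R := (1 - a) / 2.
have th0 : 0 < th by rewrite divr_gt0// subr_gt0.
pose d := sq (c0 - T c0).
have d0 : 0 <= d by exact: sq_ge0.
pose r := (1 + th^-1) * d / th.
have r0 : 0 <= r.
  have iv : 0 <= 1 + th^-1 by rewrite addr_ge0// invr_ge0 (ltW th0).
  by rewrite /r mulr_ge0 ?mulr_ge0 ?invr_ge0 ?(ltW th0).
have Tball u : C u -> sq (c0 - u) <= r -> sq (c0 - T u) <= r.
  move=> Cu ur; rewrite -(subrKA (T c0)) sqD.
  have := @young _ _ (th^-1 / 2) (th / 2) (c0 - T c0) (T c0 - T u).
  rewrite ler_norml => /(_ _ _ _)/andP[].
  - by rewrite mulr_ge0 ?invr_ge0 ?(ltW th0).
  - by rewrite mulr_ge0 ?invr_ge0 ?(ltW th0).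
  - suff -> : 4 * (th^-1 / 2) * (th / 2) = 1 by [].
    by field; rewrite gt_eqF.
  move=> _ Y; have /Tcontr/(_ Cu) := Cc0.
  move: Y; rewrite -/d.
  have Er : (1 + th^-1) * d = r * th by rewrite /r divfK// gt_eqF.
  set X := dot _ _; set Z := sq (T c0 - T u) => Y.
  have aE : a = 1 - 2 * th by rewrite /th; field.
  have /(ler_wpM2l a0) H : sq (c0 - u) <= r := ur.
  move=> ZH; have : Z <= a * r := le_trans ZH H.
  rewrite aE => ZH'.
  have : (1 + th) * Z <= (1 + th) * ((1 - 2 * th) * r).
    by rewrite ler_wpM2l// addr_ge0// ltW.
  have := mulr_ge0 (sqr_ge0 th) r0; lra.
pose B := C `&` [set u | sq (c0 - u) <= r].
have clB : closed B.
  apply: closedI => //.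
  apply: (@closed_comp _ _ (fun c => sq (c0 - c)) [set x | x <= r]).
    by move=> c _; exact: sq_dist_continuous.
  exact: closed_le.
pose P := proj C.
have PC u : C (P u) by case: (projP u C0 clC).
have Pid u : C u -> P u = u.
  move=> Cu; rewrite -[in LHS](addr0 u); apply: normal_cone_proj => //.
  exact: normal_cone0.
have [|||u] := @EVT_min_rV R n (fun u => enorm (P u - T (P u))) B.
- by exists c0; split => //=; rewrite subrr /sq dot0l.
- by apply: (@sq_bounded_compact _ c0 r) => // c [].
- apply: continuous_subspaceT.
  apply: (lipschitz_sq_continuous (K := 2 * (1 + a))) => u v.
  apply: (le_trans (enorm_lipschitz _ _)).
  have -> : P u - T (P u) - (P v - T (P v)) = (P u - P v) + (T (P v) - T (P u)).
    by apply/rowP => i; rewrite !mxE; ring.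
  apply: (le_trans (sq_sum2 _ _)).
  have H1 : sq (P u - P v) <= sq (u - v) := proj_nonexpansive _ _ C0 clC sC.
  have := Tcontr _ _ (PC v) (PC u); rewrite (sq_sym (P v)) => H2.
  have := ler_wpM2l a0 H1; lra.
rewrite inE => -[Cu ur] um; exists u; split=> //.
have Tu : u = T u.
  have : T u \in B by rewrite inE; split=> //; exact: Tball.
  move=> /um; rewrite !Pid// ler_enorm => H.
  have H2 := le_trans H (Tcontr _ _ Cu (TC u)).
  apply/eqP; rewrite -subr_eq0 -sq_eq0 eq_le sq_ge0 andbT.
  rewrite leNgt; apply/negP => u_gt0.
  by move: H2; rewrite leNgt gtr_pMl// a1.
have [_] := proj_normal (u - t *: M u) C0 clC sC.
rewrite -TE -Tu => H v /H.
by rewrite addrAC subrr sub0r dotNl dotZl oppr_le0 pmulr_rge0.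
Qed.

End projection.

(** * The regularised saddle point and its envelope *)

Section saddle.
Context {R : realType} {n p : nat}.
Variables (X : set 'rV[R]_n) (Y : set 'rV[R]_p).
Variable F : 'rV[R]_n * 'rV[R]_p -> R.
Variables (gx : 'rV[R]_n * 'rV[R]_p -> 'rV[R]_n).
Variables (gy : 'rV[R]_n * 'rV[R]_p -> 'rV[R]_p).
Variables L mu : R.

(** The quantitative content of smoothness in a form free of calculus. *)
Record smooth_concave : Prop := SmoothConcave {
  domX_neq0 : X !=set0;
  domX_closed : closed X;
  domX_segment : segment_closed X;
  domY_neq0 : Y !=set0;
  domY_closed : closed Y;
  domY_segment : segment_closed Y;
  smooth_gt0 : 0 < L;
  modulus_gt0 : 0 < mu;
  weakly_convex : forall x x' y, X x -> X x' -> Y y ->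
    F (x, y) + dot (gx (x, y)) (x' - x) - L / 2 * sq (x' - x)
      <= F (x', y);
  concave_above : forall x y y', X x -> Y y -> Y y' ->
    F (x, y') <= F (x, y) + dot (gy (x, y)) (y' - y)
                 - mu / 2 * sq (y' - y);
  gradient_lipschitz : forall u u', (X `*` Y) u -> (X `*` Y) u' ->
    sq (gx u - gx u') + sq (gy u - gy u')
      <= L ^+ 2 * (sq (u.1 - u'.1) + sq (u.2 - u'.2))
}.

Hypothesis H : smooth_concave.
Implicit Types (z x : 'rV[R]_n) (y : 'rV[R]_p) (u : 'rV[R]_n * 'rV[R]_p).

Let L_gt0 : 0 < L := smooth_gt0 H.
Let mu_gt0 : 0 < mu := modulus_gt0 H.

(** [F] with the quadratic proximal term centred at [z]; the weight [L] makes
    the [L]-weakly convex [F (_, y)] strongly convex with modulus [L]. *)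
Definition prox_val z u : R := F u + L * sq (u.1 - z).
Definition prox_gradx z u : 'rV[R]_n := gx u + (2 * L) *: (u.1 - z).

Lemma prox_convex z x x' y : X x -> X x' -> Y y ->
  prox_val z (x, y) + dot (prox_gradx z (x, y)) (x' - x)
    + L / 2 * sq (x' - x) <= prox_val z (x', y).
Proof.
move=> Xx Xx' Yy; have := weakly_convex H Xx Xx' Yy.
rewrite /prox_val /prox_gradx /= dotDl dotZl.
have -> : x' - z = (x - z) + (x' - x) by rewrite [RHS]addrC addrA subrK.
rewrite (sqD (x - z)); lra.
Qed.

Lemma prox_concave z x y y' : X x -> Y y -> Y y' ->
  prox_val z (x, y') <= prox_val z (x, y) + dot (gy (x, y)) (y' - y)
                        - mu / 2 * sq (y' - y).
Proof.
by move=> Xx Yy Yy'; have := concave_above H Xx Yy Yy'; rewrite /prox_val/=; lra.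
Qed.

(** The sum of the strong convexity and concavity inequalities at the four
    corners spanned by two points. *)
Lemma prox_monotone z u u' : (X `*` Y) u -> (X `*` Y) u' ->
  L * sq (u'.1 - u.1) + mu * sq (u'.2 - u.2)
    <= dot (prox_gradx z u' - prox_gradx z u) (u'.1 - u.1)
       - dot (gy u' - gy u) (u'.2 - u.2).
Proof.
case: u u' => x y [x' y'] [/= Xx Yy] [/= Xx' Yy'].
have := prox_convex z Xx Xx' Yy; have := prox_convex z Xx' Xx Yy'.
have := prox_concave z Xx Yy Yy'; have := prox_concave z Xx' Yy' Yy.
move: (prox_gradx z _) (prox_gradx z _) => g g'.
rewrite -(opprB x' x) -(opprB y' y) !sqN !dotNr !dotDl !dotNl; lra.
Qed.

Lemma prox_gradient_lipschitz z u u' : (X `*` Y) u -> (X `*` Y) u' ->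
  sq (prox_gradx z u - prox_gradx z u') + sq (gy u - gy u')
    <= 10 * L ^+ 2 * (sq (u.1 - u'.1) + sq (u.2 - u'.2)).
Proof.
move=> Cu Cu'; have := gradient_lipschitz H Cu Cu'.
have -> : prox_gradx z u - prox_gradx z u' =
    (gx u - gx u') + (2 * L) *: (u.1 - u'.1).
  by rewrite /prox_gradx; apply/rowP => i; rewrite !mxE; ring.
have := sq_sum2 (gx u - gx u') ((2 * L) *: (u.1 - u'.1)).
rewrite sqZ.
have := sq_ge0 (gy u - gy u').
have := mulr_ge0 (sqr_ge0 L) (sq_ge0 (u.2 - u'.2)).
lra.
Qed.

Definition is_saddle z u : Prop :=
  [/\ X u.1, Y u.2,
      forall x, X x -> 0 <= dot (prox_gradx z u) (x - u.1) &
      forall y, Y y -> dot (gy u) (y - u.2) <= 0].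

(** The field of the partial gradients, with the sign of the dual one reversed,
    is strongly monotone and Lipschitz on the product; a saddle point is a
    solution of its variational inequality. *)
Lemma exists_saddle z : exists u, is_saddle z u.
Proof.
pose C : set 'rV[R]_(n + p) := [set w | X (lsubmx w) /\ Y (rsubmx w)].
pose M (w : 'rV[R]_(n + p)) := let u := (lsubmx w, rsubmx w) in
  row_mx (prox_gradx z u) (- gy u).
have [x0 Xx0] := domX_neq0 H; have [y0 Yy0] := domY_neq0 H.
have lsub : continuous (@lsubmx R 1 n p).
  move=> w s /nbhs_ballP [e e0 es]; apply/nbhs_ballP; exists e => //= w' [_ ww'].
  by apply: es; split=> // i j; rewrite !mxE; exact: ww'.
have rsub : continuous (@rsubmx R 1 n p).
  move=> w s /nbhs_ballP [e e0 es]; apply/nbhs_ballP; exists e => //= w' [_ ww'].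
  by apply: es; split=> // i j; rewrite !mxE; exact: ww'.
have [||||||w [[Xw Yw] wP]] :=
    @exists_variational_solution R _ C M (Num.min L mu) (10 * L ^+ 2).
- by exists (row_mx x0 y0); rewrite /C/= row_mxKl row_mxKr.
- apply: closedI.
    apply: (@closed_comp _ _ (@lsubmx R 1 n p) X) (domX_closed H).
    by move=> c _; exact: lsub.
  apply: (@closed_comp _ _ (@rsubmx R 1 n p) Y) (domY_closed H).
  by move=> c _; exact: rsub.
- move=> a b t [Xa Ya] [Xb Yb] t0 t1; split => /=.
    have -> : lsubmx (a + t *: (b - a)) = lsubmx a + t *: (lsubmx b - lsubmx a).
      by apply/rowP => i; rewrite !mxE.
    exact: (domX_segment H).
  have -> : rsubmx (a + t *: (b - a)) = rsubmx a + t *: (rsubmx b - rsubmx a).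
    by apply/rowP => i; rewrite !mxE.
  exact: (domY_segment H).
- by rewrite lt_min L_gt0.
- move=> v w [Xv Yv] [Xw Yw].
  have := @prox_monotone z (lsubmx w, rsubmx w) (lsubmx v, rsubmx v).
  move=> /(_ (conj Xw Yw) (conj Xv Yv)) /=.
  rewrite -[v - w]hsubmxK sq_row_mx /M !linearB /=.
  have -> : row_mx (prox_gradx z (lsubmx v, rsubmx v))
      (- gy (lsubmx v, rsubmx v)) -
    row_mx (prox_gradx z (lsubmx w, rsubmx w)) (- gy (lsubmx w, rsubmx w))
    = row_mx (prox_gradx z (lsubmx v, rsubmx v)
              - prox_gradx z (lsubmx w, rsubmx w))
        (- (gy (lsubmx v, rsubmx v) - gy (lsubmx w, rsubmx w))).
    by rewrite opp_row_mx add_row_mx opprB opprK (addrC (- gy _)).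
  rewrite dot_row_mx dotNl => Hm; apply: le_trans Hm.
  by rewrite mulrDr lerD// ler_wpM2r ?sq_ge0// ge_min lexx ?orbT.
- move=> v w [Xv Yv] [Xw Yw].
  have := @prox_gradient_lipschitz z (lsubmx v, rsubmx v) (lsubmx w, rsubmx w).
  move=> /(_ (conj Xv Yv) (conj Xw Yw)) /=.
  rewrite -[v - w]hsubmxK sq_row_mx /M !linearB /=.
  rewrite opp_row_mx add_row_mx sq_row_mx.
  by rewrite -opprD sqN.
exists (lsubmx w, rsubmx w); split=> //= [x Xx|y Yy].
  have := wP (row_mx x (rsubmx w)).
  rewrite /C /= row_mxKl row_mxKr => /(_ (conj Xx Yw)).
  rewrite -[X in row_mx x _ - X](hsubmxK w) opp_row_mx add_row_mx subrr.
  by rewrite dot_row_mx dot0r addr0.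
have := wP (row_mx (lsubmx w) y).
rewrite /C /= row_mxKl row_mxKr => /(_ (conj Xw Yy)).
rewrite -[X in row_mx _ y - X](hsubmxK w) opp_row_mx add_row_mx subrr.
by rewrite dot_row_mx dot0r add0r dotNl oppr_ge0.
Qed.

Definition saddle z : 'rV[R]_n * 'rV[R]_p := get (is_saddle z).

Lemma saddleP z : is_saddle z (saddle z).
Proof. by have [u Hu] := exists_saddle z; exact: (getPex (ex_intro _ u Hu)). Qed.

Lemma saddle_dom z : (X `*` Y) (saddle z).
Proof. by have [] := saddleP z. Qed.

Definition envelope z : R := prox_val z (saddle z).

Lemma envelope_le z x : X x ->
  envelope z + L / 2 * sq (x - (saddle z).1) <= prox_val z (x, (saddle z).2).
Proof.
rewrite /envelope; have [] := saddleP z; case: (saddle z) => xs ys /= Xs Ys Hx _ Xx.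
have := prox_convex z Xs Xx Ys; have := Hx _ Xx; lra.
Qed.

Lemma envelope_ge z y : Y y ->
  prox_val z ((saddle z).1, y) + mu / 2 * sq (y - (saddle z).2) <= envelope z.
Proof.
rewrite /envelope; have [] := saddleP z; case: (saddle z) => xs ys /= Xs Ys _ Hy Yy.
have := prox_concave z Xs Ys Yy; have := Hy _ Yy; lra.
Qed.

(** Playing the old [x] against the new [y] in the two saddle inequalities leaves
    only the change of the proximal term, which is quadratic in the centre. *)
Lemma envelope_smooth z z' :
  envelope z' <= envelope z + 2 * L * dot (z - (saddle z).1) (z' - z)
                 + L * sq (z' - z).
Proof.
have [Xs Ys] := saddle_dom z; have [Xs' Ys'] := saddle_dom z'.
have := envelope_le z' Xs; have := envelope_ge z Ys'.
have := sq_ge0 ((saddle z').2 - (saddle z).2).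
have := sq_ge0 ((saddle z).1 - (saddle z').1).
rewrite /prox_val /=.
have -> : (saddle z).1 - z' = ((saddle z).1 - z) - (z' - z).
  by apply/rowP => i; rewrite !mxE; ring.
rewrite (sqB (_ - z)) -(opprB (saddle z).1 z) dotNl.
move=> /(mulr_ge0 (ltW L_gt0)) + /(mulr_ge0 (ltW mu_gt0)); lra.
Qed.

(** The optimality conditions at the two saddle points, added to strong
    monotonicity; only the primal field depends on the centre. *)
Lemma saddle_shift z z' :
  L * sq ((saddle z').1 - (saddle z).1) + mu * sq ((saddle z').2 - (saddle z).2)
    <= 2 * L * dot (z' - z) ((saddle z').1 - (saddle z).1).
Proof.
have Cs := saddle_dom z; have Cs' := saddle_dom z'.
have [_ _ Hx Hy] := saddleP z; have [_ _ Hx' Hy'] := saddleP z'.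
have := prox_monotone z Cs Cs'.
have := Hx _ Cs'.1; have := Hy _ Cs'.2; have := Hx' _ Cs.1; have := Hy' _ Cs.2.
rewrite -(opprB (saddle z').1) -(opprB (saddle z').2) !dotNr.
have -> : prox_gradx z' (saddle z') =
    prox_gradx z (saddle z') - (2 * L) *: (z' - z).
  by rewrite /prox_gradx; apply/rowP => i; rewrite !mxE; ring.
move: (prox_gradx z _) (prox_gradx z _) => g g'.
rewrite !(dotDl, dotNl, dotZl); lra.
Qed.

Lemma saddle_x_lipschitz z z' :
  sq ((saddle z').1 - (saddle z).1) <= 4 * sq (z' - z).
Proof.
have := saddle_shift z z'.
have := mulr_ge0 (ltW mu_gt0) (sq_ge0 ((saddle z').2 - (saddle z).2)).
have := @young R _ 1 (1 / 4) (z' - z) ((saddle z').1 - (saddle z).1).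
rewrite ler_norml => /(_ _ _ _)/andP[]; [lra|lra|lra|] => _ Y1 Y2 Y3.
rewrite -(ler_pM2l L_gt0); have := ler_wpM2l (ltW L_gt0) Y1; lra.
Qed.

Lemma saddle_y_lipschitz z z' :
  mu * sq ((saddle z').2 - (saddle z).2) <= L * sq (z' - z).
Proof.
have := saddle_shift z z'.
have := @young R _ (1 / 2) (1 / 2) (z' - z) ((saddle z').1 - (saddle z).1).
rewrite ler_norml => /(_ _ _ _)/andP[]; [lra|lra|lra|] => _ Y1.
have := ler_wpM2l (ltW L_gt0) Y1; lra.
Qed.

End saddle.

(** * Energy balance of one iteration *)

(** The estimates of this part are pure vector algebra, in the units where the
    smoothness constant is 1: the step is [eta], the strong concavity modulus is
    [128 * g ^+ 2], [A] and [B] are minus the primal and plus the dual discrete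
    velocity, [Q] and [r] the displacements from the saddle point. *)

Section balance.
Context {R : realType} {n p : nat}.
Implicit Types (a b g k : R).

Lemma young_both {m} a b (u v : 'rV[R]_m) : 0 <= a -> 0 <= b -> 1 <= 4 * a * b ->
  dot u v <= a * sq u + b * sq v /\ - dot u v <= a * sq u + b * sq v.
Proof. by move=> a0 b0 ab; have := young u v a0 b0 ab; rewrite ler_norml; lra. Qed.

Notation eta := (1 / 192 : R).

Variable g : R.
Hypothesis g_gt0 : 0 < g.
Hypothesis g_le : g <= 1 / 11.

Let g_ge0 : 0 <= g := ltW g_gt0.

Let gM t : 0 <= t -> g * t <= 1 / 11 * t.
Proof. by move=> t0; rewrite ler_wpM2r. Qed.

Let gM2 t u : t <= u -> g * t <= g * u.
Proof. by move=> tu; rewrite ler_wpM2l. Qed.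

(** Velocity energy: [X'] and [D'] are the new primal and dual velocities up to
    the errors [ex] and [ey], [dv] is the exact update of the momentum, [gain]
    the increase of the regularised objective. *)
Lemma velocity_energy (A ex dX : 'rV[R]_n) (B ey dD w nu2 : 'rV[R]_p)
    (gain : R) :
  let X' := A + ex in let D' := B - ey in
  let dv := eta *: (- g *: D' + (1 / 2) *: w + (1 / 2 - g) *: nu2) in
  eta * sq A <= - dot dX A - dot (dD - dv) B ->
  eta * dot w B - eta * dot (X' - dX) A <= gain ->
  1 / 2 * (sq X' - sq (X' - dX)) + 1 / 2 * (sq D' - sq (D' - dD))
     - 1 / 2 * gain
  <= - (eta * g) * sq B + eta * g * dot ey B + eta * (1 / 2 - g) * dot nu2 B
     - eta / 2 * sq A + eta / 2 * (dot ex A - dot dX A)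
     + dot dX ex - dot dD ey - 1 / 2 * sq dX - 1 / 2 * sq dD.
Proof.
move=> X' D' dv; rewrite /X' /D' /dv !sqB !sqD /sq !dotE.
rewrite (dotC ex A) (dotC dX A) (dotC ex dX) (dotC ey B) (dotC dD B) (dotC ey dD).
lra.
Qed.

(** Displacement energy: the cross term [dot v r] turns the strong
    concavity into dissipation of the distance to the saddle point. *)
Lemma displacement_energy (A ex dX Q : 'rV[R]_n)
    (B ey dD w nu2 r : 'rV[R]_p) (gain : R) :
  let X' := A + ex in let D' := B - ey in
  let dv := eta *: (- g *: D' + (1 / 2) *: w + (1 / 2 - g) *: nu2) in
  let v := D' - w in
  gain <= - (eta * dot X' A) + eta * dot (w - (dD - dv)) B ->
  dot w r - dot X' Q <= - (128 * g ^+ 2) * sq r - sq Q ->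
  dot v r - dot (v - dv) (r - eta *: B)
    + g / 2 * (sq r - sq (r - eta *: B))
    + 1 / 4 * (sq Q - sq (Q + eta *: A)) + gain
  <= eta * (- (64 * g ^+ 2) * sq r - 1 / 2 * sq Q
       + (1 / 2 - g) * dot nu2 r + g * dot ey r + 1 / 2 * dot ex Q
       + sq B - dot ey B - dot dD B - sq A - dot ex A).
Proof.
move=> X' D' dv v; rewrite /v /X' /D' /dv.
have := sq_ge0 A; have := sq_ge0 B; have := mulr_ge0 g_ge0 (sq_ge0 B).
rewrite !sqB !sqD !sqZ /sq !dotE.
rewrite (dotC ex A) (dotC Q A) (dotC r B) (dotC ey B) (dotC dD B)
   (dotC w B) (dotC nu2 B) (dotC w r) (dotC nu2 r) (dotC ey r).
lra.
Qed.

Lemma velocity_bound (A ex dX : 'rV[R]_n) (B ey dD nu2 : 'rV[R]_p) :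
  - (eta * g) * sq B + eta * g * dot ey B + eta * (1 / 2 - g) * dot nu2 B
     - eta / 2 * sq A + eta / 2 * (dot ex A - dot dX A)
     + dot dX ex - dot dD ey - 1 / 2 * sq dX - 1 / 2 * sq dD
  <= - (3 / 4 * eta) * (g * sq B) - eta / 4 * sq A
     - (3 / 8 - eta / 2) * sq dX - 3 / 8 * sq dD
     + 3 * (sq ex + sq ey) + eta * (1 / 2 - g) * dot nu2 B.
Proof.
have [Y1 _] := @young_both _ 1 (1 / 4) ey B ltac:(lra) ltac:(lra) ltac:(lra).
have [Y2 _] := @young_both _ 1 (1 / 4) ex A ltac:(lra) ltac:(lra) ltac:(lra).
have [_ Y3] := @young_both _ 1 (1 / 4) dX A ltac:(lra) ltac:(lra) ltac:(lra).
have [Y4 _] := @young_both _ (1 / 8) 2 dX ex ltac:(lra) ltac:(lra) ltac:(lra).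
have [_ Y5] := @young_both _ (1 / 8) 2 dD ey ltac:(lra) ltac:(lra) ltac:(lra).
have := gM2 Y1; have := gM (sq_ge0 ey).
have := sq_ge0 ex; have := sq_ge0 ey; lra.
Qed.

Variable k : R.
Hypothesis k_ge0 : 0 <= k.
Hypothesis k_le : k <= 1 / 384.

(** The part of the gradient error paired with the predictor
    displacement [Xt], [Yt] is kept apart, because it averages out, whereas the
    remaining displacement [Px], [Py] is small. *)
Lemma displacement_bound (A ex Q sx n1x Xt Px : 'rV[R]_n)
    (B ey dD nu2 r sy n1y Yt Py : 'rV[R]_p) :
  ex = sx - n1x -> ey = (1 + k) *: sy + (1 + k) *: n1y - k *: nu2 ->
  Q = Xt + Px -> r = Yt + Py ->
  - (64 * g ^+ 2) * sq r - 1 / 2 * sq Q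
       + (1 / 2 - g) * dot nu2 r + g * dot ey r + 1 / 2 * dot ex Q
       + sq B - dot ey B - dot dD B - sq A - dot ex A
  <= - (63 * g ^+ 2) * sq r - 3 / 8 * sq Q + 3 / 2 * sq B
     + (sq sx + sq sy) + (sq n1x + sq n1y) + (sq Px + sq Py)
     + (sq ex + sq ey) + sq dD
     + ((1 / 2 - g - g * k) * dot nu2 r + g * (1 + k) * dot n1y Yt
        - 1 / 2 * dot n1x Xt).
Proof.
move=> Eex Eey EQ Er; have [g1 k0 k1] := And3 g_le k_ge0 k_le.
have gk : 0 <= (g * (1 + k)) ^+ 2 <= 1.
  rewrite sqr_ge0/= expr_le1 ?mulr_ge0 ?addr_ge0//.
  have := gM (_ : 0 <= 1 + k); lra.
have gk' : (1 + k) ^+ 2 <= 2 by rewrite expr2; nra.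
have [Y1 _] := @young_both _ 1 (1 / 4) sy ((g * (1 + k)) *: r) ltac:(lra) ltac:(lra) ltac:(lra).
have [Y2 _] := @young_both _ 1 (1 / 4) n1y ((g * (1 + k)) *: Py) ltac:(lra) ltac:(lra) ltac:(lra).
have [Y3 _] := @young_both _ 1 (1 / 4) sx Q ltac:(lra) ltac:(lra) ltac:(lra).
have [_ Y4] := @young_both _ 1 1 n1x Px ltac:(lra) ltac:(lra) ltac:(lra).
have [_ Y5] := @young_both _ 1 (1 / 4) ey B ltac:(lra) ltac:(lra) ltac:(lra).
have [_ Y6] := @young_both _ 1 (1 / 4) dD B ltac:(lra) ltac:(lra) ltac:(lra).
have [_ Y7] := @young_both _ (1 / 4) 1 ex A ltac:(lra) ltac:(lra) ltac:(lra).
have E1 : dot ey r = (1 + k) * dot sy r + (1 + k) * dot n1y Yt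
   + (1 + k) * dot n1y Py - k * dot nu2 r.
  by rewrite Eey !(dotDl, dotNl, dotZl) {2}Er dotDr; ring.
have E2 : dot ex Q = dot sx Q - dot n1x Xt - dot n1x Px.
  by rewrite Eex dotDl dotNl {2}EQ dotDr; ring.
move: Y1 Y2; rewrite !dotZr !sqZ => Y1 Y2.
have Z1 : 1 / 4 * ((g * (1 + k)) ^+ 2 * sq r) <= g ^+ 2 * sq r.
  have := ler_wpM2r (mulr_ge0 (sqr_ge0 g) (sq_ge0 r)) gk'.
  by have := mulr_ge0 (sqr_ge0 g) (sq_ge0 r); rewrite exprMn; lra.
have Z2 : (g * (1 + k)) ^+ 2 * sq Py <= 1 * sq Py.
  by rewrite ler_wpM2r ?sq_ge0//; lra.
rewrite E1 E2.
have := sq_ge0 ex; have := sq_ge0 Px; have := sq_ge0 Py; have := sq_ge0 n1x.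
have := sq_ge0 sx; have := sq_ge0 n1y.
move: Y3 Y4 Y5 Y6 Y7; lra.
Qed.

Lemma momentum_bound (B ey nu2 v : 'rV[R]_p) :
  - (1 / 2) * sq v + (1 / 2 - g) * dot (B - ey) v + (1 / 2 - g) * dot nu2 v
  <= - (1 / 4) * sq v + 1 / 2 * sq B + sq ey + sq nu2.
Proof.
have g1 := g_le; have c0 : 0 <= 1 / 2 - g by lra.
have [Y1 _] := @young_both _ 1 (1 / 4) B v ltac:(lra) ltac:(lra) ltac:(lra).
have [_ Y2] := @young_both _ 2 (1 / 8) ey v ltac:(lra) ltac:(lra) ltac:(lra).
have [Y3 _] := @young_both _ 2 (1 / 8) nu2 v ltac:(lra) ltac:(lra) ltac:(lra).
have := ler_wpM2l c0 Y1; have := ler_wpM2l c0 Y2; have := ler_wpM2l c0 Y3.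
have := mulr_ge0 g_ge0 (sq_ge0 v); have := mulr_ge0 g_ge0 (sq_ge0 B).
have := mulr_ge0 g_ge0 (sq_ge0 ey); have := mulr_ge0 g_ge0 (sq_ge0 nu2).
rewrite dotDl dotNl; lra.
Qed.

Notation beta := (eta * g / 256).

(** Moving the proximal centre by [beta * Z] perturbs the saddle point by
    [Xs] and [Ys]; the choice of [beta] makes this affordable. *)
Lemma centre_bound (A ex Q Z Xs : 'rV[R]_n) (r v Ys : 'rV[R]_p) :
  sq Xs <= 4 * beta ^+ 2 * sq Z -> 128 * g ^+ 2 * sq Ys <= beta ^+ 2 * sq Z ->
  - (2 * beta) * sq Z + 2 * (3 / 2 - g / 4) * beta * dot Q Z + beta ^+ 2 * sq Z
    - 2 * beta * dot (A + ex) Z + 2 * beta ^+ 2 * sq Z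
    + g / 4 * (- dot v Ys - g * dot r Ys + g / 2 * sq Ys - 1 / 2 * dot Q Xs
               + 1 / 4 * sq Xs)
  <= - (9 / 10 * beta) * sq Z + 7 * beta * sq Q + 4 * beta * (sq A + sq ex)
     + g / 4 * eta * (1 / 16 * sq v + g ^+ 2 * sq r).
Proof.
move=> HX HY; have g1 := g_le.
have Hys : g * sq Ys <= g * eta ^+ 2 / 256 / 256 / 128 * sq Z.
  rewrite -(ler_pM2l (_ : 0 < 128 * g)) ?mulr_gt0//.
  by move: HY; lra.
have Zg := mulr_ge0 g_ge0 (sq_ge0 Z).
have Zg2 := gM Zg.
have Zg3 : g ^+ 3 * sq Z <= 1 / 121 * (g * sq Z).
  by have := gM (mulr_ge0 g_ge0 Zg); move: Zg2; lra.
have [Y1 _] := @young_both _ (3 / 2) (1 / 6) Q Z ltac:(lra) ltac:(lra) ltac:(lra).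
have [_ Y2] := @young_both _ 2 (1 / 8) A Z ltac:(lra) ltac:(lra) ltac:(lra).
have [_ Y3] := @young_both _ 2 (1 / 8) ex Z ltac:(lra) ltac:(lra) ltac:(lra).
have [_ Y4] := @young_both _ (1 / 3072) 768 v Ys ltac:(lra) ltac:(lra) ltac:(lra).
have [_ Y5] := @young_both _ (1 / 192) 48 (g *: r) Ys ltac:(lra) ltac:(lra) ltac:(lra).
have [_ Y6] := @young_both _ (1 / 3072) 768 Q Xs ltac:(lra) ltac:(lra) ltac:(lra).
have Y1' : 2 * (3 / 2 - g / 4) * beta * dot Q Z
    <= 2 * (3 / 2 - g / 4) * beta * (3 / 2 * sq Q + 1 / 6 * sq Z).
  have c0 : 0 <= 2 * (3 / 2 - g / 4) by lra.
  have b0 : 0 <= beta by rewrite !mulr_ge0 ?invr_ge0.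
  by rewrite ler_wpM2l// mulr_ge0.
have Qg := mulr_ge0 g_ge0 (sq_ge0 Q).
have Qg2 := mulr_ge0 g_ge0 Qg.
have Yg2 : g * (g * sq Ys) <= 1 / 11 * (g * sq Ys).
  exact: gM (mulr_ge0 g_ge0 (sq_ge0 Ys)).
have := gM2 Y2; have := gM2 Y3; have := gM2 Y4; have := gM2 Y5; have := gM2 Y6.
have := gM2 HX.
have := mulr_ge0 g_ge0 Zg.
rewrite dotZl sqZ dotDl; lra.
Qed.

(** The four bounds add up to a decrease by the squared residual: the
    displacement error [P] of the extragradient predictor is of second order,
    so the errors [ex] and [ey] are absorbed by the increments [dX] and [dD]
    up to noise. *)
Lemma total_balance (a b exx eyy xx dd q r v z s P n0 n1 n2 m1 m2 : R)
    (T1 T2 T3 T4 Rs : R) :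
  0 <= a -> 0 <= b -> 0 <= exx -> 0 <= eyy -> 0 <= xx -> 0 <= dd -> 0 <= q ->
  0 <= r -> 0 <= v -> 0 <= z -> 0 <= s -> 0 <= P -> 0 <= n0 -> 0 <= n1 ->
  0 <= n2 ->
  exx + eyy <= 4 * s + 4 * n1 + n2 -> s <= 10 * P ->
  P <= 1 / 12288 * (xx + dd + n0 + exx + eyy) ->
  T1 <= - (3 / 4 * eta) * (g * b) - eta / 4 * a
     - (3 / 8 - eta / 2) * xx - 3 / 8 * dd + 3 * (exx + eyy) + m1 ->
  T2 <= - (63 * g ^+ 2) * r - 3 / 8 * q + 3 / 2 * b + s + n1 + P
     + (exx + eyy) + dd + m2 ->
  T3 <= - (1 / 4) * v + 1 / 2 * b + eyy + n2 ->
  T4 <= - (9 / 10 * beta) * z + 7 * beta * q + 4 * beta * (a + exx)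
     + g / 4 * eta * (1 / 16 * v + g ^+ 2 * r) ->
  Rs <= 3 * (a + exx + 4 * z) + 3 * (b + eyy + v) ->
  T1 + g / 4 * (eta * T2) + g / 4 * (eta * T3) + T4
  <= - (beta / 64) * Rs + 20 * (n0 + n1 + n2) + (m1 + g / 4 * (eta * m2)).
Proof.
move=> a0 b0 ex0 ey0 x0 d0 q0 r0 v0 z0 s0 P0 n00 n10 n20 He Hs HP H1 H2 H3 H4 H5.
have g1 := g_le; have g0 := g_ge0.
have G1 := gM a0; have G2 := gM ex0; have G3 := gM ey0; have G4 := gM d0.
have G5 := gM s0; have G6 := gM P0; have G7 := gM n10; have G8 := gM n20.
have I1 := mulr_ge0 g0 b0; have I2 := mulr_ge0 g0 q0; have I3 := mulr_ge0 g0 v0.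
have I4 := mulr_ge0 g0 z0.
have I5 : 0 <= g * (g ^+ 2 * r) by rewrite !mulr_ge0 ?sqr_ge0.
have J2 := gM2 H2; have J3 := gM2 H3; have J5 := gM2 H5.
lra.
Qed.

(** Bookkeeping: the increments of the separate terms of the potential, with their
    weights, add up to the increment of the potential. *)
Lemma energy_difference (Lm e pv pv' sX sX' sD sD' d d' sr sr' sQ sQ' sv sv'
    Enew T1 T2 T3 T4 bound : R) :
  Enew - (Lm * e + 1 / 2 * sX' + 1 / 2 * sD' + 1 / 2 * (Lm * (e - pv'))
    + g / 4 * (d' + g / 2 * sr' + 1 / 4 * sQ' + Lm * (pv' - e)) + g / 8 * sv')
    <= T4 ->
  1 / 2 * (sX' - sX) + 1 / 2 * (sD' - sD) - 1 / 2 * (Lm * (pv' - pv)) <= T1 ->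
  d' - d + g / 2 * (sr' - sr) + 1 / 4 * (sQ' - sQ) + Lm * (pv' - pv)
    <= eta * T2 ->
  1 / 2 * (sv' - sv) <= eta * T3 ->
  T1 + g / 4 * (eta * T2) + g / 4 * (eta * T3) + T4 <= bound ->
  Enew - (Lm * e + 1 / 2 * sX + 1 / 2 * sD + 1 / 2 * (Lm * (e - pv))
    + g / 4 * (d + g / 2 * sr + 1 / 4 * sQ + Lm * (pv - e)) + g / 8 * sv)
    <= bound.
Proof. by move=> E4 E1 /gM2 E2 /gM2 E3; lra. Qed.

End balance.

(** * Potential function of the method *)

Section descent.
Context {R : realType} {n p : nat}.
Variables (X : set 'rV[R]_n) (Y : set 'rV[R]_p).
Variable F : 'rV[R]_n * 'rV[R]_p -> R.
Variables (gx : 'rV[R]_n * 'rV[R]_p -> 'rV[R]_n).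
Variables (gy : 'rV[R]_n * 'rV[R]_p -> 'rV[R]_p).
Variables L mu g : R.
Hypothesis H : smooth_concave X Y F gx gy L mu.
Hypothesis g_gt0 : 0 < g.
Hypothesis g_le : g <= 1 / 11.
Hypothesis muE : mu = 128 * L * g ^+ 2.

Let L_gt0 : 0 < L := smooth_gt0 H.

Local Notation pv := (prox_val F L).
Local Notation pg := (prox_gradx gx L).
Local Notation sad := (saddle X Y gx gy L).
Local Notation env := (envelope X Y F gx gy L).

Local Notation eta := (1 / 192 : R).
Local Notation beta := (eta * g / 256).

(** The step parameters enter only through these three identities: [alpha] and
    [k] discretise friction [g] and forcing [1 / 2 - g] implicitly. *)
Variables h alpha k : R.
Hypothesis hL : L * h = eta.
Hypothesis alphaE : (1 + eta * g) * alpha = 1.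
Hypothesis kE : (1 + eta * g) * k = eta * (1 / 2 - g).

Let eq_le (a b : R) : a = b -> a <= b.
Proof. by move=> ->. Qed.

Let h_gt0 : 0 < h.
Proof. by rewrite -(pmulr_rgt0 _ L_gt0) hL. Qed.

Definition velocity_x z x xi y : 'rV[R]_n := pg z (x, y) + xi.
Definition velocity_y x y nn v : 'rV[R]_p := gy (x, y) - nn + v.

(** The first line is the envelope with the kinetic energies, the second the gap
    of the regularised objective to its saddle value; the bracket couples the
    momentum with the displacement from the saddle point, which is what turns
    strong concavity into dissipation. *)
Definition energy z x xi y nn v : R :=
  L * env z + 1 / 2 * sq (velocity_x z x xi y) + 1 / 2 * sq (velocity_y x y nn v)
  + 1 / 2 * (L * (env z - pv z (x, y)))
  + g / 4 * (dot v (L *: (y - (sad z).2)) + g / 2 * sq (L *: (y - (sad z).2))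
             + 1 / 4 * sq (L *: (x - (sad z).1)) + L * (pv z (x, y) - env z))
  + g / 8 * sq v.

(** The centre moves after the other variables, so its effect on the potential is
    separated from the rest of the iteration. *)
Lemma energy_recenter z z' x xi y nn v Xv Q r Z Xs Ys :
  X x -> Y y -> z' = z + beta *: (x - z) ->
  Xv = velocity_x z x xi y ->
  Q = L *: (x - (sad z).1) -> r = L *: (y - (sad z).2) -> Z = L *: (x - z) ->
  Xs = L *: ((sad z').1 - (sad z).1) -> Ys = L *: ((sad z').2 - (sad z).2) ->
  [/\ energy z' x xi y nn v - energy z x xi y nn v <=
  - (2 * beta) * sq Z + 2 * (3 / 2 - g / 4) * beta * dot Q Z + beta ^+ 2 * sq Z
    - 2 * beta * dot Xv Z + 2 * beta ^+ 2 * sq Z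
    + g / 4 * (- dot v Ys - g * dot r Ys + g / 2 * sq Ys - 1 / 2 * dot Q Xs
               + 1 / 4 * sq Xs),
   sq Xs <= 4 * beta ^+ 2 * sq Z & 128 * g ^+ 2 * sq Ys <= beta ^+ 2 * sq Z].
Proof.
move=> Xx Yy Ez XvE QE rE ZE XsE YsE.
have Ed : z' - z = beta *: (x - z) by rewrite Ez addrAC subrr add0r.
split.
- have g1 := g_le; have g0 := g_gt0.
  have Eenv := envelope_smooth H z z'.
  have Exv : velocity_x z' x xi y = Xv - (2 * beta) *: Z.
    rewrite XvE /velocity_x /prox_gradx ZE Ez /=.
    by apply/rowP => i; rewrite !mxE; ring.
  have Epv : L * pv z' (x, y) = L * pv z (x, y) - 2 * beta * sq Z + beta ^+ 2 * sq Z.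
    rewrite /prox_val /=; have -> : x - z' = (x - z) - beta *: (x - z).
      by rewrite -Ed; apply/rowP => i; rewrite !mxE; ring.
    by rewrite ZE (sqB (x - z)) !sqZ dotZr -/(sq (x - z)); ring.
  have Er : L *: (y - (sad z').2) = r - Ys.
    by rewrite rE YsE -scalerBr; congr (_ *: _); apply/rowP => i; rewrite !mxE; ring.
  have Eq : L *: (x - (sad z').1) = Q - Xs.
    by rewrite QE XsE -scalerBr; congr (_ *: _); apply/rowP => i; rewrite !mxE; ring.
  have Env : L * env z' <= L * env z + 2 * beta * dot Q Z - 2 * beta * sq Z
      + beta ^+ 2 * sq Z.
    apply: (le_trans (ler_wpM2l (ltW L_gt0) Eenv)).
    have -> : z - (sad z).1 = (x - (sad z).1) - (x - z).
      by apply/rowP => i; rewrite !mxE; ring.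
    rewrite Ed QE ZE !sqZ dotZr dotDl dotNl !dotZl !dotZr -/(sq (x - z)).
    by apply: eq_le; ring.
  rewrite /energy Exv Er Eq -XvE -QE -rE (sqB Xv) (sqB r) (sqB Q) !sqZ !dotZr.
  rewrite (dotDr v) dotNr !mulrBr Epv.
  have c0 : 0 <= 3 / 2 - g / 4 by lra.
  have := ler_wpM2l c0 Env; lra.
- have := saddle_x_lipschitz H z z'.
  rewrite XsE ZE Ed !sqZ => /(ler_wpM2l (sqr_ge0 L)); lra.
have := saddle_y_lipschitz H z z'.
rewrite muE YsE ZE Ed !sqZ => /(ler_wpM2l (ltW L_gt0)); lra.
Qed.

Section iteration.
Variables (z x xi : 'rV[R]_n) (y nn v : 'rV[R]_p).
Variables (g0x g1x : 'rV[R]_n) (g0y g1y g2y : 'rV[R]_p).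
Hypotheses (Xx : X x) (Yy : Y y).
Hypotheses (Nx : normal_cone X x xi) (Ny : normal_cone Y y nn).
Variables (xt x' xi' z' : 'rV[R]_n) (yt y' nn' v' : 'rV[R]_p).
Hypothesis xtE : xt = proj X (x - h *: (g0x + (2 * L) *: (x - z) + xi)).
Hypothesis ytE : yt = proj Y (y + h *: (g0y - nn + v)).
Hypothesis x'E : x' = proj X (x - h *: (g1x + (2 * L) *: (xt - z))).
Hypothesis xi'E : xi' = h^-1 *: (x - x') - g1x - (2 * L) *: (xt - z).
Hypothesis y'E : y' = proj Y (y + h *: (g1y + (alpha *: v + k *: g1y))).
Hypothesis nn'E :
  nn' = (1 + k)^-1 *: (h^-1 *: (y - y') + g1y + (alpha *: v + k *: g1y)).
Hypothesis v'E : v' = alpha *: v + k *: (g2y - nn').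
Hypothesis z'E : z' = z + beta *: (x' - z).

Let nu0x := g0x - gx (x, y).
Let nu0y := g0y - gy (x, y).
Let nu1x := g1x - gx (xt, yt).
Let nu1y := g1y - gy (xt, yt).
Let nu2 := g2y - gy (x', y').

Let projX w : X (proj X w) /\ normal_cone X (proj X w) (w - proj X w).
Proof.
have Nw := proj_normal w (domX_neq0 H) (domX_closed H) (domX_segment H).
by split=> //; case: Nw.
Qed.

Let projY w : Y (proj Y w) /\ normal_cone Y (proj Y w) (w - proj Y w).
Proof.
have Nw := proj_normal w (domY_neq0 H) (domY_closed H) (domY_segment H).
by split=> //; case: Nw.
Qed.

Lemma iteration_dom : [/\ X xt, Y yt, X x' & Y y'].
Proof.
by rewrite xtE ytE x'E y'E; split; [case: (projX (x - h *: (g0x + (2 * L) *: (x - z) + xi)))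
  |case: (projY (y + h *: (g0y - nn + v)))|case: (projX (x - h *: (g1x + (2 * L) *: (xt - z))))
  |case: (projY (y + h *: (g1y + (alpha *: v + k *: g1y))))].
Qed.

Let eg_gt0 : 0 < 1 + eta * g.
Proof. have g0 := g_gt0; lra. Qed.

Let k_ge0 : 0 <= k.
Proof. by have g1 := g_le; rewrite -(pmulr_rge0 _ eg_gt0) kE; lra. Qed.

Let k_le : k <= 1 / 384.
Proof.
have g1 := g_le; have g0 := g_gt0.
by rewrite -(ler_pM2l eg_gt0) kE; lra.
Qed.

Let k_sq : 3 * (1 + k) ^+ 2 <= 4 /\ 3 * k ^+ 2 <= 1.
Proof.
have k0 := k_ge0; have k1 := k_le.
by split; rewrite expr2; nra.
Qed.

Lemma iteration_normal : normal_cone X x' xi' /\ normal_cone Y y' nn'.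
Proof.
split.
  have [_ Nw] := projX (x - h *: (g1x + (2 * L) *: (xt - z))).
  rewrite -x'E in Nw.
  have -> : xi' = h^-1 *: (x - h *: (g1x + (2 * L) *: (xt - z)) - x').
    rewrite xi'E; apply/rowP => i; rewrite !mxE.
    by field; rewrite gt_eqF.
  by apply: normal_coneZ => //; rewrite invr_ge0 ltW.
have [_ Nw] := projY (y + h *: (g1y + (alpha *: v + k *: g1y))).
rewrite -y'E in Nw.
have -> : nn' = ((1 + k)^-1 * h^-1) *:
    (y + h *: (g1y + (alpha *: v + k *: g1y)) - y').
  rewrite nn'E -scalerA; congr (_ *: _).
  apply/rowP => i; rewrite !mxE.
  by field; rewrite gt_eqF.
apply: normal_coneZ => //; rewrite mulr_ge0 ?invr_ge0 ?(ltW h_gt0)//.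
by rewrite addr_ge0.
Qed.

Variables (A Q : 'rV[R]_n) (B r : 'rV[R]_p).
Hypothesis AE : A = h^-1 *: (x - x').
Hypothesis BE : B = h^-1 *: (y' - y).
Hypothesis QE : Q = L *: (x' - (sad z).1).
Hypothesis rE : r = L *: (y' - (sad z).2).
Let Xv := velocity_x z x xi y.
Let Xv' := velocity_x z x' xi' y'.
Let Dv := velocity_y x y nn v.
Let Dv' := velocity_y x' y' nn' v'.
Let ex := Xv' - A.
Let ey := B - Dv'.
Let w := gy (x', y') - nn'.
Let sx := pg z (x', y') - pg z (xt, yt).
Let sy := gy (xt, yt) - gy (x', y').

Let exE : ex = sx - nu1x.
Proof.
rewrite /ex /Xv' AE /velocity_x xi'E /sx /nu1x /prox_gradx /=.
by apply/rowP => i; rewrite !mxE; ring.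
Qed.

Let dxE : x' - x = - (h *: A).
Proof.
by rewrite AE scalerA divff ?gt_eqF// scale1r opprB.
Qed.

Let dyE : y' - y = h *: B.
Proof. by rewrite BE scalerA divff ?gt_eqF// scale1r. Qed.

Let eyE : ey = (1 + k) *: sy + (1 + k) *: nu1y - k *: nu2.
Proof.
have k1 : 1 + k != 0 by rewrite gt_eqF// ltr_wpDr.
have E : (1 + k) *: nn' = - B + g1y + (alpha *: v + k *: g1y).
  by rewrite nn'E scalerA divff// scale1r BE -scalerN opprB.
have -> : ey = B - gy (x', y') - alpha *: v - k *: g2y + (1 + k) *: nn'.
  rewrite /ey /Dv' /velocity_y v'E.
  by apply/rowP => i; rewrite !mxE; ring.
rewrite E /sy /nu1y /nu2.
by apply/rowP => i; rewrite !mxE; ring.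
Qed.

Let dvE : v' - v = eta *: (- g *: Dv' + (1 / 2) *: w + (1 / 2 - g) *: nu2).
Proof.
have E : (1 + eta * g) *: v' = v + (eta * (1 / 2 - g)) *: (w + nu2).
  rewrite v'E scalerDr !scalerA alphaE scale1r kE; congr (_ + _ *: _).
  by rewrite /w /nu2; apply/rowP => i; rewrite !mxE; ring.
have -> : Dv' = w + v' by [].
apply/rowP => i; move/rowP/(_ i): E; rewrite !mxE.
set a1 := v' 0 i; set a2 := v 0 i; set a3 := nu2 0 i; set a4 := w 0 i.
lra.
Qed.

Let normals : [/\ 0 <= dot xi A, dot xi' A <= 0, dot nn B <= 0 & 0 <= dot nn' B].
Proof.
have [_ _ Xx' Yy'] := iteration_dom; have [[_ Nx'] [_ Ny']] := iteration_normal.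
case: Nx Ny => [_ N1] [_ N2].
have := N1 _ Xx'; have := N2 _ Yy'; have := Nx' _ Xx; have := Ny' _ Yy.
rewrite -(opprB x' x) -(opprB y' y) dxE dyE !dotNr !dotZr.
by rewrite opprK oppr_le0 oppr_le0 !(pmulr_rle0 _ h_gt0) !(pmulr_rge0 _ h_gt0) => -> -> -> ->.
Qed.

(* The normal vectors drop out with the right sign in each of the next four
   inequalities. *)
Let monotone : eta * sq A <= - dot (Xv' - Xv) A - dot (Dv' - Dv - (v' - v)) B.
Proof.
have [_ _ Xx' Yy'] := iteration_dom; have [n1 n2 n3 n4] := normals.
have /= := prox_monotone H z (conj Xx Yy : (X `*` Y) (x, y))
  (conj Xx' Yy' : (X `*` Y) (x', y')).
rewrite dxE dyE sqN !sqZ dotNr !dotZr.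
have -> : pg z (x', y') - pg z (x, y) = (Xv' - Xv) - (xi' - xi).
  by rewrite /Xv' /Xv /velocity_x; apply/rowP => i; rewrite !mxE; ring.
have -> : gy (x', y') - gy (x, y) = (Dv' - Dv - (v' - v)) + (nn' - nn).
  by rewrite /Dv' /Dv /velocity_y; apply/rowP => i; rewrite !mxE; ring.
rewrite (dotDl (Xv' - Xv)) (dotNl (xi' - xi)) (dotDl _ (nn' - nn)).
rewrite (dotDl xi') (dotDl nn') !(dotNl xi, dotNl nn) => M.
have m0 : 0 <= mu * (h ^+ 2 * sq B).
  by rewrite mulr_ge0 ?(ltW (modulus_gt0 H))// mulr_ge0 ?sqr_ge0 ?sq_ge0.
rewrite -(ler_pM2l h_gt0) -hL.
have := ler_wpM2l (ltW h_gt0) n1; have := ler_wpM2l (ltW h_gt0) n2.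
have := ler_wpM2l (ltW h_gt0) n3; have := ler_wpM2l (ltW h_gt0) n4.
lra.
Qed.

Let gain_ge : eta * dot w B - eta * dot Xv A <= L * (pv z (x', y') - pv z (x, y)).
Proof.
have [_ _ Xx' Yy'] := iteration_dom; have [n1 n2 n3 n4] := normals.
have := prox_convex H z Xx Xx' Yy; have := prox_concave H z Xx' Yy' Yy.
rewrite -(opprB y' y) dxE dyE !sqN !dotNr !dotZr.
have -> : pg z (x, y) = Xv - xi by rewrite /Xv /velocity_x addrK.
have -> : gy (x', y') = w + nn' by rewrite /w subrK.
rewrite (dotDl Xv) (dotNl xi) (dotDl w).
have := mulr_ge0 (ltW (modulus_gt0 H)) (sq_ge0 (h *: B)).
have := mulr_ge0 (ltW L_gt0) (sq_ge0 (h *: A)).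
have := ler_wpM2l (ltW h_gt0) n1; have := ler_wpM2l (ltW h_gt0) n4.
rewrite !mulr0 -hL => a1 a2 a3 a4 a5 a6.
have : h * dot w B - h * dot Xv A <= pv z (x', y') - pv z (x, y).
  lra.
by move/(ler_wpM2l (ltW L_gt0)); rewrite mulrBr !mulrA.
Qed.

Let gain_le : L * (pv z (x', y') - pv z (x, y)) <=
  - (eta * dot Xv' A) + eta * dot (w - (Dv' - Dv - (v' - v))) B.
Proof.
have [_ _ Xx' Yy'] := iteration_dom; have [n1 n2 n3 n4] := normals.
have := prox_convex H z Xx' Xx Yy'; have := prox_concave H z Xx Yy Yy'.
rewrite -(opprB x' x) dxE dyE !sqN !dotNr opprK !dotZr.
have -> : pg z (x', y') = Xv' - xi' by rewrite /Xv' /velocity_x addrK.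
have -> : gy (x, y) = (w - (Dv' - Dv - (v' - v))) + nn.
  by rewrite /w /Dv' /Dv /velocity_y; apply/rowP => i; rewrite !mxE; ring.
rewrite (dotDl Xv') (dotNl xi') (dotDl _ nn).
have := mulr_ge0 (ltW (modulus_gt0 H)) (sq_ge0 (h *: B)).
have := mulr_ge0 (ltW L_gt0) (sq_ge0 (h *: A)).
have := ler_wpM2l (ltW h_gt0) n2; have := ler_wpM2l (ltW h_gt0) n3.
rewrite !mulr0 -hL => a1 a2 a3 a4 a5 a6.
have : pv z (x', y') - pv z (x, y) <= - (h * dot Xv' A) +
    h * dot (w - (Dv' - Dv - (v' - v))) B.
  lra.
by move/(ler_wpM2l (ltW L_gt0)); lra.
Qed.

Let saddle_gap : dot w r - dot Xv' Q <= - (128 * g ^+ 2) * sq r - sq Q.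
Proof.
have [_ _ Xx' Yy'] := iteration_dom; have [[_ Nx'] [_ Ny']] := iteration_normal.
have [Xs Ys] := saddle_dom H z.
have := prox_convex H z Xx' Xs Yy'; have := prox_concave H z Xx' Yy' Ys.
have := envelope_le H z Xx'; have := envelope_ge H z Yy'.
have := Nx' _ Xs; have := Ny' _ Ys.
rewrite QE rE !dotZr !sqZ.
rewrite -(opprB x' (sad z).1) -(opprB y' (sad z).2) !sqN !dotNr.
have -> : pg z (x', y') = Xv' - xi' by rewrite /Xv' /velocity_x addrK.
have -> : gy (x', y') = w + nn' by rewrite /w subrK.
rewrite (dotDl Xv') (dotNl xi') (dotDl w) muE => a1 a2 a3 a4 a5 a6.
rewrite -(ler_pM2l (_ : 0 < L^-1)) ?invr_gt0//.
have -> : L^-1 * (L * dot w (y' - (sad z).2) - L * dot Xv' (x' - (sad z).1))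
  = dot w (y' - (sad z).2) - dot Xv' (x' - (sad z).1).
  by field; rewrite gt_eqF.
have -> : L^-1 * (- (128 * g ^+ 2) * (L ^+ 2 * sq (y' - (sad z).2))
    - L ^+ 2 * sq (x' - (sad z).1)) =
  - (128 * L * g ^+ 2) * sq (y' - (sad z).2) - L * sq (x' - (sad z).1).
  by field; rewrite gt_eqF.
lra.
Qed.

(* Predictor and corrector are projections of points that differ by [h] times the
   increments of the velocities plus errors; the constant is 3 / 192 ^ 2. *)
Let predictor : sq (L *: (x' - xt)) + sq (L *: (y' - yt)) <=
  1 / 12288 * (sq (Xv' - Xv) + sq (Dv' - Dv) + (sq nu0x + sq nu0y)
               + sq ex + sq ey).
Proof.
have [_ _ Xx' Yy'] := iteration_dom.
have Px : proj X x' = x'.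
  rewrite -[in LHS](addr0 x'); apply: normal_cone_proj (normal_cone0 Xx').
  - exact: domX_neq0 H.
  - exact: domX_closed H.
  - exact: domX_segment H.
have Py : proj Y y' = y'.
  rewrite -[in LHS](addr0 y'); apply: normal_cone_proj (normal_cone0 Yy').
  - exact: domY_neq0 H.
  - exact: domY_closed H.
  - exact: domY_segment H.
have Bx : sq (x' - xt) <= h ^+ 2 * sq (- (Xv' - Xv) + nu0x + ex).
  rewrite -{1}Px xtE (le_trans (proj_nonexpansive _ _ (domX_neq0 H)
    (domX_closed H) (domX_segment H)))//.
  rewrite -sqZ; apply: eq_le; congr (sq _).
  have -> : x' = x - h *: A by rewrite -dxE addrCA subrr addr0.
  have XvE : Xv = gx (x, y) + (2 * L) *: (x - z) + xi by [].
  rewrite /ex /nu0x XvE.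
  by apply/rowP => i; rewrite !mxE; ring.
have By : sq (y' - yt) <= h ^+ 2 * sq (- (Dv' - Dv) + nu0y + - ey).
  rewrite sq_sym -{1}Py ytE (le_trans (proj_nonexpansive _ _ (domY_neq0 H)
    (domY_closed H) (domY_segment H)))//.
  rewrite -sqZ; apply: eq_le; congr (sq _).
  have -> : y' = y + h *: B by rewrite -dyE addrCA subrr addr0.
  have DvE : Dv = gy (x, y) - nn + v by [].
  rewrite /ey /nu0y DvE.
  by apply/rowP => i; rewrite !mxE; ring.
have := sq_sum3 (- (Xv' - Xv)) nu0x ex; have := sq_sum3 (- (Dv' - Dv)) nu0y (- ey).
rewrite !sqZ (sqN (Xv' - Xv)) (sqN (Dv' - Dv)) (sqN ey).
move=> /(ler_wpM2l (sqr_ge0 eta)) S1 /(ler_wpM2l (sqr_ge0 eta)) S2.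
have := ler_wpM2l (sqr_ge0 L) Bx; have := ler_wpM2l (sqr_ge0 L) By.
rewrite !(mulrA (L ^+ 2) (h ^+ 2)) -!exprMn hL => S3 S4.
by move: S1 S2 S3 S4; clear Bx By Px Py; lra.
Qed.

(** Vectors that the fresh gradient errors are paired with; they are known
    before the corresponding batch is drawn. *)
Definition corrector_weight z y y' : 'rV[R]_p :=
  (eta * (1 / 2 - g)) *: (h^-1 *: (y' - y)) +
  (g / 4 * eta * (1 / 2 - g - g * k)) *: (L *: (y' - (sad z).2)).
Definition predictor_weight_x z xt : 'rV[R]_n :=
  (- (g / 4 * eta / 2)) *: (L *: (xt - (sad z).1)).
Definition predictor_weight_y z yt : 'rV[R]_p :=
  (g / 4 * eta * g * (1 + k)) *: (L *: (yt - (sad z).2)).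

Let pairing : dot nu2 (corrector_weight z y y')
    + dot nu1x (predictor_weight_x z xt) + dot nu1y (predictor_weight_y z yt) =
  eta * (1 / 2 - g) * dot nu2 B + g / 4 * (eta *
    ((1 / 2 - g - g * k) * dot nu2 r
     + g * (1 + k) * dot nu1y (L *: (yt - (sad z).2))
     - 1 / 2 * dot nu1x (L *: (xt - (sad z).1)))).
Proof.
rewrite /corrector_weight /predictor_weight_x /predictor_weight_y.
rewrite -BE -rE (dotDr nu2) !(dotZr _ _ (L *: _)) (dotZr _ _ B) (dotZr _ _ r).
ring.
Qed.

Let velocity_split : A + ex = Xv' /\ B - ey = Dv'.
Proof.
by split; [rewrite addrC subrK|rewrite opprB addrC subrK].
Qed.

Let momentum_split : B - ey - w = v'.
Proof.
by rewrite velocity_split.2 /Dv' /velocity_y addrAC subrr add0r.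
Qed.

Let momentum_energy : 1 / 2 * (sq v' - sq v) <= eta * (- (1 / 2) * sq v' +
    (1 / 2 - g) * dot (B - ey) v' + (1 / 2 - g) * dot nu2 v').
Proof.
have [EA EB] := velocity_split; have Ew := momentum_split.
have Ev : v = v' - (v' - v) by rewrite subKr.
have Ew' : w = Dv' - v' by rewrite -EB -Ew subKr.
rewrite {1}Ev sqB (dotC v') dvE Ew'.
have := sq_ge0 (eta *: (- g *: Dv' + (1 / 2) *: (Dv' - v') + (1 / 2 - g) *: nu2)).
by rewrite EB !(dotZl, dotDl, dotNl) -/(sq v'); lra.
Qed.

Let error_bound : sq ex + sq ey <=
    4 * (sq sx + sq sy) + 4 * (sq nu1x + sq nu1y) + (sq nu2).
Proof.
rewrite exE eyE.
have := sq_sum2 sx (- nu1x); rewrite sqN.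
have := sq_sum3 ((1 + k) *: sy) ((1 + k) *: nu1y) (- (k *: nu2)).
rewrite sqN !sqZ => S3 S2.
have := ler_wpM2r (sq_ge0 sy) k_sq.1; have := ler_wpM2r (sq_ge0 nu1y) k_sq.1.
have := ler_wpM2r (sq_ge0 nu2) k_sq.2; have := sq_ge0 sx; have := sq_ge0 nu1x.
lra.
Qed.

Let error_lipschitz : sq sx + sq sy <= 10 * (sq (L *: (x' - xt)) + sq (L *: (y' - yt))).
Proof.
have [Xxt Yyt Xx' Yy'] := iteration_dom.
have := prox_gradient_lipschitz H z (conj Xx' Yy' : (X `*` Y) (x', y'))
  (conj Xxt Yyt : (X `*` Y) (xt, yt)).
rewrite -/sx (sq_sym (gy _)) -/sy /= !sqZ; lra.
Qed.

Let residual_le : sq (gx (x', y') + xi') + sq (gy (x', y') - nn') <=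
   3 * (sq A + sq ex + 4 * sq (L *: (x' - z))) + 3 * (sq B + sq ey + sq v').
Proof.
have [EA EB] := velocity_split; have Ew := momentum_split.
have -> : gx (x', y') + xi' = A + ex + (- 2) *: (L *: (x' - z)).
  rewrite EA /Xv' /velocity_x /prox_gradx /=.
  by apply/rowP => i; rewrite !mxE; ring.
have -> : gy (x', y') - nn' = B + (- ey) + (- v').
  by rewrite -/w -[w](subKr (B - ey)) Ew.
have := sq_sum3 A ex (- 2 *: (L *: (x' - z))); have := sq_sum3 B (- ey) (- v').
by rewrite !sqN (sqZ (- 2)); lra.
Qed.

Lemma energy_step :
  energy z' x' xi' y' nn' v' - energy z x xi y nn v <=
  - (beta / 64) * (sq (gx (x', y') + xi') + sq (gy (x', y') - nn'))
  + 20 * ((sq nu0x + sq nu0y) + (sq nu1x + sq nu1y) + sq nu2)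
  + (dot nu2 (corrector_weight z y y') + dot nu1x (predictor_weight_x z xt)
     + dot nu1y (predictor_weight_y z yt)).
Proof.
have [Xxt Yyt Xx' Yy'] := iteration_dom.
have [EA EB] := velocity_split; have Ew := momentum_split.
have [Z ZE] : exists Z, Z = L *: (x' - z) by eexists.
have [Xs XsE] : exists Xs, Xs = L *: ((sad z').1 - (sad z).1) by eexists.
have [Ys YsE] : exists Ys, Ys = L *: ((sad z').2 - (sad z).2) by eexists.
have [R1 HXs HYs] := energy_recenter nn' v' Xx' Yy' z'E
  (erefl (velocity_x z x' xi' y')) QE rE ZE XsE YsE.
rewrite -/Xv' in R1.
have T4 := centre_bound g_gt0 g_le A ex Q r v' HXs HYs.
rewrite EA in T4.
have dv' := dvE; rewrite -EB in dv'.
have EX : A + ex - (Xv' - Xv) = Xv by rewrite EA subKr.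
have ED : B - ey - (Dv' - Dv) = Dv by rewrite EB subKr.
have := @velocity_energy R n p g A ex (Xv' - Xv) B ey (Dv' - Dv) w nu2
  (L * (pv z (x', y') - pv z (x, y))).
rewrite /= -dv' EX ED EA EB => /(_ monotone gain_ge) E1.
have Er : r - eta *: B = L *: (y - (sad z).2).
  rewrite rE -hL -scalerA -dyE -scalerBr; congr (_ *: _).
  by apply/rowP => i; rewrite !mxE; ring.
have Eq : Q + eta *: A = L *: (x - (sad z).1).
  rewrite QE -hL -scalerA -[h *: A]opprK -dxE -scalerDr; congr (_ *: _).
  by apply/rowP => i; rewrite !mxE; ring.
have := @displacement_energy R n p g g_gt0 A ex (Xv' - Xv) Q B ey
  (Dv' - Dv) w nu2 r (L * (pv z (x', y') - pv z (x, y))).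
rewrite /= -dv' Ew EA subKr Er Eq => /(_ gain_le saddle_gap) E2.
have V1 := velocity_bound g_gt0 g_le A ex (Xv' - Xv) B ey (Dv' - Dv) nu2.
have Qdec : Q = L *: (xt - (sad z).1) + L *: (x' - xt).
  by rewrite QE -scalerDr; congr (_ *: _); apply/rowP => i; rewrite !mxE; ring.
have rdec : r = L *: (yt - (sad z).2) + L *: (y' - yt).
  by rewrite rE -scalerDr; congr (_ *: _); apply/rowP => i; rewrite !mxE; ring.
have V2 := displacement_bound g_gt0 g_le k_ge0 k_le A B (Dv' - Dv)
  exE eyE Qdec rdec.
have V3 := momentum_bound g_gt0 g_le B ey nu2 v'.
have HR := residual_le; rewrite -ZE in HR.
have := total_balance g_gt0 g_le (sq_ge0 A) (sq_ge0 B) (sq_ge0 ex) (sq_ge0 ey)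
  (sq_ge0 (Xv' - Xv)) (sq_ge0 (Dv' - Dv)) (sq_ge0 Q) (sq_ge0 r) (sq_ge0 v')
  (sq_ge0 Z) (addr_ge0 (sq_ge0 sx) (sq_ge0 sy))
  (addr_ge0 (sq_ge0 (L *: (x' - xt))) (sq_ge0 (L *: (y' - yt))))
  (addr_ge0 (sq_ge0 nu0x) (sq_ge0 nu0y)) (addr_ge0 (sq_ge0 nu1x) (sq_ge0 nu1y))
  (sq_ge0 nu2) error_bound error_lipschitz predictor V1 V2 V3 T4 HR.
rewrite -pairing => TB.
rewrite {2}/energy -/Xv -/Dv.
move: R1; rewrite {2}/energy -/Xv' -/Dv' -QE -rE => R1.
exact: (energy_difference g_gt0 R1 E1 E2 momentum_energy TB).
Qed.

End iteration.

End descent.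

Section energy_range.
Context {R : realType} {n p : nat}.
Variables (X : set 'rV[R]_n) (Y : set 'rV[R]_p).
Variable F : 'rV[R]_n * 'rV[R]_p -> R.
Variables (gx : 'rV[R]_n * 'rV[R]_p -> 'rV[R]_n).
Variables (gy : 'rV[R]_n * 'rV[R]_p -> 'rV[R]_p).
Variables L mu g : R.
Hypothesis H : smooth_concave X Y F gx gy L mu.
Hypothesis g_gt0 : 0 < g.
Hypothesis g_le : g <= 1 / 11.

Let L_gt0 : 0 < L := smooth_gt0 H.

Local Notation pv := (prox_val F L).
Local Notation sad := (saddle X Y gx gy L).
Local Notation env := (envelope X Y F gx gy L).
Local Notation energy := (energy X Y F gx gy L g).

(** Strong convexity from [x] towards the saddle point bounds the gap by the
    velocity, the normal vector being favourable. *)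
Lemma prox_gap z x xi y : X x -> Y y -> normal_cone X x xi ->
  L * (pv z (x, y) - env z) <=
  dot (velocity_x gx L z x xi y) (L *: (x - (sad z).1))
    - 1 / 2 * sq (L *: (x - (sad z).1)).
Proof.
move=> Xx Yy [_ Nx]; have [Xs Ys] := saddle_dom H z.
have := prox_convex H z Xx Xs Yy; have := envelope_ge H z Yy; have := Nx _ Xs.
have -> : prox_gradx gx L z (x, y) = velocity_x gx L z x xi y - xi.
  by rewrite /velocity_x addrK.
move: (velocity_x _ _ _ _ _ _) => V.
have := mulr_ge0 (ltW (modulus_gt0 H)) (sq_ge0 (y - (sad z).2)).
rewrite -(opprB x) sqN !dotNr dotZr sqZ (dotDl V) (dotNl xi) => a1 a2 a3 a4.
have : pv z (x, y) - env z <= dot V (x - (sad z).1) - L / 2 * sq (x - (sad z).1).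
  lra.
by move=> /(ler_wpM2l (ltW L_gt0)); lra.
Qed.

(** The coupling with the momentum and the gap of the regularised objective are
    indefinite, but squares completed against the kinetic energies absorb them. *)
Lemma energy_ge z x xi y nn v : X x -> Y y ->
  normal_cone X x xi -> normal_cone Y y nn -> L * env z <= energy z x xi y nn v.
Proof.
move=> Xx Yy Nx Ny; have [Xs Ys] := saddle_dom H z.
have := prox_gap z Xx Yy Nx; rewrite /energy.
set V := velocity_x _ _ _ _ _ _; set D := velocity_y _ _ _ _ _.
have [q qE] : exists q, q = L *: (x - (sad z).1) by eexists.
have [r rE] : exists r, r = L *: (y - (sad z).2) by eexists.
rewrite -qE -rE => P1.
have [Y1 _] := @young_both _ _ (1 / 2) (1 / 2) V q ltac:(lra) ltac:(lra) ltac:(lra).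
have [_ Y2] := @young_both _ _ (1 / 2) (1 / 2) D (g *: r) ltac:(lra) ltac:(lra) ltac:(lra).
have P2 : dot (gy (x, y) - nn) r <= L * (pv z (x, y) - env z).
  have [_ N] := Ny; have := N _ Ys.
  have := prox_concave H z Xx Yy Ys; have := envelope_le H z Xx.
  have := mulr_ge0 (ltW (modulus_gt0 H)) (sq_ge0 (y - (sad z).2)).
  have := mulr_ge0 (ltW L_gt0) (sq_ge0 (x - (sad z).1)).
  rewrite -(opprB y) sqN !dotNr rE dotZr (dotDl (gy _)) (dotNl nn) => a1 a2 a3 a4 a5.
  rewrite (ler_pM2l L_gt0); lra.
have Ev : dot v r = dot D r - dot (gy (x, y) - nn) r.
  by rewrite {1}/D /velocity_y (dotDl (gy (x, y) - nn)) addrAC subrr add0r.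
move: P1 Y1 Y2 P2; rewrite Ev !dotZr sqZ.
move: (dot (gy _ - nn) r) => c P1 Y1 Y2 P2.
have g0 := g_gt0.
have := sq_ge0 V; have := sq_ge0 D; have := mulr_ge0 (ltW g0) (sq_ge0 v).
have := mulr_ge0 (ltW g0) (sq_ge0 q).
have : g * c <= g * (L * (pv z (x, y) - env z)) by rewrite ler_wpM2l// ltW.
lra.
Qed.

(** The start of the method has zero multipliers and is centred at [x0], so the
    potential is controlled by the gradient and the diameter of [Y]. *)
Lemma initial_energy_le x0 y0 (dY : R) : X x0 -> Y y0 -> 0 <= dY ->
  (forall y, Y y -> enorm y <= dY) ->
  energy x0 x0 0 y0 0 0 <= L * env x0 + L * (2 * dY * enorm (gy (x0, y0)))
    + (sq (gx (x0, y0)) + 2 * sq (gy (x0, y0))) + 3 * (L * dY) ^+ 2.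
Proof.
move=> Xx0 Yy0 d0 HdY; have [Xs Ys] := saddle_dom H x0.
have := prox_gap x0 Xx0 Yy0 (normal_cone0 Xx0); rewrite /energy.
have -> : velocity_x gx L x0 x0 0 y0 = gx (x0, y0).
  by rewrite /velocity_x /prox_gradx /= subrr scaler0 !addr0.
have -> : velocity_y gy x0 y0 0 0 = gy (x0, y0).
  by rewrite /velocity_y subr0 addr0.
have [q qE] : exists q, q = L *: (x0 - (sad x0).1) by eexists.
have [r rE] : exists r, r = L *: (y0 - (sad x0).2) by eexists.
have diam : sq (y0 - (sad x0).2) <= (2 * dY) ^+ 2.
  have := sq_sum2 y0 (- (sad x0).2); rewrite sqN.
  have sqd y : Y y -> sq y <= dY ^+ 2.
    by move=> /HdY yd; rewrite -enorm_sq lerXn2r ?nnegrE ?enorm_ge0.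
  have := sqd _ Yy0; have := sqd _ Ys; lra.
have rd : sq r <= 4 * (L * dY) ^+ 2.
  by rewrite rE sqZ; have := ler_wpM2l (sqr_ge0 L) diam; lra.
rewrite -qE -rE dot0l sq0 => P1.
have gap : L * (env x0 - pv x0 (x0, y0)) <= L * (2 * dY * enorm (gy (x0, y0))).
  rewrite ler_pM2l//.
  have := envelope_le H x0 Xx0; have := concave_above H Xx0 Yy0 Ys.
  have := mulr_ge0 (ltW L_gt0) (sq_ge0 (x0 - (sad x0).1)).
  have := mulr_ge0 (ltW (modulus_gt0 H)) (sq_ge0 ((sad x0).2 - y0)).
  have := dot_CauchySchwarz (gy (x0, y0)) ((sad x0).2 - y0).
  rewrite ler_norml => /andP[_].
  have : enorm (gy (x0, y0)) * enorm ((sad x0).2 - y0)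
      <= enorm (gy (x0, y0)) * (2 * dY).
    rewrite ler_wpM2l ?enorm_ge0// -(@ler_pXn2r _ 2)// ?nnegrE ?enorm_ge0//.
      by rewrite enorm_sq sq_sym.
    by rewrite mulr_ge0.
  rewrite /prox_val /= subrr sq0; lra.
have [Y1 _] := @young_both _ _ 1 (1 / 4) (gx (x0, y0)) q ltac:(lra) ltac:(lra) ltac:(lra).
have g0 := g_gt0; have g1 := g_le.
have S1 := sq_ge0 (gx (x0, y0)); have S2 := sq_ge0 (gy (x0, y0)).
have S3 := sqr_ge0 (L * dY); have S4 := sq_ge0 q; have S5 := sq_ge0 r.
have S6 : 0 <= L * (2 * dY * enorm (gy (x0, y0))).
  by rewrite !mulr_ge0 ?(ltW L_gt0)// enorm_ge0.
move: (pv x0 _) (env x0) gap P1 S6 => P E.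
move: (L * (2 * dY * _)) => N gap P1 S6.
have Q1 : 1 / 4 * sq q <= sq (gx (x0, y0)) + N by lra.
have Q2 : L * (P - E) <= sq (gx (x0, y0)) by lra.
have T : g / 2 * sq r + 1 / 4 * sq q + L * (P - E) <=
    (L * dY) ^+ 2 + 2 * sq (gx (x0, y0)) + N.
  have : g * sq r <= 1 / 11 * (4 * (L * dY) ^+ 2).
    by rewrite ler_pM// ltW.
  lra.
have : g / 4 * (0 + g / 2 * sq r + 1 / 4 * sq q + L * (P - E)) <=
    1 / 44 * ((L * dY) ^+ 2 + 2 * sq (gx (x0, y0)) + N).
  rewrite add0r; apply: (le_trans (ler_wpM2l (_ : 0 <= g / 4) T)); first lra.
  by rewrite ler_wpM2r//; lra.
lra.
Qed.

End energy_range.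

(** * One step of the algorithm on states *)

Section state_step.
Context {R : realType} {n p : nat} {S : Type}.
Variables (X : set 'rV[R]_n) (Y : set 'rV[R]_p).
Variable F : 'rV[R]_n * 'rV[R]_p -> R.
Variables (gx : 'rV[R]_n * 'rV[R]_p -> 'rV[R]_n).
Variables (gy : 'rV[R]_n * 'rV[R]_p -> 'rV[R]_p).
Variable G : 'rV[R]_n * 'rV[R]_p -> S -> 'rV[R]_n * 'rV[R]_p.
Variables L mu g : R.
Hypothesis H : smooth_concave X Y F gx gy L mu.
Hypothesis g_gt0 : 0 < g.
Hypothesis g_le : g <= 1 / 11.
Hypothesis muE : mu = 128 * L * g ^+ 2.
Variables h alpha k beta : R.
Hypothesis hL : L * h = 1 / 192.
Hypothesis alphaE : (1 + 1 / 192 * g) * alpha = 1.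
Hypothesis kE : (1 + 1 / 192 * g) * k = 1 / 192 * (1 / 2 - g).
Hypothesis betaE : beta = 1 / 192 * g / 256.

Implicit Types (st : @state R n p) (b : seq S).

Definition st_point st : 'rV[R]_n * 'rV[R]_p := (st_x st, st_y st).

Definition admissible st : Prop :=
  normal_cone X (st_x st) (st_xi st) /\ normal_cone Y (st_y st) (st_n st).

Definition predicted b st : 'rV[R]_n * 'rV[R]_p :=
  let g0 := (minibatch G (st_point st) b).1 in
  (proj X (st_x st - h *: (g0.1 + (2 * L) *: (st_x st - st_z st) + st_xi st)),
   proj Y (st_y st + h *: (g0.2 - st_n st + st_v st))).

Definition batch_error u b : 'rV[R]_n * 'rV[R]_p :=
  ((minibatch G u b).1.1 - gx u, (minibatch G u b).1.2 - gy u).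

Definition psq (u : 'rV[R]_n * 'rV[R]_p) : R := sq u.1 + sq u.2.

Definition state_energy st : R :=
  energy X Y F gx gy L g (st_z st) (st_x st) (st_xi st) (st_y st) (st_n st)
    (st_v st).

(** The multipliers kept by the method witness the distance to the normal
    cones in the residual. *)
Definition residual_bound st : R :=
  sq (gx (st_point st) + st_xi st) + sq (gy (st_point st) - st_n st).

(** The sampling error of the predictor batch has no pairing: it only displaces
    the predictor. *)
Definition error_pairing b0 b1 b2 st : R :=
  let st' := spde_step X Y G L h alpha k beta b0 b1 b2 st in
  let e1 := batch_error (predicted b0 st) b1 in
  let e2 := batch_error (st_point st') b2 in
  dot e2.2 (corrector_weight X Y gx gy L g h k (st_z st) (st_y st) (st_y st'))
  + dot e1.1 (predictor_weight_x X Y gx gy L g (st_z st) (predicted b0 st).1)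
  + dot e1.2 (predictor_weight_y X Y gx gy L g k (st_z st) (predicted b0 st).2).

Lemma predicted_dom b st : (X `*` Y) (predicted b st).
Proof.
split=> /=.
  exact: (projP _ (domX_neq0 H) (domX_closed H)).1.
exact: (projP _ (domY_neq0 H) (domY_closed H)).1.
Qed.

Lemma spde_step_energy b0 b1 b2 st : admissible st ->
  let st' := spde_step X Y G L h alpha k beta b0 b1 b2 st in
  admissible st' /\
  state_energy st' - state_energy st <=
    - (beta / 64) * residual_bound st'
    + 20 * (psq (batch_error (st_point st) b0)
            + psq (batch_error (predicted b0 st) b1)
            + psq (batch_error (st_point st') b2))
    + error_pairing b0 b1 b2 st.
Proof.
case: st => x z xi y nn v c [Nx Ny] st'; rewrite /= in Nx Ny.
have [Xx _] := Nx; have [Yy _] := Ny.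
split.
  exact: (@iteration_normal R n p X Y F gx gy L mu g H g_gt0 g_le h alpha k hL
    kE z x y v
    (minibatch G (predicted b0 (State x z xi y nn v c)) b1).1.1
    (minibatch G (predicted b0 (State x z xi y nn v c)) b1).1.2
    (predicted b0 (State x z xi y nn v c)).1 (st_x st') (st_xi st')
    (st_y st') (st_n st') erefl erefl erefl erefl).
have := @energy_step R n p X Y F gx gy L mu g H g_gt0 g_le muE h alpha k hL
  alphaE kE z x xi y nn v
  (minibatch G (x, y) b0).1.1
  (minibatch G (predicted b0 (State x z xi y nn v c)) b1).1.1
  (minibatch G (x, y) b0).1.2
  (minibatch G (predicted b0 (State x z xi y nn v c)) b1).1.2
  (minibatch G (st_point st') b2).1.2 Xx Yy Nx Ny
  (predicted b0 (State x z xi y nn v c)).1 (st_x st') (st_xi st') (st_z st')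
  (predicted b0 (State x z xi y nn v c)).2 (st_y st') (st_n st') (st_v st')
  erefl erefl erefl erefl erefl erefl erefl.
rewrite -betaE => /(_ erefl _ _ _ _ erefl erefl erefl erefl) HE.
refine (le_trans HE _); apply: lerD; last exact: lexx.
apply: lerD; first exact: lexx.
rewrite ler_wpM2l//; apply: lerD; first exact: lexx.
by rewrite /psq lerDr sq_ge0.
Qed.

Section trajectory.
Variables (m : nat) (s : nat -> nat -> nat -> S).
Variables (x0 : 'rV[R]_n) (y0 : 'rV[R]_p).
Hypotheses (Xx0 : X x0) (Yy0 : Y y0).

Local Notation run := (spde X Y G L h alpha k beta m s x0 y0).

Definition errors_sq t : R :=
  psq (batch_error (st_point (run t)) (batch m s t 0))
  + psq (batch_error (predicted (batch m s t 0) (run t)) (batch m s t 1))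
  + psq (batch_error (st_point (run t.+1)) (batch m s t 2)).

Definition run_pairing t : R :=
  error_pairing (batch m s t 0) (batch m s t 1) (batch m s t 2) (run t).

Lemma admissible_run t : admissible (run t).
Proof.
elim: t => [|t IH]; first by split; exact: normal_cone0.
exact: (spde_step_energy (batch m s t 0) (batch m s t 1) (batch m s t 2) IH).1.
Qed.

Lemma energy_telescope T :
  beta / 64 * (\sum_(t < T) residual_bound (run t.+1)) + state_energy (run T)
  <= state_energy (run 0)
     + 20 * (\sum_(t < T) errors_sq t) + \sum_(t < T) run_pairing t.
Proof.
elim: T => [|T IH]; first by rewrite !big_ord0 !mulr0 !add0r !addr0.
rewrite !big_ord_recr /=.
have := (spde_step_energy (batch m s T 0) (batch m s T 1) (batch m s T 2)
  (admissible_run T)).2.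
rewrite -/(run_pairing T) -[spde_step _ _ _ _ _ _ _ _ _ _ _ _]/(run T.+1).
rewrite -/(errors_sq T); move: IH.
move: (residual_bound (run T.+1)) (state_energy (run T.+1)) => r e.
lra.
Qed.

End trajectory.

End state_step.

(** * The objective satisfies the quantitative assumptions *)

Section calculus.
Context {R : realType} {n p : nat}.
Implicit Types (F : 'rV[R]_n * 'rV[R]_p -> R).

Lemma diff_grad F u d : differentiable F u ->
  'd F u d = dot (gradx F u) d.1 + dot (grady F u) d.2.
Proof.
move=> dF; case: d => a b /=.
have -> : (a, b) = (a, 0) + (0, b) :> 'rV[R]_n * 'rV[R]_p.
  by congr pair; rewrite ?addr0 ?add0r.
rewrite linearD; congr (_ + _).
  rewrite {1}[a]row_sum_delta (@big_morph _ _ (fun c => 'd F u (c, 0)) 0 +%R).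
  - apply: eq_bigr => i _; rewrite mxE mulrC.
    by rewrite -[LHS]/('d F u (_, 0)) -linearZ /=; congr ('d F u (_, _)); rewrite scaler0.
  - by move=> c c'; rewrite -linearD; congr ('d F u (_, _)); rewrite addr0.
  - by rewrite -[RHS](linear0 ('d F u)).
rewrite {1}[b]row_sum_delta (@big_morph _ _ (fun c => 'd F u (0, c)) 0 +%R).
- apply: eq_bigr => i _; rewrite mxE mulrC.
  by rewrite -linearZ /=; congr ('d F u (_, _)); rewrite scaler0.
- by move=> c c'; rewrite -linearD; congr ('d F u (_, _)); rewrite addr0.
- by rewrite -[RHS](linear0 ('d F u)).
Qed.

Lemma is_derive_quadratic (a b t : R) :
  is_derive t (1 : R) (cst a * id + cst b * (id * id)) (a + 2 * b * t).
Proof.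
apply: is_derive_eq; rewrite /cst /= !scaler0 !addr0.
by rewrite /GRing.scale /= !mulr1; ring.
Qed.

Lemma dot_drift_ge (a a0 d : 'rV[R]_n) (b : 'rV[R]_p) (L t : R) :
  0 <= L -> 0 <= t ->
  sq (a - a0) + sq b <= L ^+ 2 * (sq (t *: d) + sq (0 : 'rV[R]_p)) ->
  0 <= dot a d - dot a0 d + L * sq d * t.
Proof.
move=> L0 t0; rewrite sq0 addr0 sqZ => H1; have H0 := sq_ge0 b.
have := dot_CauchySchwarz (a - a0) d.
rewrite dotDl dotNl ler_norml => /andP[+ _].
have : enorm (a - a0) <= L * t * enorm d.
  rewrite -(@ler_pXn2r _ 2)// ?nnegrE ?mulr_ge0 ?enorm_ge0//.
  by rewrite exprMn !enorm_sq exprMn; lra.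
move=> /(ler_wpM2r (enorm_ge0 d)).
rewrite -[L * t * _ * _]mulrA -expr2 enorm_sq; lra.
Qed.

(** Along a segment the gradient drifts by at most [L t] times the length, so
    the linear model minus a quadratic is a lower bound. *)
Lemma smooth_weakly_convex F (L : R) (X : set 'rV[R]_n) (Y : set 'rV[R]_p) :
  segment_closed X -> 0 <= L ->
  (forall u, (X `*` Y) u -> differentiable F u) ->
  (forall u u', (X `*` Y) u -> (X `*` Y) u' ->
    sq (gradx F u - gradx F u') + sq (grady F u - grady F u')
      <= L ^+ 2 * (sq (u.1 - u'.1) + sq (u.2 - u'.2))) ->
  forall x x' y, X x -> X x' -> Y y ->
    F (x, y) + dot (gradx F (x, y)) (x' - x) - L / 2 * sq (x' - x)
      <= F (x', y).
Proof.
move=> sX L0 dF lF x x' y Xx Xx' Yy.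
set c := dot (gradx F (x, y)) (x' - x); set q := sq (x' - x).
pose u t := (x + t *: (x' - x), y).
have Cu (t : R) : 0 <= t -> t <= 1 -> (X `*` Y) (u t) by move=> *; split => //=; exact: sX.
pose f0 (t : R) := F (u t).
pose df (t : R) := dot (gradx F (u t)) (x' - x).
have uE (t s : R) : u (s *: 1 + t) = s *: (x' - x, 0) + u t.
  rewrite /u; congr pair; last by rewrite /= scaler0 add0r.
  by rewrite /= scalerDl addrCA -[s *: 1]/(s * 1) mulr1.
have D (t : R) : 0 <= t -> t <= 1 -> is_derive t (1 : R) f0 (df t).
  move=> t0 t1; have dFt := dF _ (Cu t t0 t1).
  have E : (fun s : R => s^-1 *: ((F \o shift (u t)) (s *: (x' - x, 0)) - F (u t)))
      = (fun s : R => s^-1 *: ((f0 \o shift t) (s *: 1) - f0 t)).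
    by apply/funext => s; rewrite /f0 /shift /= uE.
  apply: DeriveDef.
    rewrite /derivable; have := diff_derivable (v := (x' - x, 0)) dFt.
    by rewrite /derivable E.
  rewrite /derive -E -/(derive F (u t) (x' - x, 0)) deriveE// diff_grad//=.
  by rewrite dot0r addr0.
pose f : R -> R := f0 + (cst (- c) * id + cst (L / 2 * q) * (id * id)).
have Dp t : is_derive t (1 : R) (cst (- c) * id + cst (L / 2 * q) * (id * id))
    (- c + L * q * t).
  have -> : L * q = 2 * (L / 2 * q) by field.
  exact: is_derive_quadratic.
pose g (t : R) : R := df t - c + L * q * t.
have Df (t : R) : 0 <= t -> t <= 1 -> is_derive t (1 : R) f (g t).
  move=> t0 t1; have Dt := D t t0 t1.
  apply: (@is_derive_eq _ _ _ _ _ _ _ _ (is_deriveD Dt (Dp t))).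
  by rewrite /g addrA.
have g_ge0 (t : R) : 0 <= t -> t <= 1 -> 0 <= g t.
  move=> t0 t1; rewrite /g /df /c; apply: dot_drift_ge => //.
  have := lF _ _ (Cu t t0 t1) (conj Xx Yy : (X `*` Y) (x, y)).
  have -> : (u t).1 - (x, y).1 = t *: (x' - x) by rewrite /= addrAC subrr add0r.
  have -> : (u t).2 - (x, y).2 = 0 by rewrite /= subrr.
  exact.
have Ef (t : R) : f t = F (u t) + (- c * t + L / 2 * q * (t * t)) by [].
have u0 : u 0 = (x, y) by rewrite /u scale0r addr0.
have u1 : u 1 = (x', y) by rewrite /u scale1r addrC subrK.
clearbody f g.
have [t tI E] : exists2 t : R, t \in `[0, 1]%R & f 1 - f 0 = g t * (1 - 0).
  apply: MVT_segment => // t; rewrite ?in_itv /=.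
    by move=> /andP[t0 t1]; exact: Df (ltW t0) (ltW t1).
  apply: derivable_within_continuous => {}t; rewrite in_itv/= => /andP[t0 t1].
  by have [] := Df t t0 t1.
move: tI; rewrite in_itv/= => /andP[t0 t1]; have := g_ge0 t t0 t1.
move: (Ef 0) (Ef 1) E; rewrite u0 u1.
move: (F _) (F _) (f 0) (f 1) (g t) => a b f0' f1 gt E0 E1 E g0.
have : f1 - f0' = gt by rewrite E; ring.
rewrite E0 E1; lra.
Qed.

End calculus.

(** * Square integrable variables and conditional expectations *)

Section square_integrable.
Context {R : realType} {d : measure_display} {Omega : measurableType d}.
Variable P : probability Omega R.
Implicit Types (f g : Omega -> R).

Definition integ f : Prop := P.-integrable setT (EFin \o f).

Definition L2 f : Prop := measurable_fun setT f /\ integ (fun w => f w ^+ 2).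

Local Notation Ex f := (\int[P]_w (f w))%R.

Lemma integD f g : integ f -> integ g -> integ (fun w => f w + g w).
Proof. by move=> If Ig; exact: (integrableD measurableT If Ig). Qed.

Lemma integZ (a : R) f : integ f -> integ (fun w => a * f w).
Proof. by move=> If; exact: (integrableZl measurableT a If). Qed.

Lemma integ_cst (a : R) : integ (fun=> a).
Proof.
exact: finite_measure_integrable_cst.
Qed.

Lemma integ_sum (I : Type) (r : seq I) (F : I -> Omega -> R) :
  (forall i, integ (F i)) -> integ (fun w => \sum_(i <- r) F i w).
Proof.
move=> IF; elim: r => [|i r IH].
  by under eq_fun do rewrite big_nil; exact: integ_cst.
by under eq_fun do rewrite big_cons; exact: integD.
Qed.

Lemma integ_measurable f : integ f -> measurable_fun setT f.
Proof. by move=> /measurable_int /measurable_EFinP. Qed.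

Lemma integ_le f g : measurable_fun setT f -> (forall w, `|f w| <= g w) ->
  integ g -> integ f.
Proof.
move=> mf fg; apply: le_integrable => //; first exact/measurable_EFinP.
move=> w _ /=; rewrite lee_fin (le_trans (fg w))//; exact: ler_norm.
Qed.

Lemma Ex_sum (I : Type) (r : seq I) (F : I -> Omega -> R) :
  (forall i, integ (F i)) ->
  Ex (fun w => \sum_(i <- r) F i w) = \sum_(i <- r) Ex (F i).
Proof.
move=> IF; elim: r => [|i r IH].
  rewrite big_nil; under eq_Rintegral do rewrite big_nil.
  by rewrite Rintegral_cst// mul0r.
rewrite big_cons -IH -RintegralD//; [|exact: IF|exact: integ_sum].
by apply: eq_Rintegral => w _; rewrite big_cons.
Qed.

Lemma ExZ (a : R) f : integ f -> Ex (fun w => a * f w) = a * Ex f.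
Proof. by move=> If; rewrite RintegralZl. Qed.

Lemma ExD f g : integ f -> integ g -> Ex (fun w => f w + g w) = Ex f + Ex g.
Proof. by move=> If Ig; rewrite RintegralD. Qed.

Lemma Ex_cst (a : R) : Ex (fun=> a) = a.
Proof. by have := expectation_cst P a; rewrite unlock /Rintegral => ->. Qed.

Lemma L2_mul f g : L2 f -> L2 g -> integ (fun w => f w * g w).
Proof.
move=> [mf If] [mg Ig]; apply: (@integ_le _ (fun w => f w ^+ 2 + g w ^+ 2)).
- exact: measurable_funM.
- move=> w; rewrite ler_norml; have := sqr_ge0 (f w + g w).
  have := sqr_ge0 (f w + - g w); have := sqr_ge0 (f w); have := sqr_ge0 (g w).
  by rewrite !sqrrD => *; apply/andP; split; lra.
- exact: integD.
Qed.

Lemma L2_cst (a : R) : L2 (fun=> a).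
Proof. by split; [exact: measurable_cst|exact: integ_cst]. Qed.

Lemma L2_integ f : L2 f -> integ f.
Proof.
move=> Lf; have := L2_mul Lf (L2_cst 1).
by under eq_fun do rewrite mulr1.
Qed.

Lemma L2D f g : L2 f -> L2 g -> L2 (fun w => f w + g w).
Proof.
move=> Lf Lg; have [mf If] := Lf; have [mg Ig] := Lg.
split; first exact: measurable_funD.
have -> : (fun w => (f w + g w) ^+ 2) =
    (fun w => (f w ^+ 2 + g w ^+ 2) + 2 * (f w * g w)).
  by apply/funext => w; ring.
by apply: integD; [exact: integD|apply/integZ/L2_mul].
Qed.

Lemma L2Z (a : R) f : L2 f -> L2 (fun w => a * f w).
Proof.
move=> [mf If]; split; first exact: measurable_funM.
under eq_fun do rewrite exprMn; exact: integZ.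
Qed.

Lemma L2_le f g : measurable_fun setT f -> (forall w, f w ^+ 2 <= g w) ->
  integ g -> L2 f.
Proof.
move=> mf fg Ig; split=> //; apply: integ_le Ig.
  exact: measurable_funX.
by move=> w; rewrite ger0_norm ?sqr_ge0.
Qed.

End square_integrable.

Section conditional_expectation.
Import HBSimple HBNNSimple.
Context {R : realType} {d : measure_display} {Omega : measurableType d}.
Variable P : probability Omega R.
Variable A : set (set Omega).
Hypothesis subA : Defs.sub_sigma_algebra A.

Local Notation TA := (g_sigma_algebraType A).
Local Notation Ex f := (\int[P]_w (f w))%R.

Lemma measurable_algebraE : (measurable : set (set TA)) = A.
Proof.
have [sA _] := subA; apply/seteqP; split => [E|E AE]; last exact: sub_sigma_algebra.
by move=> /(_ A); apply; split.
Qed.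

Lemma measurable_wrtP {d'} {T : measurableType d'} (u : Omega -> T) :
  measurable_wrt A u <-> measurable_fun [set: TA] (u : TA -> T).
Proof.
split=> [uA _ B mB|mu B mB].
  by rewrite setTI measurable_algebraE; exact: uA.
have := mu measurableT B mB; by rewrite setTI measurable_algebraE.
Qed.

Lemma measurable_wrt_fun {d'} {T : measurableType d'} (u : Omega -> T) :
  measurable_wrt A u -> measurable_fun [set: Omega] u.
Proof. by move=> uA _ B mB; rewrite setTI; apply: subA.2; exact: uA. Qed.

Lemma disjoint_cover (A_ : (set Omega)^nat) :
  (forall k, A (A_ k)) -> \bigcup_k A_ k = setT ->
  [/\ forall k, A (seqDU A_ k), \bigcup_k seqDU A_ k = setT,
      trivIset setT (seqDU A_) & forall k, seqDU A_ k `<=` A_ k].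
Proof.
move=> AA cA; split.
- move=> k; rewrite -measurable_algebraE.
  rewrite /seqDU; apply: (@measurableD _ TA); first by rewrite measurable_algebraE.
  by apply: (@bigsetU_measurable _ TA) => i _; rewrite measurable_algebraE.
- by rewrite -seqDU_bigcup_eq.
- exact: trivIset_seqDU.
- exact: subset_seqDU.
Qed.

(** The cover by sets of integrability makes the bound on the conditional
    expectation a bound on the full expectation, by countable additivity. *)
Lemma cond_exp_le (G V : Omega -> R) (r : R) :
  is_cond_exp P A G V -> (forall w, 0 <= G w) -> {ae P, forall w, V w <= r} ->
  integ P G /\ Ex G <= r.
Proof.
move=> [mG mV [A_ [AA cA IA]] GV] G0 Vr.
have [BA cB tB BsubA] := disjoint_cover AA cA.
set B := seqDU A_ in BA cB tB BsubA.
have mB k : measurable (B k) := subA.2 _ (BA k).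
have IGB k : P.-integrable (B k) (EFin \o G).
  exact: integrableS (subA.2 _ (AA k)) (mB k) (BsubA k) (IA k).
have Bound : (\int[P]_w (G w)%:E <= r%:E)%E.
  rewrite -cB ge0_integral_bigcup//; last 2 first.
  - by rewrite cB; exact/measurable_EFinP.
  - by move=> w _; rewrite lee_fin.
  have PB : (\sum_(k <oo) P (B k) = 1)%E.
    rewrite -measure_semi_bigcup// cB//.
    exact: probability_setT.
  have rE : (r%:E = \sum_(k <oo) (r%:E * P (B k)))%E.
    by rewrite nneseriesZl// PB mule1.
  rewrite rE; apply: lee_nneseries => [k _ _|k _].
    by apply: integral_ge0 => w _; rewrite lee_fin.
  have [IV ->] := GV _ (BA k) (IGB k).
  have mVT := measurable_wrt_fun mV.
  have mVk : measurable_fun (B k) (EFin \o V).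
    by apply/measurable_EFinP; exact: measurable_funTS.
  have mVr : measurable_fun (B k) (EFin \o (fun w => Num.min (V w) r)).
    apply/measurable_EFinP; apply: measurable_funTS.
    by apply: measurable_minr => //; exact: measurable_cst.
  have EV : ae_eq P (B k) (EFin \o V) (EFin \o (fun w => Num.min (V w) r)).
    by apply: filterS Vr => w Vw _ /=; rewrite min_l.
  rewrite -integral_cst// (ae_eq_integral _ _ (mB k) mVk mVr EV)//.
  apply: le_integral => //.
  - have Ig : P.-integrable (B k) (EFin \o (fun w => `|V w| + `|r|)).
      have I2 := integrableS measurableT (mB k) (@subsetT _ _) (integ_cst P `|r|).
      exact: (integrableD (mB k) (integrable_norm IV) I2).
    apply: le_integrable Ig => // w _ /=; rewrite lee_fin [leRHS]ger0_norm//.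
    by case: (leP (V w) r) => _; rewrite ?lerDl ?lerDr.
  - exact: (integrableS measurableT (mB k) (@subsetT _ _) (integ_cst P r)).
  - by move=> w _ /=; rewrite lee_fin ge_min lexx orbT.
have IG : integ P G.
  apply/integrableP; split; first exact/measurable_EFinP.
  under eq_integral => w _ do rewrite /= ger0_norm//.
  exact: le_lt_trans Bound (ltry _).
split=> //; rewrite /Rintegral -lee_fin fineK//.
exact: integrable_fin_num.
Qed.

(** An error with vanishing conditional expectation is orthogonal to every
    variable of the conditioning algebra: this holds for
    indicators, hence for simple functions, and passes to their limits. *)
Lemma cond_exp_orthogonal (G H c : Omega -> R) :
  is_cond_exp P A G H -> integ P (fun w => G w - H w) ->
  measurable_wrt A c -> integ P (fun w => (G w - H w) * c w) ->
  Ex (fun w => (G w - H w) * c w) = 0.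
Proof.
move=> [mG mH [A_ [AA cA IA]] GH] IN mc Lc.
have [BA cB tB BsubA] := disjoint_cover AA cA.
set B := seqDU A_ in BA cB tB BsubA.
have mB k : measurable (B k) := subA.2 _ (BA k).
set N := fun w => G w - H w in IN Lc *.
have mN : measurable_fun setT N := integ_measurable IN.
have zero E : A E -> (\int[P]_(w in E) (N w)%:E = 0)%E.
  move=> AE; have mE := subA.2 _ AE.
  have EB : E = \bigcup_k (E `&` B k) by rewrite -setI_bigcupr cB setIT.
  have AEB k : A (E `&` B k).
    rewrite -measurable_algebraE; apply: (@measurableI _ TA).
      by rewrite measurable_algebraE.
    by rewrite measurable_algebraE; exact: BA.
  rewrite EB integral_bigcup//.
  - apply: eseries0 => k _ _.
    have mEB : measurable (E `&` B k) by exact: measurableI.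
    have IG : P.-integrable (E `&` B k) (EFin \o G).
      apply: integrableS (subA.2 _ (AA k)) mEB _ (IA k).
      by move=> w [_ /BsubA].
    have [IH GHE] := GH _ (AEB k) IG.
    have -> : (fun w => (N w)%:E) = (fun w => (G w)%:E - (H w)%:E)%E.
      by apply/funext => w.
    by rewrite integralB// GHE subee//; exact: integrable_fin_num.
  - exact: trivIset_setIl.
  - by move=> k; exact: measurableI.
  - by rewrite -EB; exact: integrableS IN.
wlog c0 : c mc Lc / forall w, 0 <= c w.
  move=> hw; have mcT := (measurable_wrtP c).1 mc.
  have mp : measurable_wrt A (fun w => Num.max (c w) 0).
    by apply/measurable_wrtP; apply: measurable_maxr => //; exact: measurable_cst.
  have mn : measurable_wrt A (fun w => Num.max (- c w) 0).
    apply/measurable_wrtP; apply: measurable_maxr; last exact: measurable_cst.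
    exact: measurable_funN.
  have Lp : integ P (fun w => N w * Num.max (c w) 0).
    apply: (integ_le _ _ (integrable_norm Lc)).
      by apply: measurable_funM => //; exact: measurable_wrt_fun mp.
    move=> w /=; rewrite !normrM ler_wpM2l//.
    by case: (leP (c w) 0) => cw; rewrite ?normr0.
  have Ln : integ P (fun w => N w * Num.max (- c w) 0).
    apply: (integ_le _ _ (integrable_norm Lc)).
      by apply: measurable_funM => //; exact: measurable_wrt_fun mn.
    move=> w /=; rewrite !normrM ler_wpM2l//.
    by case: (leP (- c w) 0) => cw; rewrite ?normr0 ?normrN.
  have -> : (fun w => N w * c w) =
      (fun w => N w * Num.max (c w) 0 + (-1) * (N w * Num.max (- c w) 0)).
    apply/funext => w; case: (leP (c w) 0) => cw.
      by rewrite max_l ?oppr_ge0//; ring.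
    by rewrite max_r ?oppr_le0 ?(ltW cw)//; ring.
  rewrite ExD//; last exact: integZ.
  rewrite ExZ//.
  rewrite (hw _ mp Lp) ?(hw _ mn Ln) ?mulr0 ?addr0// => w.
    by rewrite le_max lexx orbT.
  by rewrite le_max lexx orbT.
have mcT : measurable_fun [set: TA] (EFin \o c).
  by apply/measurable_EFinP; exact/measurable_wrtP.
pose a_ (m : nat) : Omega -> R := nnsfun_approx measurableT mcT m.
have ma m : measurable_wrt A (a_ m).
  by apply/measurable_wrtP; exact: (@measurable_funPT _ _ _ _ (nnsfun_approx measurableT mcT m)).
have a_ge0 m w : 0 <= a_ m w.
  exact: (@fun_ge0 _ _ (nnsfun_approx measurableT mcT m)).
have a_le m w : a_ m w <= c w.
  rewrite -lee_fin /a_ nnsfun_approxE; apply: (@le_approx _ TA R setT (EFin \o c)) => //.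
  by move=> t _; rewrite /= lee_fin.
have a_cvg w : (EFin \o a_ ^~ w) @ \oo --> (c w)%:E.
  apply: (@cvg_nnsfun_approx _ TA R setT measurableT (EFin \o c) mcT) => //.
  by move=> t _; rewrite /= lee_fin.
have a_zero m : Ex (fun w => N w * a_ m w) = 0.
  rewrite /a_; set phi := nnsfun_approx _ _ _.
  pose E y := phi @^-1` [set y].
  have AE y : A (E y) by rewrite -measurable_algebraE; exact: measurable_sfunP.
  have mNE y : measurable_fun setT (fun w => N w * \1_(E y) w).
    by apply: measurable_funM => //; exact: measurable_indic (subA.2 _ (AE y)).
  have INE y : integ P (fun w => N w * \1_(E y) w).
    apply: (@integ_le _ _ _ P _ (fun w => `|N w|)) => //.
      move=> w; rewrite normrM indicE ler_piMr//.
      by case: (_ \in _); rewrite ?normr1 ?normr0.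
    exact: integrable_norm.
  have ENE y : Ex (fun w => N w * \1_(E y) w) = 0.
    have := zero _ (AE y); rewrite integral_mkcond /Rintegral => Z.
    rewrite -[RHS]/(fine 0%E) -Z; congr fine; apply: eq_integral => w _.
    by rewrite patchE indicE; case: ifPn => _; rewrite ?mulr1 ?mulr0.
  have -> : (fun w => N w * phi w) = (fun w =>
      \sum_(y <- fset_set (range phi)) y * (N w * \1_(E y) w)).
    apply/funext => w; rewrite {1}(fimfunE phi) fsbig_finite//= mulr_sumr.
    by apply: eq_bigr => y _; rewrite mulrCA.
  rewrite Ex_sum => [|y]; last exact: integZ.
  by rewrite big1// => y _; rewrite ExZ// ENE mulr0.
have [|||||_ _ cvg0] := @dominated_convergence _ Omega R P setT measurableT
  (fun m w => (N w * a_ m w)%:E) (fun w => (N w * c w)%:E)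
  (fun w => `|N w * c w|%:E).
- move=> m; apply/measurable_EFinP/measurable_funM => //.
  exact: measurable_wrt_fun.
- exact: measurable_int Lc.
- apply/aeW => w _; rewrite /=.
  have -> : (fun m => (N w * a_ m w)%:E) = (fun m => (N w)%:E * (a_ m w)%:E)%E by [].
  by rewrite EFinM; apply: cvgeZl => //; exact: a_cvg.
- exact: integrable_norm.
- apply/aeW => w m _ /=; rewrite lee_fin !normrM ler_wpM2l//.
  by rewrite ger0_norm// ger0_norm.
have E0 : [sequence (\int[P]_w (N w * a_ m w)%:E)%E]_m = cst 0%E.
  apply/funext => m /=; have := a_zero m; rewrite /Rintegral => Z.
  rewrite -[LHS]fineK ?Z//.
  apply: integrable_fin_num => //; apply: (integ_le _ _ (integrable_norm Lc)).
    by apply: measurable_funM => //; exact: measurable_wrt_fun (ma m).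
  move=> w /=; rewrite !normrM ler_wpM2l//.
  by rewrite ger0_norm// ger0_norm.
move: cvg0; rewrite E0 => cvg0.
have <- : fine 0%E = 0 :> R by [].
congr fine; apply/esym; apply: cvg_unique cvg0 => //; exact: cvg_cst.
Qed.

End conditional_expectation.

(** * Random vectors *)

Section random_vectors.
Context {R : realType} {d : measure_display} {T : measurableType d}.

Definition measurable_coord {n} (a : T -> 'rV[R]_n) : Prop :=
  forall i, measurable_fun setT (fun w => a w 0 i).

Lemma measurable_real_open (f : T -> R) :
  (forall U, open U -> measurable (f @^-1` U)) -> measurable_fun setT f.
Proof.
move=> H; apply: (measurability _ (RGenOInfty.measurableE R)).
by move=> _ [_ [x ->] <-]; rewrite setTI; apply: H; exact: interval_open.
Qed.

(** An open set is the union of the countably many boxes with rational centre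
    and radius [1 / (k + 1)] that it contains, and a box is cut out by finitely
    many conditions on the coordinates. *)
Lemma measurable_coord_open {n} (a : T -> 'rV[R]_n) (U : set 'rV[R]_n) :
  measurable_coord a -> open U -> measurable (a @^-1` U).
Proof.
move=> ma oU.
pose box (q : 'rV[rat]_n * nat) : set 'rV[R]_n :=
  [set v | forall i, `|v 0 i - ratr (q.1 0 i)| < q.2.+1%:R^-1].
pose F (k : nat) : set T :=
  if choice.unpickle k is Some q then
    if pselect (box q `<=` U) then a @^-1` box q else set0
  else set0.
have mbox q : measurable (a @^-1` box q).
  have -> : a @^-1` box q = \bigcap_(i in [set: 'I_n])
      [set w | `|a w 0 i - ratr (q.1 0 i)| < q.2.+1%:R^-1].
    by apply/seteqP; split => [w bw i _|w bw i]; apply: bw.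
  apply: fin_bigcap_measurable => // i _.
  have mi : measurable_fun setT (fun w => `|a w 0 i - ratr (q.1 0 i)|).
    apply: measurableT_comp => //.
    by apply: measurable_funB; [exact: ma|exact: measurable_cst].
  rewrite -[X in measurable X]setTI.
  exact: (mi measurableT `]-oo, (q.2.+1%:R^-1)[%classic (measurable_itv _)).
have -> : a @^-1` U = \bigcup_k F k.
  apply/seteqP; split => [w /= Uw|w [k _]]; last first.
    by rewrite /F; case: choice.unpickle => [q|//]; case: pselect => [bU /bU|].
  have /nbhs_ballP[e /= e0 eU] := open_nbhs_nbhs (conj oU Uw).
  have [k ke] : exists k : nat, k.+1%:R^-1 < e / 2.
    by have [k _ /(_ k (leqnn _))] := near_infty_natSinv_lt
      (PosNum (divr_gt0 e0 (ltr0n R 2))); exists k.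
  have kpos : 0 < k.+1%:R^-1 :> R by rewrite invr_gt0.
  have /boolp.choice[c Hc] (i : 'I_n) :
      exists c : rat, `|a w 0 i - ratr c| < k.+1%:R^-1.
    have [c cI] := @rat_in_itvoo R (a w 0 i) (a w 0 i + k.+1%:R^-1) ltac:(by rewrite ltrDl).
    exists c; move: cI; rewrite in_itv/= => /andP[c1 c2].
    by rewrite distrC gtr0_norm ?subr_gt0// ltrBlDl.
  pose q : 'rV[rat]_n * nat := (\row_i c i, k).
  exists (choice.pickle q) => //; rewrite /F choice.pickleK; case: pselect => [_ i|].
    by rewrite /q/= mxE.
  case=> v bv; apply: eU; split=> // i j.
  rewrite (ord1 i) /ball/=.
  have := bv j; have := Hc j; rewrite /q/= mxE => H1 H2.
  have := ler_distD (ratr (c j)) (a w 0 j) (v 0 j).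
  rewrite (distrC (ratr _)) => H3.
  apply: (le_lt_trans H3); rewrite (splitr e).
  by rewrite ltrD// (lt_trans _ ke).
apply: bigcupT_measurable => k; rewrite /F.
case: choice.unpickle => [q|]; last exact: measurable0.
by case: pselect => _ /=; [exact: mbox|exact: measurable0].
Qed.

Lemma measurable_continuous {n} (a : T -> 'rV[R]_n) (phi : 'rV[R]_n -> R) :
  measurable_coord a -> continuous phi -> measurable_fun setT (phi \o a).
Proof.
move=> ma cphi; apply: measurable_real_open => U oU.
rewrite comp_preimage; apply: measurable_coord_open => //.
by apply: open_comp => // v _; exact: cphi.
Qed.

Lemma measurable_coord_row {n p} (a : T -> 'rV[R]_n) (b : T -> 'rV[R]_p) :
  measurable_coord a -> measurable_coord b ->
  measurable_coord (fun w => row_mx (a w) (b w)).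
Proof.
move=> ma mb i; under eq_fun do rewrite mxE.
by case: (fintype.split i) => j; [exact: ma|exact: mb].
Qed.

Lemma unrow_continuous {n p} :
  continuous (fun v : 'rV[R]_(n + p) => (lsubmx v, rsubmx v)).
Proof.
move=> v U /nbhs_ballP[e /= e0 eU]; apply/nbhs_ballP; exists e => //= u [_ vu].
by apply: eU; split; split=> // i j; rewrite /= !mxE; exact: vu.
Qed.

Lemma fst_coord_continuous {n p} i :
  continuous (fun q : 'rV[R]_n * 'rV[R]_p => q.1 0 i).
Proof.
move=> q; apply: (@cvg_comp _ _ _ fst (fun v : 'rV[R]_n => v 0 i) (nbhs q) (nbhs q.1)).
  exact: cvg_fst.
exact: coord_continuous.
Qed.

Lemma snd_coord_continuous {n p} i :
  continuous (fun q : 'rV[R]_n * 'rV[R]_p => q.2 0 i).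
Proof.
move=> q; apply: (@cvg_comp _ _ _ snd (fun v : 'rV[R]_p => v 0 i) (nbhs q) (nbhs q.2)).
  exact: cvg_snd.
exact: coord_continuous.
Qed.

(** Pairs are read as vectors of the sum dimension, of which the pair is a
    continuous image. *)
Lemma measurable_pair_open {n p} (a : T -> 'rV[R]_n) (b : T -> 'rV[R]_p) :
  measurable_coord a -> measurable_coord b ->
  measurable_fun setT (fun w => (a w, b w) : borel_pair R n p).
Proof.
move=> ma mb; apply: (@measurability _ _ _ (borel_pair R n p) _ _
  (@open ('rV[R]_n * 'rV[R]_p)%type)) => //.
move=> _ [U oU <-]; rewrite setTI.
pose j (v : 'rV[R]_(n + p)) := (lsubmx v, rsubmx v).
have -> : (fun w => (a w, b w)) @^-1` U =
    (fun w => row_mx (a w) (b w)) @^-1` (j @^-1` U).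
  by apply/seteqP; split => w /=; rewrite /j row_mxKl row_mxKr.
apply: measurable_coord_open; first exact: measurable_coord_row.
apply: open_comp => // v _.
exact: unrow_continuous.
Qed.

Lemma measurable_coord_fst {n p} (u : T -> borel_pair R n p) :
  measurable_fun setT u -> measurable_coord (fun w => (u w).1).
Proof.
move=> mu i; apply: measurable_real_open => U oU.
rewrite -[X in measurable X]setTI.
apply: (mu measurableT [set q : 'rV[R]_n * 'rV[R]_p | U (q.1 0 i)]).
apply: sub_sigma_algebra.
apply: (@open_comp _ _ (fun q : 'rV[R]_n * 'rV[R]_p => q.1 0 i)) => // q _.
exact: fst_coord_continuous.
Qed.

Lemma measurable_coord_snd {n p} (u : T -> borel_pair R n p) :
  measurable_fun setT u -> measurable_coord (fun w => (u w).2).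
Proof.
move=> mu i; apply: measurable_real_open => U oU.
rewrite -[X in measurable X]setTI.
apply: (mu measurableT [set q : 'rV[R]_n * 'rV[R]_p | U (q.2 0 i)]).
apply: sub_sigma_algebra.
apply: (@open_comp _ _ (fun q : 'rV[R]_n * 'rV[R]_p => q.2 0 i)) => // q _.
exact: snd_coord_continuous.
Qed.

Lemma closed_measurable_pair {n p} (X : set 'rV[R]_n) (Y : set 'rV[R]_p) :
  closed X -> closed Y -> measurable (X `*` Y : set (borel_pair R n p)).
Proof.
move=> cX cY; rewrite -[X in measurable X]setCK; apply: measurableC.
apply: sub_sigma_algebra; apply: closed_openC.
have -> : X `*` Y = fst @^-1` X `&` snd @^-1` Y by [].
by apply: closedI; apply: closed_comp => // q _; [exact: cvg_fst|exact: cvg_snd].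
Qed.

End random_vectors.

(** * Independence of generated algebras *)

Section independence.
Context {R : realType} {d : measure_display} {Omega : measurableType d}.
Variable P : probability Omega R.
Variables (I : choiceType) (K : set I) (G : I -> set (set Omega)).
Hypothesis Gsigma : forall i, Defs.sub_sigma_algebra (G i).
Hypothesis Gindep : mutually_independent P K G.

Definition generated (K0 : set I) : set (set Omega) := <<s \bigcup_(i in K0) G i >>.

Lemma generated_sub_sigma_algebra K0 : Defs.sub_sigma_algebra (generated K0).
Proof.
split; first exact: smallest_sigma_algebra.
apply: smallest_sub; first exact: sigma_algebra_measurable.
by move=> E [i _ GE]; exact: (Gsigma i).2.
Qed.

Lemma generated_le K0 K1 : K0 `<=` K1 -> generated K0 `<=` generated K1.
Proof.
move=> K01; apply: sub_smallest2r; first exact: smallest_sigma_algebra.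
by move=> E [i K0i GE]; exists i => //; exact: K01.
Qed.

Lemma sub_generated K0 i : K0 i -> G i `<=` generated K0.
Proof. by move=> K0i E GE; apply: sub_gen_smallest; exists i. Qed.

(** Finite intersections of generators form a pi-system on which independence
    is the product rule, and independence of a fixed event propagates along
    complements and disjoint unions. *)
Lemma generated_independent K0 q : K0 `<=` K -> K q -> ~ K0 q ->
  independent P (generated K0) (G q).
Proof.
move=> K0K Kq K0q E E' GE GE'.
have mE' : measurable E' := (Gsigma q).2 _ GE'.
pose pi : set (set Omega) := [set B | exists (A : {fset I}) (F : I -> set Omega),
  [/\ [set` A] `<=` K0, forall i, G i (F i) & B = \bigcap_(i in [set` A]) F i]].
have GT i : G i setT.
  have [sG _] := Gsigma i; have [G0 GC _] := sG.
  by have := GC _ G0; rewrite setD0.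
have GI i B C : G i B -> G i C -> G i (B `&` C).
  by have := @measurableI _ (g_sigma_algebraType (G i)) B C;
    rewrite (measurable_algebraE (Gsigma i)).
have piI : setI_closed pi.
  move=> _ _ [A [F [AK GF ->]]] [B [F' [BK GF' ->]]].
  exists (A `|` B)%fset, (fun i => (if i \in A then F i else setT) `&`
    (if i \in B then F' i else setT)); split.
  - by move=> i /=; rewrite inE => /orP[/AK|/BK].
  - by move=> i; apply: GI; case: ifP.
  - apply/seteqP; split => [w [w1 w2] i _|w ww].
      by split; case: ifPn => // iX; [exact: w1|exact: w2].
    split=> i iX.
      by have [] := ww i; rewrite /= ?inE ?iX//= => + _; rewrite iX.
    by have [] := ww i; rewrite /= ?inE ?iX ?orbT//= => _; rewrite iX.
have pi_gen : <<s pi >> = generated K0.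
  apply/seteqP; split.
    apply: smallest_sub; first exact: smallest_sigma_algebra.
    move=> _ [A [F [AK GF ->]]].
    rewrite -(measurable_algebraE (generated_sub_sigma_algebra K0)).
    apply: fin_bigcap_measurable => // i iA.
    rewrite (measurable_algebraE (generated_sub_sigma_algebra K0)).
    by apply: (sub_generated (AK _ iA)).
  apply: smallest_sub; first exact: smallest_sigma_algebra.
  move=> B [i K0i GB]; apply: sub_gen_smallest.
  exists [fset i]%fset, (fun j => if i == j then B else setT); split.
  - by move=> j; rewrite /= inE => /eqP ->.
  - by move=> j; case: eqP => // <-.
  - apply/seteqP; split => [w Bw j|w /(_ i)].
      by rewrite /= inE => /eqP ->; rewrite eqxx.
    by rewrite /= inE eqxx; exact.
pose TA := g_sigma_algebraType pi.
have mTA B : (measurable : set (set TA)) B -> measurable (B : set Omega).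
  move=> mB; apply: (generated_sub_sigma_algebra K0).2.
  by rewrite -pi_gen.
apply: (@dynkin_induction _ TA pi (fun B => P (B `&` E') = (P B * P E')%E)) => //.
- by rewrite setTI probability_setT mul1e.
- move=> _ [A [F [AK GF ->]]].
  have qA : q \notin A by apply/negP => /AK.
  pose E0 i := if q == i then E' else F i.
  have E0A i : i \in A -> E0 i = F i.
    by move=> iA; rewrite /E0; case: eqP => // qi; move: qA; rewrite qi iA.
  have GE0 i : G i (E0 i) by rewrite /E0; case: eqP => // <-.
  have capE : \bigcap_(i in [set` A]) F i = \bigcap_(i in [set` A]) E0 i.
    by apply: eq_bigcapr => i /= /E0A ->.
  have qAK : [set` (q |` A)%fset] `<=` K.
    by move=> i /=; rewrite !inE => /orP[/eqP ->|/AK/K0K].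
  have AK' : [set` A] `<=` K by move=> i /AK/K0K.
  have := Gindep qAK (fun i _ => GE0 i).
  rewrite bigcap_fsetU1 big_fsetU1//= -(Gindep AK' (fun i _ => GE0 i)) -capE.
  by rewrite /E0 eqxx setIC muleC.
- move=> B /mTA mB PB.
  have -> : ~` B `&` E' = E' `\` B by rewrite setIC.
  rewrite measureD// ?probability_setC//; last first.
    exact: le_lt_trans (probability_le1 P mE') (ltry _).
  rewrite [E' `&` B]setIC.
  transitivity (P E' - P B * P E')%E; first by congr (_ - _)%E; exact: PB.
  rewrite -(fineK (fin_num_measure P _ mB)) -(fineK (fin_num_measure P _ mE')).
  by rewrite -!EFinM -!EFinB; congr EFin; ring.
- move=> F mF tF PF; rewrite setI_bigcupl.
  have mF' k : measurable (F k : set Omega) := mTA _ (mF k).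
  rewrite measure_semi_bigcup//; last 3 first.
  - by move=> k; exact: measurableI.
  - exact: trivIset_setIr.
  - by apply: bigcupT_measurable => k; exact: measurableI.
  rewrite measure_semi_bigcup//; last exact: bigcupT_measurable.
  rewrite muleC -(fineK (fin_num_measure P _ mE')) -nneseriesZl// fineK ?fin_num_measure//.
  by apply: eq_eseriesr => k _; rewrite muleC; exact: PF.
- by rewrite pi_gen.
Qed.

End independence.

(** * Square integrable random vectors adapted to an algebra *)

Section adapted_vectors.
Context {R : realType} {d : measure_display} {Omega : measurableType d}.
Variable P : probability Omega R.
Implicit Types A : set (set Omega).

Local Notation Ex f := (\int[P]_w (f w))%R.

(** Coordinatewise, so that the scalar theory applies directly. *)
Definition adaptedL2 A {n} (a : Omega -> 'rV[R]_n) : Prop :=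
  forall i, measurable_wrt A (fun w => a w 0 i) /\ L2 P (fun w => a w 0 i).

Lemma adaptedL2_le A B {n} (a : Omega -> 'rV[R]_n) : A `<=` B -> adaptedL2 A a -> adaptedL2 B a.
Proof.
by move=> AB Aa i; have [ma La] := Aa i; split=> // E mE; apply: AB; exact: ma.
Qed.

Lemma integ_dot A {n} (a b : Omega -> 'rV[R]_n) :
  adaptedL2 A a -> adaptedL2 A b -> integ P (fun w => dot (a w) (b w)).
Proof.
move=> Aa Ab; apply: integ_sum => i; apply: L2_mul.
  exact: (Aa i).2.
exact: (Ab i).2.
Qed.

Lemma Ex_dot A {n} (a b : Omega -> 'rV[R]_n) : adaptedL2 A a -> adaptedL2 A b ->
  Ex (fun w => dot (a w) (b w)) = \sum_i Ex (fun w => a w 0 i * b w 0 i).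
Proof.
move=> Aa Ab; rewrite /dot Ex_sum// => i; apply: L2_mul.
  exact: (Aa i).2.
exact: (Ab i).2.
Qed.

Section fixed_algebra.
Variable A : set (set Omega).
Hypothesis subA : Defs.sub_sigma_algebra A.

Local Notation TA := (g_sigma_algebraType A).

Lemma adaptedL2_coord {n} (a : Omega -> 'rV[R]_n) :
  adaptedL2 A a -> measurable_coord (a : TA -> 'rV[R]_n).
Proof. by move=> Aa i; apply/(measurable_wrtP subA); exact: (Aa i).1. Qed.

Lemma measurable_sq {n} (a : Omega -> 'rV[R]_n) :
  adaptedL2 A a -> measurable_fun [set: TA] (fun w : TA => sq (a w)).
Proof.
move=> Aa; apply: measurable_sum => i.
by apply: measurable_funM; exact: adaptedL2_coord.
Qed.

Lemma adaptedL2_bounded {n} (a : Omega -> 'rV[R]_n) (g : Omega -> R) :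
  (forall i, measurable_wrt A (fun w => a w 0 i)) ->
  (forall w, sq (a w) <= g w) -> integ P g -> adaptedL2 A a.
Proof.
move=> ma ag Ig i; split=> //.
apply: L2_le Ig; first exact: (measurable_wrt_fun subA (ma i)).
by move=> w; exact: le_trans (sq_coord _ _) (ag w).
Qed.

Lemma adaptedL2_cst {n} (c : 'rV[R]_n) : adaptedL2 A (fun=> c).
Proof.
move=> i; split; last exact: L2_cst.
by apply/(measurable_wrtP subA); exact: measurable_cst.
Qed.

Lemma adaptedL2D {n} (a b : Omega -> 'rV[R]_n) :
  adaptedL2 A a -> adaptedL2 A b -> adaptedL2 A (fun w => a w + b w).
Proof.
move=> Aa Ab i; have [ma La] := Aa i; have [mb Lb] := Ab i.
under eq_fun do rewrite mxE; split; last exact: L2D.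
apply/(measurable_wrtP subA); apply: measurable_funD.
  exact/(measurable_wrtP subA).
exact/(measurable_wrtP subA).
Qed.

Lemma adaptedL2Z {n} (t : R) (a : Omega -> 'rV[R]_n) :
  adaptedL2 A a -> adaptedL2 A (fun w => t *: a w).
Proof.
move=> Aa i; have [ma La] := Aa i.
under eq_fun do rewrite mxE; split; last exact: L2Z.
apply/(measurable_wrtP subA); apply: measurable_funM; first exact: measurable_cst.
exact/(measurable_wrtP subA).
Qed.

Lemma adaptedL2B {n} (a b : Omega -> 'rV[R]_n) :
  adaptedL2 A a -> adaptedL2 A b -> adaptedL2 A (fun w => a w - b w).
Proof.
move=> Aa Ab; have := adaptedL2D Aa (adaptedL2Z (-1) Ab).
by under eq_fun do rewrite scaleN1r.
Qed.

(** A Lipschitz map grows at most linearly, so it preserves square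
    integrability. *)
Lemma adaptedL2_lipschitz {n k} (phi : 'rV[R]_n -> 'rV[R]_k) (K : R)
    (a : Omega -> 'rV[R]_n) :
  (forall u v, sq (phi u - phi v) <= K * sq (u - v)) ->
  adaptedL2 A a -> adaptedL2 A (fun w => phi (a w)).
Proof.
move=> phiK Aa.
apply: (@adaptedL2_bounded _ _ (fun w => 2 * (K * dot (a w) (a w)) + 2 * sq (phi 0))).
- move=> i; apply/(measurable_wrtP subA).
  apply: (measurable_continuous (adaptedL2_coord Aa)
    (phi := fun v : 'rV[R]_n => phi v 0 i)).
  apply: (lipschitz_sq_continuous (K := K)) => u v.
  by apply: le_trans (phiK u v); have := sq_coord (phi u - phi v) i; rewrite !mxE.
- move=> w; have := sq_sum2 (phi (a w) - phi 0) (phi 0); rewrite subrK.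
  have := phiK (a w) 0; rewrite subr0 /sq; lra.
- apply: integD; last exact: integ_cst.
  by apply: integZ; apply: integZ; exact: integ_dot.
Qed.

End fixed_algebra.

End adapted_vectors.

(** * Stochastic gradients *)

Section row_vectors.
Context {R : realType} {n : nat}.
Implicit Types (a b c : 'rV[R]_n).

Lemma row_sub a b i : (a - b) 0 i = a 0 i - b 0 i.
Proof. by rewrite !mxE. Qed.

Lemma dot_suml m (a : 'I_m -> 'rV[R]_n) c :
  dot (\sum_i a i) c = \sum_i dot (a i) c.
Proof.
by apply: (big_morph (fun v => dot v c)) => [u v|]; rewrite ?dotDl ?dot0l.
Qed.

Lemma psqD {p} (u v : 'rV[R]_n * 'rV[R]_p) :
  psq (u.1 + v.1, u.2 + v.2) =
  psq u + psq v + 2 * (dot v.1 u.1 + dot v.2 u.2).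
Proof. by rewrite /psq !sqD (dotC v.1) (dotC v.2); ring. Qed.

Lemma sq_growth {p} a b (a' b' : 'rV[R]_p) (M : R) :
  sq (a - b) + sq (a' - b') <= M ->
  sq a + sq a' <= 2 * M + 2 * (sq b + sq b').
Proof.
have := sq_sum2 (a - b) b; have := sq_sum2 (a' - b') b'.
by rewrite !subrK; lra.
Qed.

End row_vectors.

Section oracle.
Context {R : realType} {n p : nat} {dS : measure_display} {S : measurableType dS}.
Variables (D : probability S R) (f : 'rV[R]_n * 'rV[R]_p -> S -> R).
Variables (X : set 'rV[R]_n) (Y : set 'rV[R]_p) (L sigma : R).
Context {d : measure_display} {Omega : measurableType d}.
Variable P : probability Omega R.
Hypotheses (clX : closed X) (clY : closed Y).
Hypothesis msgrad : measurable_fun ((X `*` Y) `*` setT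
    : set (borel_pair R n p * S))
  (fun q => sgrad f q.1 q.2 : borel_pair R n p).
Hypothesis oracleH : stochastic_oracle D f X Y sigma P.

Local Notation F := (expected D f).
Local Notation Ex f := (\int[P]_w (f w))%R.

Hypothesis lipF : forall u u', (X `*` Y) u -> (X `*` Y) u' ->
  sq (gradx F u - gradx F u') + sq (grady F u - grady F u')
    <= L ^+ 2 * (sq (u.1 - u'.1) + sq (u.2 - u'.2)).

Section one_sample.
Variables (A : set (set Omega)) (u : Omega -> 'rV[R]_n * 'rV[R]_p).
Variable s : {mfun Omega >-> S}.
Hypothesis subA : Defs.sub_sigma_algebra A.
Hypotheses (u1 : adaptedL2 P A (fun w => (u w).1)) (u2 : adaptedL2 P A (fun w => (u w).2)).
Hypothesis uXY : forall w, (X `*` Y) (u w).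
Hypothesis s_law : forall B, measurable B -> distribution P s B = D B.
Hypothesis s_indep : independent P A (g_sigma_algebra_preimage s).

Definition noise (w : Omega) : 'rV[R]_n * 'rV[R]_p :=
  ((sgrad f (u w) (s w)).1 - gradx F (u w),
   (sgrad f (u w) (s w)).2 - grady F (u w)).

Let noise1 w i : (noise w).1 0 i =
  (sgrad f (u w) (s w)).1 0 i - gradx F (u w) 0 i.
Proof. exact: row_sub. Qed.

Let noise2 w i : (noise w).2 0 i =
  (sgrad f (u w) (s w)).2 0 i - grady F (u w) 0 i.
Proof. exact: row_sub. Qed.

Let u_pair : measurable_wrt A (u : Omega -> borel_pair R n p).
Proof.
apply/(measurable_wrtP subA).
have -> : u = (fun w => ((u w).1, (u w).2)) by apply/funext => w; case: (u w).
by apply: measurable_pair_open; exact: adaptedL2_coord.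
Qed.

Let oracleA := oracleH subA u_pair uXY s_law s_indep.

(** The measurability of the exact gradient comes with the oracle, as it is a
    conditional expectation; its growth is at most linear. *)
Lemma adaptedL2_gradient :
  adaptedL2 P A (fun w => gradx F (u w)) /\ adaptedL2 P A (fun w => grady F (u w)).
Proof.
have [H1 H2 _] := oracleA; have [w0] : [set: Omega] !=set0.
  apply/set0P/eqP => O0; have := probability_setT P.
  by rewrite O0 measure0 => /esym/eqP; rewrite onee_eq0.
move=> _; pose q w := sq ((u w).1 - (u w0).1) + sq ((u w).2 - (u w0).2).
pose g w := 2 * (L ^+ 2 * q w) + 2 * (sq (gradx F (u w0)) + sq (grady F (u w0))).
have Ig : integ P g.
  have D1 := adaptedL2B subA u1 (adaptedL2_cst P subA (u w0).1).
  have D2 := adaptedL2B subA u2 (adaptedL2_cst P subA (u w0).2).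
  apply: integD; last exact: integ_cst.
  by apply: integZ; apply: integZ; apply: integD; exact: integ_dot.
have both w : sq (gradx F (u w)) + sq (grady F (u w)) <= g w.
  exact: sq_growth (lipF (uXY w) (uXY w0)).
split; apply: (adaptedL2_bounded subA _ _ Ig).
- by move=> i; have [] := H1 i.
- by move=> w; apply: le_trans (both w); rewrite lerDl sq_ge0.
- by move=> i; have [] := H2 i.
- by move=> w; apply: le_trans (both w); rewrite lerDr sq_ge0.
Qed.

Lemma noise_sq : integ P (fun w => psq (noise w)) /\
  Ex (fun w => psq (noise w)) <= sigma ^+ 2.
Proof.
have [_ _ [V [HV Vle]]] := oracleA.
have -> : (fun w => psq (noise w)) = (fun w =>
    penorm (sgrad f (u w) (s w) - grad F (u w)) ^+ 2).
  by apply/funext => w; rewrite penorm_sq.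
by apply: (cond_exp_le subA HV) => // w; exact: sqr_ge0.
Qed.

Lemma noise_adapted B : Defs.sub_sigma_algebra B -> A `<=` B ->
  g_sigma_algebra_preimage s `<=` B ->
  adaptedL2 P B (fun w => (noise w).1) /\ adaptedL2 P B (fun w => (noise w).2).
Proof.
move=> subB AB sB; have [G1 G2] := adaptedL2_gradient.
have [Ipsq _] := noise_sq.
pose TB := g_sigma_algebraType B.
have mu : measurable_fun [set: TB] (u : TB -> borel_pair R n p).
  by apply/(measurable_wrtP subB) => E mE; apply: AB; exact: u_pair.
have ms : measurable_fun [set: TB] (s : TB -> S).
  apply/(measurable_wrtP subB) => E mE; apply: sB.
  by exists E => //; rewrite setTI.
have mg : measurable_fun [set: TB]
    (fun w : TB => sgrad f (u w) (s w) : borel_pair R n p).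
  apply: (@measurable_comp _ _ _ TB (borel_pair R n p * S)%type (borel_pair R n p)
    ((X `*` Y) `*` setT) (fun q => sgrad f q.1 q.2) setT (fun w => (u w, s w))) => //.
  - apply: (@measurableX _ _ (borel_pair R n p) S) => //.
    exact: closed_measurable_pair.
  - by move=> _ [w _ <-]; split=> //; exact: uXY.
  - exact: measurable_fun_pair.
split; apply: (adaptedL2_bounded subB _ _ Ipsq).
- move=> i; apply/(measurable_wrtP subB).
  under eq_fun do rewrite noise1; apply: measurable_funB.
    exact: (measurable_coord_fst mg).
  exact: (adaptedL2_coord subB (adaptedL2_le AB G1)).
- by move=> w; rewrite /psq lerDl sq_ge0.
- move=> i; apply/(measurable_wrtP subB).
  under eq_fun do rewrite noise2; apply: measurable_funB.
    exact: (measurable_coord_snd mg).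
  exact: (adaptedL2_coord subB (adaptedL2_le AB G2)).
- by move=> w; rewrite /psq lerDr sq_ge0.
Qed.

Lemma noise_orthogonal B : Defs.sub_sigma_algebra B -> A `<=` B ->
  g_sigma_algebra_preimage s `<=` B ->
  (forall c, adaptedL2 P A c -> Ex (fun w => dot (noise w).1 (c w)) = 0) /\
  (forall c, adaptedL2 P A c -> Ex (fun w => dot (noise w).2 (c w)) = 0).
Proof.
move=> subB AB sB; have [N1 N2] := noise_adapted subB AB sB.
have [H1 H2 _] := oracleA.
split=> c Ac; rewrite (Ex_dot _ (adaptedL2_le AB Ac))// big1// => i _.
- have [mc Lc] := Ac i; have [_ LN] := N1 i.
  move: LN; under eq_fun do rewrite noise1; move=> LN.
  under eq_Rintegral do rewrite noise1.
  exact: (cond_exp_orthogonal subA (H1 i) (L2_integ LN) mc (L2_mul LN Lc)).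
- have [mc Lc] := Ac i; have [_ LN] := N2 i.
  move: LN; under eq_fun do rewrite noise2; move=> LN.
  under eq_Rintegral do rewrite noise2.
  exact: (cond_exp_orthogonal subA (H2 i) (L2_integ LN) mc (L2_mul LN Lc)).
Qed.

End one_sample.

Section one_batch.
Variables (A : nat -> set (set Omega)) (s : nat -> {mfun Omega >-> S}) (m : nat).
Variable u : Omega -> 'rV[R]_n * 'rV[R]_p.
Hypothesis m_gt0 : (0 < m)%N.
Hypothesis subA : forall i, Defs.sub_sigma_algebra (A i).
Hypothesis A_mono : forall i, A i `<=` A i.+1.
Hypothesis sA : forall i, (i < m)%N -> g_sigma_algebra_preimage (s i) `<=` A i.+1.
Hypothesis s_law : forall i, (i < m)%N ->
  forall B, measurable B -> distribution P (s i) B = D B.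
Hypothesis s_indep : forall i, (i < m)%N ->
  independent P (A i) (g_sigma_algebra_preimage (s i)).
Hypotheses (u1 : adaptedL2 P (A 0) (fun w => (u w).1)) (u2 : adaptedL2 P (A 0) (fun w => (u w).2)).
Hypothesis uXY : forall w, (X `*` Y) (u w).

Let A0_le i : A 0 `<=` A i.
Proof. by elim: i => [//|i IH] E /IH; exact: A_mono. Qed.

Let U1 i := adaptedL2_le (@A0_le i) u1.
Let U2 i := adaptedL2_le (@A0_le i) u2.

Definition noise_sum (k : nat) (w : Omega) : 'rV[R]_n * 'rV[R]_p :=
  (\sum_(i < k) (noise u (s i) w).1, \sum_(i < k) (noise u (s i) w).2).

(** Each error is orthogonal to the earlier ones, so that the variances add. *)
Lemma noise_sum_bound k : (k <= m)%N ->
  [/\ adaptedL2 P (A k) (fun w => (noise_sum k w).1),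
      adaptedL2 P (A k) (fun w => (noise_sum k w).2),
      integ P (fun w => psq (noise_sum k w)) &
      Ex (fun w => psq (noise_sum k w)) <= k%:R * sigma ^+ 2].
Proof.
elim: k => [|k IH] km.
  have -> : noise_sum 0 = fun=> (0, 0).
    by apply/funext => w; rewrite /noise_sum !big_ord0.
  have -> : (fun w : Omega => psq ((0, 0) : 'rV[R]_n * 'rV[R]_p)) = (fun=> 0).
    by apply/funext => w; rewrite /psq /sq !dot0l addr0.
  by rewrite Ex_cst mul0r; split=> //; [exact: adaptedL2_cst|exact: adaptedL2_cst|exact: integ_cst].
have [S1 S2 IS ES] := IH (ltnW km).
have [N1 N2] := noise_adapted (subA k) (U1 k) (U2 k) uXY (s_law km) (s_indep km)
  (subA k.+1) (@A_mono k) (sA km).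
have [T1 T2] := noise_orthogonal (subA k) (U1 k) (U2 k) uXY (s_law km)
  (s_indep km) (subA k.+1) (@A_mono k) (sA km).
have [IN EN] := noise_sq (subA k) (U1 k) (U2 k) uXY (s_law km) (s_indep km).
have S1' := adaptedL2_le (@A_mono k) S1; have S2' := adaptedL2_le (@A_mono k) S2.
have E1 : (fun w => (noise_sum k.+1 w).1) =
    (fun w => (noise_sum k w).1 + (noise u (s k) w).1).
  by apply/funext => w; rewrite /noise_sum/= big_ord_recr.
have E2 : (fun w => (noise_sum k.+1 w).2) =
    (fun w => (noise_sum k w).2 + (noise u (s k) w).2).
  by apply/funext => w; rewrite /noise_sum/= big_ord_recr.
have E w : psq (noise_sum k.+1 w) = psq (noise_sum k w) + psq (noise u (s k) w)
    + 2 * (dot (noise u (s k) w).1 (noise_sum k w).1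
           + dot (noise u (s k) w).2 (noise_sum k w).2).
  by rewrite -psqD /psq (congr1 (@^~ w) E1) (congr1 (@^~ w) E2).
have I1 := integ_dot N1 S1'; have I2 := integ_dot N2 S2'.
have I12 := integZ 2 (integD I1 I2).
split.
- by rewrite E1; exact: adaptedL2D.
- by rewrite E2; exact: adaptedL2D.
- by under eq_fun do rewrite E; apply: integD => //; exact: integD.
- under eq_Rintegral do rewrite E.
  rewrite ExD//; last exact: integD.
  rewrite ExD// ExZ; last exact: integD.
  rewrite ExD// (T1 _ S1) (T2 _ S2) addr0 mulr0 addr0 -natr1 mulrDl mul1r.
  exact: lerD.
Qed.

Definition batch_of (w : Omega) : seq S := mkseq (s ^~ w) m.

Definition averaged_noise (w : Omega) : 'rV[R]_n * 'rV[R]_p :=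
  batch_error (gradx F) (grady F) (sgrad f) (u w) (batch_of w).

Lemma averaged_noiseE w : averaged_noise w =
  (m%:R^-1 *: (noise_sum m w).1, m%:R^-1 *: (noise_sum m w).2).
Proof.
rewrite /averaged_noise /batch_error /minibatch /batch_of size_mkseq /=.
have m0 : m%:R != 0 :> R by rewrite pnatr_eq0 -lt0n.
have sumE (V : lmodType R) (a : nat -> V) (b : V) :
    m%:R^-1 *: (\sum_(i < m) (a i)) - b = m%:R^-1 *: (\sum_(i < m) (a i - b)).
  rewrite sumrB sumr_const card_ord scalerBr -[b *+ m]scaler_nat scalerA mulVf//.
  by rewrite scale1r.
have mapE : \sum_(x <- mkseq (fun i => s i w) m) sgrad f (u w) x =
    \sum_(i < m) sgrad f (u w) (s i w).
  by rewrite big_map -[X in iota 0 X]subn0 big_mkord.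
rewrite mapE; congr pair.
  rewrite -(sumE _ (fun i => (sgrad f (u w) (s i w)).1)); congr (_ *: _ - _).
  exact: (big_morph fst (fun _ _ => erefl) erefl).
rewrite -(sumE _ (fun i => (sgrad f (u w) (s i w)).2)); congr (_ *: _ - _).
by elim/big_rec2: _ => //= i a b _ <-.
Qed.

Lemma averaged_noise_bound :
  [/\ adaptedL2 P (A m) (fun w => (averaged_noise w).1),
      adaptedL2 P (A m) (fun w => (averaged_noise w).2),
      integ P (fun w => psq (averaged_noise w)) &
      Ex (fun w => psq (averaged_noise w)) <= sigma ^+ 2 / m%:R].
Proof.
have [S1 S2 IS ES] := noise_sum_bound (leqnn m).
have E1 : (fun w => (averaged_noise w).1) = (fun w => m%:R^-1 *: (noise_sum m w).1).
  by apply/funext => w; rewrite averaged_noiseE.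
have E2 : (fun w => (averaged_noise w).2) = (fun w => m%:R^-1 *: (noise_sum m w).2).
  by apply/funext => w; rewrite averaged_noiseE.
have m0 : 0 < m%:R :> R by rewrite ltr0n.
have E w : psq (averaged_noise w) = (m%:R^-1 ^+ 2) * psq (noise_sum m w).
  by rewrite averaged_noiseE /psq !sqZ -mulrDr.
split.
- by rewrite E1; exact: adaptedL2Z.
- by rewrite E2; exact: adaptedL2Z.
- by under eq_fun do rewrite E; exact: integZ.
- under eq_Rintegral do rewrite E.
  rewrite ExZ//; apply: (le_trans (ler_wpM2l _ ES)); first exact: sqr_ge0.
  by rewrite le_eqVlt; apply/orP; left; apply/eqP; field; rewrite gt_eqF.
Qed.

Lemma averaged_noise_orthogonal :
  (forall c, adaptedL2 P (A 0) c -> Ex (fun w => dot (averaged_noise w).1 (c w)) = 0) /\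
  (forall c, adaptedL2 P (A 0) c -> Ex (fun w => dot (averaged_noise w).2 (c w)) = 0).
Proof.
have N i (im : (i < m)%N) := noise_adapted (subA i) (U1 i) (U2 i) uXY (s_law im)
  (s_indep im) (subA i.+1) (@A_mono i) (sA im).
have O i (im : (i < m)%N) := noise_orthogonal (subA i) (U1 i) (U2 i) uXY
  (s_law im) (s_indep im) (subA i.+1) (@A_mono i) (sA im).
split=> c Ac.
- have E w : dot (averaged_noise w).1 (c w) =
      m%:R^-1 * \sum_(i < m) dot (noise u (s i) w).1 (c w).
    by rewrite averaged_noiseE dotZl dot_suml.
  have I (i : 'I_m) := integ_dot (N i (ltn_ord i)).1 (adaptedL2_le (@A0_le i.+1) Ac).
  under eq_Rintegral do rewrite E.
  rewrite ExZ; last exact: integ_sum.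
  rewrite Ex_sum// big1 ?mulr0// => i _.
  by rewrite (O i (ltn_ord i)).1//; exact: (adaptedL2_le (@A0_le i) Ac).
- have E w : dot (averaged_noise w).2 (c w) =
      m%:R^-1 * \sum_(i < m) dot (noise u (s i) w).2 (c w).
    by rewrite averaged_noiseE dotZl dot_suml.
  have I (i : 'I_m) := integ_dot (N i (ltn_ord i)).2 (adaptedL2_le (@A0_le i.+1) Ac).
  under eq_Rintegral do rewrite E.
  rewrite ExZ; last exact: integ_sum.
  rewrite Ex_sum// big1 ?mulr0// => i _.
  by rewrite (O i (ltn_ord i)).2//; exact: (adaptedL2_le (@A0_le i) Ac).
Qed.

End one_batch.

End oracle.

(** * The random trajectory *)

Section random_trajectory.
Context {R : realType} {n p : nat} {dS : measure_display} {S : measurableType dS}.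
Variables (D : probability S R) (f : 'rV[R]_n * 'rV[R]_p -> S -> R).
Variables (X : set 'rV[R]_n) (Y : set 'rV[R]_p) (L mu g sigma : R).
Context {d : measure_display} {Omega : measurableType d}.
Variable P : probability Omega R.
Variables (m T : nat) (s : nat -> nat -> nat -> {mfun Omega >-> S}).

Local Notation F := (expected D f).
Local Notation G := (sgrad f).
Local Notation Ex f := (\int[P]_w (f w))%R.
Local Notation sad := (saddle X Y (gradx F) (grady F) L).

Hypothesis H : smooth_concave X Y F (gradx F) (grady F) L mu.
Hypothesis g_gt0 : 0 < g.
Hypothesis g_le : g <= 1 / 11.
Hypothesis muE : mu = 128 * L * g ^+ 2.
Variables h alpha k beta : R.
Hypothesis hL : L * h = 1 / 192.
Hypothesis alphaE : (1 + 1 / 192 * g) * alpha = 1.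
Hypothesis kE : (1 + 1 / 192 * g) * k = 1 / 192 * (1 / 2 - g).
Hypothesis betaE : beta = 1 / 192 * g / 256.
Hypothesis msgrad : measurable_fun ((X `*` Y) `*` setT
    : set (borel_pair R n p * S))
  (fun q => sgrad f q.1 q.2 : borel_pair R n p).
Hypothesis oracleH : stochastic_oracle D f X Y sigma P.
Hypothesis m_gt0 : (0 < m)%N.
Hypothesis s_law : forall q, used m T q -> forall B, measurable B ->
  distribution P (s q.1.1 q.1.2 q.2) B = D B.
Hypothesis s_indep : mutually_independent P (used m T) (sample_algebra s).

Lemma sample_sub_sigma_algebra q : Defs.sub_sigma_algebra (sample_algebra s q).
Proof.
split; first exact: sigma_algebra_preimage (sigma_algebra_measurable _).
by move=> _ [B mB <-]; exact: (@measurable_funPT _ _ _ _ (s q.1.1 q.1.2 q.2) measurableT B mB).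
Qed.

Definition rank (q : nat * nat * nat) : nat := ((q.1.1 * 3 + q.1.2) * m + q.2)%N.

(** As [rank] numbers the samples in the order of the queries, this is the natural
    filtration of the method. *)
Definition past (r : nat) : set (set Omega) :=
  generated (sample_algebra s) [set q | used m T q /\ (rank q < r)%N].

Lemma past_sub_sigma_algebra r : Defs.sub_sigma_algebra (past r).
Proof. exact: generated_sub_sigma_algebra sample_sub_sigma_algebra _. Qed.

Lemma past_le r r' : (r <= r')%N -> past r `<=` past r'.
Proof.
by move=> rr'; apply: generated_le => q [Uq qr]; split=> //; exact: leq_trans rr'.
Qed.

Lemma adaptedL2_past {q} r r' (a : Omega -> 'rV[R]_q) : (r <= r')%N ->
  adaptedL2 P (past r) a -> adaptedL2 P (past r') a.
Proof. by move=> rr'; apply: adaptedL2_le; exact: past_le. Qed.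

Let samples (w : Omega) t j i := s t j i w.
Let error t j (u : Omega -> 'rV[R]_n * 'rV[R]_p) w :=
  batch_error (gradx F) (grady F) G (u w) (batch m (samples w) t j).
Let answer t j (u : Omega -> 'rV[R]_n * 'rV[R]_p) w :=
  (minibatch G (u w) (batch m (samples w) t j)).1.

Section query.
Variables (t j r : nat) (u : Omega -> 'rV[R]_n * 'rV[R]_p).
Hypotheses (tT : (t < T)%N) (j3 : (j < 3)%N) (rE : r = ((t * 3 + j) * m)%N).
Hypotheses (u1 : adaptedL2 P (past r) (fun w => (u w).1))
  (u2 : adaptedL2 P (past r) (fun w => (u w).2)).
Hypothesis uXY : forall w, (X `*` Y) (u w).

Let u10 : adaptedL2 P (past (r + 0)) (fun w => (u w).1).
Proof. by rewrite addn0. Qed.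

Let u20 : adaptedL2 P (past (r + 0)) (fun w => (u w).2).
Proof. by rewrite addn0. Qed.

Let law i : (i < m)%N -> forall B, measurable B -> distribution P (s t j i) B = D B.
Proof. by move=> im; apply: (s_law (q := (t, j, i))). Qed.

Let past_mono i : past (r + i) `<=` past (r + i.+1).
Proof. by apply: past_le; rewrite leq_add2l. Qed.

Let known i : (i < m)%N -> g_sigma_algebra_preimage (s t j i) `<=` past (r + i.+1).
Proof.
move=> im; apply: (sub_generated (G := sample_algebra s) (i := (t, j, i))).
by split; [split|rewrite /rank/= -rE addnS].
Qed.

Let fresh i : (i < m)%N ->
  independent P (past (r + i)) (g_sigma_algebra_preimage (s t j i)).
Proof.
move=> im; apply: (generated_independent sample_sub_sigma_algebra s_indep (q := (t, j, i))).
- by move=> q [].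
- by split.
- by case=> _; rewrite /rank/= -rE ltnn.
Qed.

(** Splitting [past (r + m)] sample by sample makes a batch an instance of the
    general averaging bound. *)
Lemma query_error :
  [/\ adaptedL2 P (past (r + m)) (fun w => (error t j u w).1),
      adaptedL2 P (past (r + m)) (fun w => (error t j u w).2),
      integ P (fun w => psq (error t j u w)) &
      Ex (fun w => psq (error t j u w)) <= sigma ^+ 2 / m%:R].
Proof.
exact: (@averaged_noise_bound R n p dS S D f X Y L sigma d Omega P (domX_closed H)
  (domY_closed H) msgrad oracleH (gradient_lipschitz H) (fun i => past (r + i))
  (s t j) m u m_gt0 (fun i => past_sub_sigma_algebra _) past_mono known law fresh
  u10 u20 uXY).
Qed.

Lemma query_orthogonal :
  (forall c, adaptedL2 P (past r) c -> Ex (fun w => dot (error t j u w).1 (c w)) = 0) /\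
  (forall c, adaptedL2 P (past r) c -> Ex (fun w => dot (error t j u w).2 (c w)) = 0).
Proof.
have := @averaged_noise_orthogonal R n p dS S D f X Y L sigma d Omega P (domX_closed H)
  (domY_closed H) msgrad oracleH (gradient_lipschitz H) (fun i => past (r + i))
  (s t j) m u m_gt0 (fun i => past_sub_sigma_algebra _) past_mono known law fresh
  u10 u20 uXY.
by rewrite addn0.
Qed.

Lemma query_gradient : adaptedL2 P (past r) (fun w => gradx F (u w)) /\
  adaptedL2 P (past r) (fun w => grady F (u w)).
Proof.
have := @adaptedL2_gradient R n p dS S D f X Y L sigma d Omega P oracleH
  (gradient_lipschitz H) (past (r + 0)) u (s t j 0) (past_sub_sigma_algebra _)
  u10 u20 uXY (law m_gt0) (fresh m_gt0).
by rewrite addn0.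
Qed.

Lemma query_answer : adaptedL2 P (past (r + m)) (fun w => (answer t j u w).1) /\
  adaptedL2 P (past (r + m)) (fun w => (answer t j u w).2).
Proof.
have [E1 E2 _ _] := query_error; have [G1 G2] := query_gradient.
have rm : (r <= r + m)%N by rewrite leq_addr.
split.
  have := adaptedL2D (past_sub_sigma_algebra _) E1 (adaptedL2_past rm G1).
  by under eq_fun do rewrite /error /= subrK.
have := adaptedL2D (past_sub_sigma_algebra _) E2 (adaptedL2_past rm G2).
by under eq_fun do rewrite /error /= subrK.
Qed.

End query.

Variables (x0 : 'rV[R]_n) (y0 : 'rV[R]_p).
Hypotheses (Xx0 : X x0) (Yy0 : Y y0).

Let run w := spde X Y G L h alpha k beta m (samples w) x0 y0.

Record known_state (r : nat) (st : Omega -> @state R n p) : Prop := KnownState {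
  known_x : adaptedL2 P (past r) (fun w => st_x (st w));
  known_z : adaptedL2 P (past r) (fun w => st_z (st w));
  known_xi : adaptedL2 P (past r) (fun w => st_xi (st w));
  known_y : adaptedL2 P (past r) (fun w => st_y (st w));
  known_n : adaptedL2 P (past r) (fun w => st_n (st w));
  known_v : adaptedL2 P (past r) (fun w => st_v (st w)) }.

Lemma adaptedL2_projX r (a : Omega -> 'rV[R]_n) : adaptedL2 P (past r) a ->
  adaptedL2 P (past r) (fun w => proj X (a w)).
Proof.
apply: (adaptedL2_lipschitz (past_sub_sigma_algebra r) (K := 1)) => u v; rewrite mul1r.
exact: proj_nonexpansive (domX_neq0 H) (domX_closed H) (domX_segment H).
Qed.

Lemma adaptedL2_projY r (a : Omega -> 'rV[R]_p) : adaptedL2 P (past r) a ->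
  adaptedL2 P (past r) (fun w => proj Y (a w)).
Proof.
apply: (adaptedL2_lipschitz (past_sub_sigma_algebra r) (K := 1)) => u v; rewrite mul1r.
exact: proj_nonexpansive (domY_neq0 H) (domY_closed H) (domY_segment H).
Qed.

Lemma adaptedL2_saddle_x r (a : Omega -> 'rV[R]_n) : adaptedL2 P (past r) a ->
  adaptedL2 P (past r) (fun w => (sad (a w)).1).
Proof.
apply: (adaptedL2_lipschitz (past_sub_sigma_algebra r) (phi := fun z => (sad z).1) (K := 4)).
by move=> u v; exact: saddle_x_lipschitz H _ _.
Qed.

Lemma adaptedL2_saddle_y r (a : Omega -> 'rV[R]_n) : adaptedL2 P (past r) a ->
  adaptedL2 P (past r) (fun w => (sad (a w)).2).
Proof.
apply: (adaptedL2_lipschitz (past_sub_sigma_algebra r) (phi := fun z => (sad z).2)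
  (K := L / mu)).
move=> u v; have := saddle_y_lipschitz H v u.
by rewrite mulrAC ler_pdivlMr ?(modulus_gt0 H)// mulrC.
Qed.

(** The update equations with the two later gradients written as answers at known
    points. *)
Lemma step_components (b0 b1 b2 : seq S) st :
  let st' := spde_step X Y G L h alpha k beta b0 b1 b2 st in
  let u := predicted X Y G L h b0 st in
  let g1 := (minibatch G u b1).1 in
  let g2 := (minibatch G (st_point st') b2).1 in
  [/\ st_x st' = proj X (st_x st - h *: (g1.1 + (2 * L) *: (u.1 - st_z st))),
      st_xi st' = h^-1 *: (st_x st - st_x st') - g1.1 - (2 * L) *: (u.1 - st_z st),
      st_y st' = proj Y (st_y st + h *: (g1.2 + (alpha *: st_v st + k *: g1.2))) &
      [/\ st_n st' = (1 + k)^-1 *: (h^-1 *: (st_y st - st_y st') + g1.2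
        + (alpha *: st_v st + k *: g1.2)),
      st_v st' = alpha *: st_v st + k *: (g2.2 - st_n st') &
      st_z st' = st_z st + beta *: (st_x st' - st_z st)]].
Proof. by case: st. Qed.

Lemma admissible_point w t : (X `*` Y) (st_point (run w t)).
Proof.
have [[Xx _] [Yy _]] := @admissible_run R n p S X Y F (gradx F) (grady F) G L mu g
  H g_gt0 g_le muE h alpha k beta hL alphaE kE betaE m (samples w) x0 y0 Xx0 Yy0 t.
by split.
Qed.

Let step_times t : ((t * 3 + 0) * m = t * 3 * m)%N.
Proof. by rewrite addn0. Qed.

Let mean_errors t := Ex (fun w => errors_sq X Y (gradx F) (grady F) G L h alpha k
  beta m (samples w) x0 y0 t).
Let mean_pairing t := Ex (fun w => run_pairing X Y (gradx F) (grady F) G L g h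
  alpha k beta m (samples w) x0 y0 t).

(** Along one iteration the three batches are queried at points known before
    they are drawn; hence the state stays square integrable, the errors have
    the variance of a batch, and their pairings with earlier quantities
    average out. *)
Lemma known_step t : (t < T)%N -> known_state (t * 3 * m) (run ^~ t) ->
  [/\ known_state (t.+1 * 3 * m) (run ^~ t.+1),
      integ P (fun w => errors_sq X Y (gradx F) (grady F) G L h alpha k
        beta m (samples w) x0 y0 t),
      mean_errors t <= 3 * (sigma ^+ 2 / m%:R),
      integ P (fun w => run_pairing X Y (gradx F) (grady F) G L g h
        alpha k beta m (samples w) x0 y0 t) &
      mean_pairing t = 0 /\
      adaptedL2 P (past (t.+1 * 3 * m)) (fun w => gradx F (st_point (run w t.+1))) /\
      adaptedL2 P (past (t.+1 * 3 * m)) (fun w => grady F (st_point (run w t.+1)))].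
Proof.
move=> tT [Kx Kz Kxi Ky Kn Kv].
pose r0 := ((t * 3 + 0) * m)%N; pose r1 := ((t * 3 + 1) * m)%N.
pose r2 := ((t * 3 + 2) * m)%N; pose r3 := (t.+1 * 3 * m)%N.
have r01 : (r0 + m = r1)%N by rewrite /r0 /r1 addn0 addn1 mulSn addnC.
have r12 : (r1 + m = r2)%N by rewrite /r1 /r2 addn1 addn2 mulSn addnC.
have r23 : (r2 + m = r3)%N.
  rewrite /r2 /r3 -[X in (_ + X)%N]mul1n -mulnDl; congr (_ * _)%N.
  by rewrite -addnA mulSn addnC.
have le01 : (r0 <= r1)%N by rewrite -r01 leq_addr.
have le12 : (r1 <= r2)%N by rewrite -r12 leq_addr.
have le23 : (r2 <= r3)%N by rewrite -r23 leq_addr.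
have sub r := past_sub_sigma_algebra r.
rewrite -step_times -/r0 in Kx Kz Kxi Ky Kn Kv.
pose u0 w := st_point (run w t).
pose b j w := batch m (samples w) t j.
pose u1 w := predicted X Y G L h (b 0%N w) (run w t).
pose u2 w := st_point (run w t.+1).
have D0 w : (X `*` Y) (u0 w) := admissible_point w t.
have D1 w : (X `*` Y) (u1 w) by exact: (predicted_dom _ H).
have D2 w : (X `*` Y) (u2 w) := admissible_point w t.+1.
have rr0 : r0 = ((t * 3 + 0) * m)%N by [].
have [E01 E02 IE0 EE0] := query_error (u := u0) tT (ltn0Sn 2) rr0 Kx Ky D0.
have [A01 A02] := query_answer (u := u0) tT (ltn0Sn 2) rr0 Kx Ky D0.
rewrite r01 in E01 E02 A01 A02.
have up01 q (a : Omega -> 'rV[R]_q) := @adaptedL2_past q r0 r1 a le01.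
have up12 q (a : Omega -> 'rV[R]_q) := @adaptedL2_past q r1 r2 a le12.
have up23 q (a : Omega -> 'rV[R]_q) := @adaptedL2_past q r2 r3 a le23.
have K1x : adaptedL2 P (past r1) (fun w => (u1 w).1).
  apply: (adaptedL2_projX (a := fun w => st_x (run w t) - h *: ((answer t 0 u0 w).1
    + (2 * L) *: (st_x (run w t) - st_z (run w t)) + st_xi (run w t)))).
  apply: (adaptedL2B (sub r1)); first exact: up01.
  apply: (adaptedL2Z (sub r1)); apply: (adaptedL2D (sub r1)); last exact: up01.
  apply: (adaptedL2D (sub r1)) => //; apply: (adaptedL2Z (sub r1)).
  by apply: (adaptedL2B (sub r1)); exact: up01.
have K1y : adaptedL2 P (past r1) (fun w => (u1 w).2).
  apply: (adaptedL2_projY (a := fun w => st_y (run w t) + h *: ((answer t 0 u0 w).2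
    - st_n (run w t) + st_v (run w t)))).
  apply: (adaptedL2D (sub r1)); first exact: up01.
  apply: (adaptedL2Z (sub r1)); apply: (adaptedL2D (sub r1)); last exact: up01.
  by apply: (adaptedL2B (sub r1)) => //; exact: up01.
have rr1 : r1 = ((t * 3 + 1) * m)%N by [].
have [E11 E12 IE1 EE1] := query_error (u := u1) tT (isT : (1 < 3)%N) rr1 K1x K1y D1.
have [A11 A12] := query_answer (u := u1) tT (isT : (1 < 3)%N) rr1 K1x K1y D1.
have [T11 T12] := query_orthogonal (u := u1) tT (isT : (1 < 3)%N) rr1 K1x K1y D1.
rewrite r12 in E11 E12 A11 A12.
have up02 q (a : Omega -> 'rV[R]_q) Ha := up12 q a (up01 q a Ha).
have step w := step_components (b 0%N w) (b 1%N w) (b 2%N w) (run w t).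
have K2x : adaptedL2 P (past r2) (fun w => st_x (run w t.+1)).
  have -> : (fun w => st_x (run w t.+1)) = (fun w => proj X (st_x (run w t)
      - h *: ((answer t 1 u1 w).1 + (2 * L) *: ((u1 w).1 - st_z (run w t))))).
    by apply/funext => w; have [-> _ _ _] := step w.
  apply: adaptedL2_projX; apply: (adaptedL2B (sub r2)); first exact: up02.
  apply: (adaptedL2Z (sub r2)); apply: (adaptedL2D (sub r2)) => //; apply: (adaptedL2Z (sub r2)).
  by apply: (adaptedL2B (sub r2)); [exact: up12|exact: up02].
have K2xi : adaptedL2 P (past r2) (fun w => st_xi (run w t.+1)).
  have -> : (fun w => st_xi (run w t.+1)) = (fun w =>
      h^-1 *: (st_x (run w t) - st_x (run w t.+1)) - (answer t 1 u1 w).1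
      - (2 * L) *: ((u1 w).1 - st_z (run w t))).
    by apply/funext => w; have [_ -> _ _] := step w.
  apply: (adaptedL2B (sub r2)); last first.
    by apply/(adaptedL2Z (sub r2))/(adaptedL2B (sub r2)); [exact: up12|exact: up02].
  apply: (adaptedL2B (sub r2)) => //; apply/(adaptedL2Z (sub r2))/(adaptedL2B (sub r2)) => //.
  exact: up02.
have Kvbar : adaptedL2 P (past r2) (fun w => alpha *: st_v (run w t)
    + k *: (answer t 1 u1 w).2).
  by apply: (adaptedL2D (sub r2)); apply: (adaptedL2Z (sub r2)) => //; exact: up02.
have K2y : adaptedL2 P (past r2) (fun w => st_y (run w t.+1)).
  have -> : (fun w => st_y (run w t.+1)) = (fun w => proj Y (st_y (run w t)
      + h *: ((answer t 1 u1 w).2 + (alpha *: st_v (run w t)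
      + k *: (answer t 1 u1 w).2)))).
    by apply/funext => w; have [_ _ -> _] := step w.
  apply: adaptedL2_projY; apply: (adaptedL2D (sub r2)); first exact: up02.
  by apply/(adaptedL2Z (sub r2))/(adaptedL2D (sub r2)).
have K2n : adaptedL2 P (past r2) (fun w => st_n (run w t.+1)).
  have -> : (fun w => st_n (run w t.+1)) = (fun w => (1 + k)^-1 *:
      (h^-1 *: (st_y (run w t) - st_y (run w t.+1)) + (answer t 1 u1 w).2
      + (alpha *: st_v (run w t) + k *: (answer t 1 u1 w).2))).
    by apply/funext => w; have [_ _ _ [-> _ _]] := step w.
  apply: (adaptedL2Z (sub r2)); apply: (adaptedL2D (sub r2)) => //.
  apply: (adaptedL2D (sub r2)) => //; apply/(adaptedL2Z (sub r2))/(adaptedL2B (sub r2)) => //.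
  exact: up02.
have K2z : adaptedL2 P (past r2) (fun w => st_z (run w t.+1)).
  have -> : (fun w => st_z (run w t.+1)) = (fun w => st_z (run w t)
      + beta *: (st_x (run w t.+1) - st_z (run w t))).
    by apply/funext => w; have [_ _ _ [_ _ ->]] := step w.
  apply: (adaptedL2D (sub r2)); first exact: up02.
  by apply/(adaptedL2Z (sub r2))/(adaptedL2B (sub r2)) => //; exact: up02.
have rr2 : r2 = ((t * 3 + 2) * m)%N by [].
have [E21 E22 IE2 EE2] := query_error (u := u2) tT (isT : (2 < 3)%N) rr2 K2x K2y D2.
have [A21 A22] := query_answer (u := u2) tT (isT : (2 < 3)%N) rr2 K2x K2y D2.
have [G21 G22] := query_gradient (u := u2) tT (isT : (2 < 3)%N) rr2 K2x K2y D2.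
have [T21 T22] := query_orthogonal (u := u2) tT (isT : (2 < 3)%N) rr2 K2x K2y D2.
rewrite r23 in E21 E22 A21 A22.
have K3v : adaptedL2 P (past r3) (fun w => st_v (run w t.+1)).
  have -> : (fun w => st_v (run w t.+1)) = (fun w => alpha *: st_v (run w t)
      + k *: ((answer t 2 u2 w).2 - st_n (run w t.+1))).
    by apply/funext => w; have [_ _ _ [_ -> _]] := step w.
  apply: (adaptedL2D (sub r3)); apply: (adaptedL2Z (sub r3)); first by apply/up23/up02.
  by apply: (adaptedL2B (sub r3)) => //; exact: up23.
have IE : integ P (fun w => psq (error t 0 u0 w) + psq (error t 1 u1 w)).
  exact: integD.
pose c2 w := corrector_weight X Y (gradx F) (grady F) L g h k (st_z (run w t))
  (st_y (run w t)) (st_y (run w t.+1)).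
pose c11 w := predictor_weight_x X Y (gradx F) (grady F) L g (st_z (run w t)) (u1 w).1.
pose c12 w := predictor_weight_y X Y (gradx F) (grady F) L g k (st_z (run w t)) (u1 w).2.
have C2 : adaptedL2 P (past r2) c2.
  apply: (adaptedL2D (sub r2)); apply: (adaptedL2Z (sub r2)); apply: (adaptedL2Z (sub r2)).
    by apply: (adaptedL2B (sub r2)) => //; exact: up02.
  by apply: (adaptedL2B (sub r2)) => //; apply: adaptedL2_saddle_y; exact: up02.
have C11 : adaptedL2 P (past r1) c11.
  apply: (adaptedL2Z (sub r1)); apply: (adaptedL2Z (sub r1)).
  by apply: (adaptedL2B (sub r1)) => //; apply: adaptedL2_saddle_x; exact: up01.
have C12 : adaptedL2 P (past r1) c12.
  apply: (adaptedL2Z (sub r1)); apply: (adaptedL2Z (sub r1)).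
  by apply: (adaptedL2B (sub r1)) => //; apply: adaptedL2_saddle_y; exact: up01.
have I2 := integ_dot E22 (up23 _ _ C2).
have I11 := integ_dot E11 (up12 _ _ C11).
have I12 := integ_dot E12 (up12 _ _ C12).
have I1 := integD I2 I11.
split.
- by split=> //; apply: up23.
- exact: (integD IE IE2).
- rewrite /mean_errors /errors_sq (ExD IE IE2) (ExD IE0 IE1).
  have -> : 3 * (sigma ^+ 2 / m%:R) = sigma ^+ 2 / m%:R + sigma ^+ 2 / m%:R
    + sigma ^+ 2 / m%:R by ring.
  exact: (lerD (lerD EE0 EE1) EE2).
- exact: (integD I1 I12).
- split; last by split; exact: up23.
  rewrite /mean_pairing /run_pairing /error_pairing.
  by rewrite (ExD I1 I12) (ExD I2 I11) (T22 _ C2) (T11 _ C11) (T12 _ C12) !addr0.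
Qed.

Lemma known_run t : (t <= T)%N -> known_state (t * 3 * m) (run ^~ t).
Proof.
elim: t => [_|t IH tT].
  by split; exact: (adaptedL2_cst P (past_sub_sigma_algebra _)).
by have [] := known_step tT (IH (ltnW tT)).
Qed.

Let residual t w := residual_bound (gradx F) (grady F) (run w t).

Lemma residual_known t : (0 < t <= T)%N ->
  measurable_wrt (generated (sample_algebra s) (used m T)) (residual t) /\
  integ P (residual t).
Proof.
case: t => // t /= tT.
have [_ _ Kxi _ Kn _] := known_run tT.
have [_ _ _ _ [_ [Gx Gy]]] := known_step tT (known_run (ltnW tT)).
have subr := past_sub_sigma_algebra (t.+1 * 3 * m).
have V1 := adaptedL2D subr Gx Kxi; have V2 := adaptedL2B subr Gy Kn.
split; last exact: (integD (integ_dot V1 V1) (integ_dot V2 V2)).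
have pastU : past (t.+1 * 3 * m) `<=` generated (sample_algebra s) (used m T).
  by apply: generated_le => q [].
move=> B mB; apply: pastU.
apply: (_ : measurable_wrt (past (t.+1 * 3 * m)) (residual t.+1)) => //.
apply/(measurable_wrtP subr); apply: measurable_funD.
  exact: measurable_sq V1.
exact: measurable_sq V2.
Qed.

Let drop_energy (a b c q r low : R) :
  low <= b -> a + b <= c + q + r -> a <= c - low + q + r.
Proof. lra. Qed.

(** Summing the energy inequality, only the variance of the errors and the loss
    of energy remain on average. *)
Lemma mean_residual (low : R) :
  (forall w, low <= state_energy X Y F (gradx F) (grady F) L g (run w T)) ->
  beta / 64 * (\sum_(t < T) Ex (residual t.+1)) <=
  energy X Y F (gradx F) (grady F) L g x0 x0 0 y0 0 0 - low
  + 60 * (T%:R * (sigma ^+ 2 / m%:R)).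
Proof.
move=> Elow.
have IR (t : 'I_T) : integ P (residual t.+1).
  by have [] := residual_known (t := t.+1) (ltn_ord t).
have step (t : 'I_T) := known_step (ltn_ord t) (known_run (ltnW (ltn_ord t))).
have IE (t : 'I_T) : integ P (fun w => errors_sq X Y (gradx F) (grady F) G L h alpha
    k beta m (samples w) x0 y0 t) by have [] := step t.
have IM (t : 'I_T) : integ P (fun w => run_pairing X Y (gradx F) (grady F) G L g h
    alpha k beta m (samples w) x0 y0 t) by have [] := step t.
have EE (t : 'I_T) : mean_errors t <= 3 * (sigma ^+ 2 / m%:R) by have [] := step t.
have EM (t : 'I_T) : mean_pairing t = 0 by have [_ _ _ _ []] := step t.
have [c cE] : exists c, c = energy X Y F (gradx F) (grady F) L g x0 x0 0 y0 0 0 - low.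
  by eexists.
have bound w : beta / 64 * (\sum_(t < T) residual t.+1 w) <= c
    + 20 * (\sum_(t < T) errors_sq X Y (gradx F) (grady F) G L h alpha k beta m
      (samples w) x0 y0 t)
    + \sum_(t < T) run_pairing X Y (gradx F) (grady F) G L g h alpha k beta m
      (samples w) x0 y0 t.
  have := @energy_telescope R n p S X Y F (gradx F) (grady F) G L mu g
    H g_gt0 g_le muE h alpha k beta hL alphaE kE betaE m (samples w) x0 y0 Xx0 Yy0 T.
  by rewrite cE; exact: drop_energy (Elow w).
have I1 := integZ (beta / 64) (integ_sum (index_enum 'I_T) IR).
have I2 := integZ 20 (integ_sum (index_enum 'I_T) IE).
have I3 := integ_sum (index_enum 'I_T) IM.
have I12 := integD (integ_cst P c) I2.
have : Ex (fun w => beta / 64 * (\sum_(t < T) residual t.+1 w)) <= Ex (fun w => c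
    + 20 * (\sum_(t < T) errors_sq X Y (gradx F) (grady F) G L h alpha k beta m
      (samples w) x0 y0 t)
    + \sum_(t < T) run_pairing X Y (gradx F) (grady F) G L g h alpha k beta m
      (samples w) x0 y0 t).
  apply: le_Rintegral => //; first exact: integD.
rewrite (ExD I12 I3) (ExD (integ_cst P c) I2) Ex_cst.
rewrite (ExZ _ (integ_sum (index_enum 'I_T) IR)) (ExZ _ (integ_sum (index_enum 'I_T) IE)).
rewrite (Ex_sum _ IR) (Ex_sum _ IE) (Ex_sum _ IM).
rewrite (eq_bigr (fun=> 0) (fun i _ => EM i)) big1_eq addr0 => E.
apply: (le_trans E); rewrite cE lerD2l.
have : \sum_(t < T) mean_errors t <= \sum_(t < T) 3 * (sigma ^+ 2 / m%:R).
  by apply: ler_sum => t _; exact: EE.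
rewrite sumr_const card_ord -[_ *+ T]mulr_natl => E2.
apply: (le_trans (ler_wpM2l _ E2)) => //.
by rewrite le_eqVlt; apply/orP; left; apply/eqP; ring.
Qed.

End random_trajectory.

(** * The uniformly drawn iterate *)

Section uniform_index.
Context {R : realType} {d : measure_display} {Omega : measurableType d}.
Variable P : probability Omega R.
Variables (T : nat) (J : {mfun Omega >-> nat}) (A : set (set Omega)).
Hypothesis T_gt0 : (0 < T)%N.
Hypothesis subA : Defs.sub_sigma_algebra A.
Hypothesis J_unif : forall j, (j < T)%N -> P (J @^-1` [set j]) = (T%:R^-1)%:E.
Hypothesis J_indep : independent P (g_sigma_algebra_preimage J) A.

Local Notation Ex f := (\int[P]_w (f w))%R.
Local Notation chosen j := (\1_(J @^-1` [set (j : nat)]) : Omega -> R).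

Let mJ (B : set nat) : measurable (J @^-1` B).
Proof. by rewrite -[X in measurable X]setTI; exact: (@measurable_funPT _ _ _ _ J measurableT). Qed.

Let integ_chosen j : integ P (chosen j).
Proof.
apply: (integ_le _ _ (integ_cst P 1)); first exact: measurable_indic.
by move=> w; rewrite indicE; case: (_ \in _); rewrite ?normr1 ?normr0.
Qed.

(** Independence says that [1 / T] is the conditional probability of each value of
    the index given the trajectory. *)
Lemma index_cond_exp j : (j < T)%N ->
  is_cond_exp P A (chosen j) (fun=> T%:R^-1).
Proof.
move=> jT; split.
- exact: measurable_indic.
- by apply/(measurable_wrtP subA); exact: measurable_cst.
- exists (fun=> setT); split.
  + by move=> _; rewrite -(measurable_algebraE subA).
  + by apply/seteqP; split=> // w _; exists 0%N.
  + by move=> _; exact: integ_chosen.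
- move=> E AE _; have mE := subA.2 _ AE; split.
    exact: integrableS measurableT mE _ (integ_cst P T%:R^-1).
  rewrite integral_indic// integral_cst// -(J_unif jT); apply: J_indep => //.
  by exists [set j] => //; rewrite setTI.
Qed.

Lemma index_mean j (Q : Omega -> R) : (j < T)%N ->
  measurable_wrt A Q -> integ P Q ->
  integ P (fun w => chosen j w * Q w) /\
  Ex (fun w => chosen j w * Q w) = T%:R^-1 * Ex Q.
Proof.
move=> jT mQ IQ; have mQ' := measurable_wrt_fun subA mQ.
have mC : measurable_fun setT (chosen j) by exact: measurable_indic.
have IC : integ P (fun w => chosen j w * Q w).
  apply: (integ_le _ _ (integrable_norm IQ)); first exact: measurable_funM.
  move=> w /=; rewrite normrM indicE ler_piMl//.
  by case: (_ \in _); rewrite ?normr1 ?normr0.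
split=> //.
have IN : integ P (fun w => chosen j w - T%:R^-1).
  apply: integD; last exact: integ_cst.
  exact: integ_chosen.
have ICT := integZ (- T%:R^-1) IQ.
have E w : (chosen j w - T%:R^-1) * Q w = chosen j w * Q w + - T%:R^-1 * Q w.
  by rewrite mulrBl mulNr.
have INQ : integ P (fun w => (chosen j w - T%:R^-1) * Q w).
  by under eq_fun do rewrite E; exact: integD.
have := cond_exp_orthogonal subA (index_cond_exp jT) IN mQ INQ.
under eq_Rintegral do rewrite E.
by rewrite ExD// ExZ// mulNr => /eqP; rewrite subr_eq0 => /eqP.
Qed.

Lemma index_range : P [set w | (T <= J w)%N] = 0%E.
Proof.
have -> : [set w | (T <= J w)%N] = ~` \big[setU/set0]_(j < T) (J @^-1` [set nat_of_ord j]).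
  rewrite -(bigcup_mkord T (fun j => J @^-1` [set j])); apply/seteqP; split => w /=.
    by move=> TJ [j /= jT Jj]; move: TJ; rewrite Jj leqNgt jT.
  by move=> nJ; rewrite leqNgt; apply/negP => JT; apply: nJ; exists (J w).
rewrite probability_setC; last by apply: bigsetU_measurable => i _; exact: mJ.
rewrite (measure_bigsetU P (F := fun j => J @^-1` [set j])).
- rewrite (eq_bigr (fun=> (T%:R^-1)%:E)); last by move=> i _; exact: J_unif.
  rewrite sumEFin sumr_const card_ord -[_ *+ T]mulr_natl divff ?subee//.
  by rewrite pnatr_eq0 -lt0n.
- by move=> i; exact: mJ.
- by move=> i j _ _ [w [/= <- <-]].
Qed.

(** The integral of a nonnegative function being a supremum over the simple
    functions below it, it is monotone whether or not the smaller function is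
    measurable. *)
Lemma lower_integral_le (f g : Omega -> \bar R) :
  (forall w, 0 <= f w)%E -> (forall w, f w <= g w)%E ->
  (\int[P]_w f w <= \int[P]_w g w)%E.
Proof.
move=> f0 fg; rewrite !ge0_integralTE//; last by move=> w; exact: le_trans (fg w).
apply: ereal_sup_le => _ [h hf <-]; exists h => // w.
exact: le_trans (hf w) (fg w).
Qed.

(** On each event of a fixed index the bound is a product of a variable of the
    trajectory and an indicator independent of it.  On the null event of an index
    out of range the residual is bounded by [+oo]. *)
Lemma uniform_output (Q : nat -> Omega -> R) (r : Omega -> R) :
  (forall j, (j < T)%N -> measurable_wrt A (Q j) /\ integ P (Q j)) ->
  (forall w, 0 <= r w) -> (forall w, (J w < T)%N -> r w <= Q (J w) w) ->
  ('E_P[r] <= (T%:R^-1 * \sum_(j < T) Ex (Q j))%:E)%E.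
Proof.
move=> HQ r0 rQ.
pose M w := \sum_(j < T) chosen j w * Q j w.
have IM (j : 'I_T) := (index_mean (ltn_ord j) (HQ j (ltn_ord j)).1 (HQ j (ltn_ord j)).2).1.
have EM (j : 'I_T) := (index_mean (ltn_ord j) (HQ j (ltn_ord j)).1 (HQ j (ltn_ord j)).2).2.
have IMs : integ P M by exact: integ_sum.
have ExM : Ex M = T%:R^-1 * \sum_(j < T) Ex (Q j).
  rewrite /M Ex_sum// mulr_sumr; apply: eq_bigr => j _; exact: EM.
have MQ w : (J w < T)%N -> M w = Q (J w) w.
  move=> JT; rewrite /M (bigD1 (Ordinal JT))//= big1 ?addr0.
    by rewrite indicE mem_set// mul1r.
  move=> j jJ; rewrite indicE memNset ?mul0r//= => Jj.
  by move/eqP: jJ; apply; apply: val_inj; rewrite /= Jj.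
pose B := [set w | (T <= J w)%N].
have mB : measurable B by exact: (mJ [set i | (T <= i)%N]).
pose g w : \bar R := if (J w < T)%N then (M w)%:E else +oo%E.
have mM : measurable_fun setT (EFin \o M) by exact: measurable_int IMs.
have mg : measurable_fun setT g.
  apply: measurable_fun_ifT => //; apply: (measurable_fun_bool true).
  by rewrite setTI; exact: (mJ [set i | (i < T)%N = true]).
have -> : ('E_P[r] = \int[P]_w (r w)%:E)%E by rewrite unlock.
apply: (@le_trans _ _ (\int[P]_w g w)%E).
  apply: lower_integral_le => w; rewrite ?lee_fin// /g; case: ifP => JT.
    by rewrite lee_fin MQ// rQ.
  by rewrite leey.
rewrite -ExM /Rintegral fineK; last exact: integrable_fin_num.
rewrite le_eqVlt; apply/orP; left; apply/eqP.
apply: ae_eq_integral => //.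
exists B; split=> //; first exact: index_range.
move=> w /= nE; rewrite /B /= leqNgt; apply/negP => JT; apply: nE => _.
by rewrite /g JT.
Qed.

End uniform_index.

(** * The minimax problem under the standing assumptions *)

Section standing.
Context {R : realType} {n p : nat} {dS : measure_display} {S : measurableType dS}.
Variables (D : probability S R) (f : 'rV[R]_n * 'rV[R]_p -> S -> R).
Variables (X : set 'rV[R]_n) (Y : set 'rV[R]_p) (L mu : R).
Hypothesis SA : standing_assumptions D f X Y L.
Local Notation F := (expected D f).

Lemma Y_bounded y : Y y -> enorm y <= max_norm Y.
Proof.
move=> Yy; apply: ub_le_sup; last by exists y.
have : compact [set enorm y | y in Y].
  apply: continuous_compact; last exact: (Y_compact SA).
  by apply: continuous_subspaceT => x; exact: enorm_continuous.
move=> /compact_bounded [M [_ HM]]; exists (M + 1) => z /HM; rewrite /= => H.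
by apply: le_trans (H (M + 1) _); [exact: ler_norm|rewrite ltrDl].
Qed.

Hypothesis mu_gt0 : 0 < mu.
Hypothesis SC : strongly_concave X Y F mu.

Lemma standing_smooth_concave :
  smooth_concave X Y F (gradx F) (grady F) L mu.
Proof.
have L0 := L_gt0 SA.
have lipF u u' : (X `*` Y) u -> (X `*` Y) u' ->
  sq (gradx F u - gradx F u') + sq (grady F u - grady F u')
    <= L ^+ 2 * (sq (u.1 - u'.1) + sq (u.2 - u'.2)).
  move=> Du Du'; have := F_smooth SA Du Du'.
  rewrite -(@ler_pXn2r _ 2)// ?nnegrE ?sqrtr_ge0//; last first.
    by rewrite mulr_ge0 ?sqrtr_ge0// ltW.
  by rewrite exprMn !penorm_sq.
have sX := convex_segment_closed (X_convex SA).
split=> //.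
- exact: X_neq0 SA.
- exact: X_closed SA.
- exact: Y_neq0 SA.
- by apply: compact_closed (Y_compact SA); exact: norm_hausdorff.
- exact: convex_segment_closed (Y_convex SA).
- apply: smooth_weakly_convex => //; first exact: ltW.
  by have [U [_ XYU _ dU _]] := F_C1 SA; move=> u /XYU /dU.
- by move=> x y y' Xx Yy Yy'; have := SC Xx Yy Yy'; rewrite enorm_sq.
Qed.

Let H := standing_smooth_concave.

Lemma phi_ge x y : X x -> Y y -> F (x, y) <= phi Y F x.
Proof.
move=> Xx Yy; apply: ub_le_sup; last by exists y.
exists (F (x, y) + enorm (grady F (x, y)) * (max_norm Y + max_norm Y)).
move=> _ [y' Yy' <-]; apply: (le_trans (concave_above H Xx Yy Yy')).
have : dot (grady F (x, y)) (y' - y) <=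
    enorm (grady F (x, y)) * (max_norm Y + max_norm Y).
  have [_ P1] := andP (etrans (esym (ler_norml _ _)) (dot_CauchySchwarz (grady F (x, y)) y')).
  have [P2 _] := andP (etrans (esym (ler_norml _ _)) (dot_CauchySchwarz (grady F (x, y)) y)).
  have Q1 := ler_wpM2l (enorm_ge0 (grady F (x, y))) (Y_bounded Yy').
  have Q2 := ler_wpM2l (enorm_ge0 (grady F (x, y))) (Y_bounded Yy).
  by rewrite dotDr dotNr mulrDr; lra.
have := mulr_ge0 (ltW mu_gt0) (sq_ge0 (y' - y)); lra.
Qed.

Lemma phi_le x c : (forall y, Y y -> F (x, y) <= c) -> phi Y F x <= c.
Proof.
move=> Hc; apply: ge_sup; last by move=> _ [y Yy <-]; exact: Hc.
by have [y Yy] := Y_neq0 SA; exists (F (x, y)), y.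
Qed.

Lemma phi_inf_le x : X x -> phi_inf X Y F <= phi Y F x.
Proof. by move=> Xx; apply: ge_inf (phi_bounded SA) _ _; exists x. Qed.

Lemma envelope_phi x :
  X x -> envelope X Y F (gradx F) (grady F) L x <= phi Y F x.
Proof.
move=> Xx; have [_ Ys] := saddle_dom H x; have := phi_ge Xx Ys.
have := envelope_le H x Xx; rewrite /prox_val /= subrr.
have -> : sq (0 : 'rV[R]_n) = 0 by rewrite /sq dot0l.
have := mulr_ge0 (ltW (L_gt0 SA)) (sq_ge0 (x - (saddle X Y (gradx F) (grady F) L x).1)).
lra.
Qed.

Lemma envelope_phi_inf z :
  phi_inf X Y F <= envelope X Y F (gradx F) (grady F) L z.
Proof.
have [Xs _] := saddle_dom H z; apply: le_trans (phi_inf_le Xs) _.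
apply: phi_le => y Yy; have := envelope_ge H z Yy; rewrite /prox_val /=.
have := mulr_ge0 (ltW mu_gt0) (sq_ge0 (y - (saddle X Y (gradx F) (grady F) L z).2)).
have := mulr_ge0 (ltW (L_gt0 SA)) (sq_ge0 ((saddle X Y (gradx F) (grady F) L z).1 - z)).
lra.
Qed.

Lemma edist_le {q} (C : set 'rV[R]_q) v : C v -> Defs.edist 0 C ^+ 2 <= sq v.
Proof.
move=> Cv; rewrite -enorm_sq lerXn2r ?nnegrE ?enorm_ge0//.
  apply: lb_le_inf; first by exists (enorm (0 - v)), v.
  by move=> _ [u _ <-]; exact: enorm_ge0.
have -> : enorm v = enorm (0 - v) by rewrite sub0r /enorm dotNl dotNr opprK.
apply: ge_inf; last by exists v.
by exists 0 => _ [u _ <-]; exact: enorm_ge0.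
Qed.

(** The multipliers of the method are candidates in the distances to the normal
    cones. *)
Lemma residual_sq_le x y xi nn : normal_cone X x xi -> normal_cone Y y nn ->
  residual_sq X Y F (x, y) <=
  sq (gradx F (x, y) + xi) + sq (grady F (x, y) - nn).
Proof.
move=> Nx Ny; apply: lerD; first by apply: edist_le; exists xi.
by rewrite -sqN opprB addrC; apply: edist_le; exists nn.
Qed.

Lemma residual_sq_ge0 u : 0 <= residual_sq X Y F u.
Proof. by rewrite addr_ge0 ?sqr_ge0. Qed.

Variables (x0 : 'rV[R]_n) (y0 : 'rV[R]_p).
Hypotheses (Xx0 : X x0) (Yy0 : Y y0).

Lemma initial_gap (g : R) : 0 < g -> g <= 1 / 11 ->
  energy X Y F (gradx F) (grady F) L g x0 x0 0 y0 0 0 - L * phi_inf X Y F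
    <= L * initial_quantity X Y F L x0 y0.
Proof.
move=> g0 g1; have L0 := L_gt0 SA.
have := initial_energy_le H g0 g1 Xx0 Yy0 (ltW (max_norm_gt0 SA)) Y_bounded.
have := ler_wpM2l (ltW L0) (envelope_phi Xx0).
have := sqr_ge0 (L * max_norm Y).
rewrite /initial_quantity !enorm_sq.
have -> : L * (phi Y F x0 - phi_inf X Y F
    + 2 * max_norm Y * enorm (grady F (x0, y0))
    + (sq (gradx F (x0, y0)) + 2 * sq (grady F (x0, y0))) / L
    + (3 + 1 / 64) * L * max_norm Y ^+ 2) =
  L * phi Y F x0 - L * phi_inf X Y F
    + L * (2 * max_norm Y * enorm (grady F (x0, y0)))
    + (sq (gradx F (x0, y0)) + 2 * sq (grady F (x0, y0)))
    + (3 + 1 / 64) * (L * max_norm Y) ^+ 2.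
  by field; rewrite gt_eqF.
move: (energy _ _ _ _ _ _ _ _ _ _ _ _ _) (envelope _ _ _ _ _ _ _) => e env.
move: (enorm _) (sq _ + _) (phi _ _ _) (phi_inf _ _ _) (max_norm Y) => a b c q r.
lra.
Qed.

Lemma initial_quantity_ge0 : 0 <= initial_quantity X Y F L x0 y0.
Proof.
have L0 := L_gt0 SA; have := phi_inf_le Xx0; rewrite -subr_ge0 => P0.
rewrite /initial_quantity; apply: addr_ge0; first (apply: addr_ge0; first (apply: addr_ge0 => //)).
- by rewrite !mulr_ge0 ?enorm_ge0// ltW// (max_norm_gt0 SA).
- apply: divr_ge0; last exact: ltW.
  by rewrite addr_ge0 ?sqr_ge0// mulr_ge0 ?sqr_ge0.
- by rewrite mulr_ge0 ?sqr_ge0// mulr_ge0// ltW.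
Qed.

End standing.

(** * Parameters and complexity *)

Section parameter_choice.
Context {R : realType}.
Variables (L mu : R).
Hypotheses (mu_gt0 : 0 < mu) (mu_le : mu <= L).

Let L_gt0 : 0 < L. Proof. exact: lt_le_trans mu_gt0 mu_le. Qed.
Let Ln0 : L != 0. Proof. by rewrite gt_eqF. Qed.
Let s := s_sc L mu.

(** The momentum parameter in units of [L]; all the parameters of the method are
    functions of it. *)
Definition momentum : R := s / (16 * L).

Let s_gt0 : 0 < s.
Proof. by rewrite sqrtr_gt0 !mulr_gt0. Qed.

Let s_sq : s ^+ 2 = 2 * L * mu.
Proof. by rewrite sqr_sqrtr// ltW// !mulr_gt0. Qed.

Let sE : s = 16 * L * momentum.
Proof. by rewrite /momentum; field. Qed.

Lemma momentum_gt0 : 0 < momentum.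
Proof. by rewrite divr_gt0// mulr_gt0. Qed.

Lemma momentum_le : momentum <= 1 / 11.
Proof.
rewrite /momentum ler_pdivrMr ?mulr_gt0//.
rewrite -(@ler_pXn2r _ 2)// ?nnegrE ?(ltW s_gt0)//; last by rewrite !mulr_ge0 ?(ltW L_gt0).
rewrite s_sq; have := ler_wpM2l (ltW L_gt0) mu_le.
have -> : (1 / 11 * (16 * L)) ^+ 2 = (256 / 121) * (L * L) by field.
have := mulr_ge0 (ltW L_gt0) (ltW L_gt0); rewrite -mulrA; lra.
Qed.

Lemma mu_momentum : mu = 128 * L * momentum ^+ 2.
Proof.
have -> : 128 * L * momentum ^+ 2 = s ^+ 2 / (2 * L) by rewrite /momentum; field.
by rewrite s_sq; field.
Qed.

Lemma h_momentum : L * h_sc L = 1 / 192.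
Proof. by rewrite /h_sc; field. Qed.

Let hs : h_sc L * s / 16 = 1 / 192 * momentum.
Proof. by rewrite /h_sc /momentum; field. Qed.

Let pos : 1 + 1 / 192 * momentum != 0.
Proof. have := momentum_gt0 => g0; rewrite gt_eqF//; lra. Qed.

Lemma alpha_momentum : (1 + 1 / 192 * momentum) * alpha_sc L mu = 1.
Proof. by rewrite /alpha_sc -/s hs mulfV. Qed.

Lemma k_momentum :
  (1 + 1 / 192 * momentum) * k_sc L mu = 1 / 192 * (1 / 2 - momentum).
Proof.
rewrite /k_sc -/s.
have -> : 16 + h_sc L * s = 16 * (1 + 1 / 192 * momentum) by rewrite -hs; field.
have -> : h_sc L * (8 * L - s) = 16 * (1 / 192 * (1 / 2 - momentum)).
  by rewrite /h_sc /momentum; field.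
by move: pos; move: (1 + 1 / 192 * momentum) => B B0; field.
Qed.

Lemma beta_momentum : beta_sc L mu = 1 / 192 * momentum / 256.
Proof.
rewrite /beta_sc -/s sE /h_sc.
have -> : 2 ^+ 12 = 16 * 256 :> R by rewrite -[256]/(16 * 16)%:R natrM; ring.
by field.
Qed.

Lemma beta_gt0 : 0 < beta_sc L mu.
Proof. by rewrite beta_momentum; have := momentum_gt0; lra. Qed.

Lemma inv_beta_le : (beta_sc L mu)^-1 <= 192 * 2 ^+ 12 * Num.sqrt (L / mu).
Proof.
have q0 : 0 <= L / mu by rewrite divr_ge0// ltW.
have two0 : 0 < 2 ^+ 12 :> R by rewrite exprn_gt0.
have -> : (beta_sc L mu)^-1 = 192 * 2 ^+ 12 * (L / s).
  by rewrite /beta_sc -/s /h_sc; field; rewrite Ln0 !gt_eqF.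
rewrite ler_wpM2l ?mulr_ge0 ?(ltW two0)//.
rewrite -(@ler_pXn2r _ 2)// ?nnegrE ?sqrtr_ge0 ?divr_ge0 ?(ltW s_gt0) ?(ltW L_gt0)//.
rewrite expr_div_n s_sq sqr_sqrtr//.
have -> : L ^+ 2 / (2 * L * mu) = 1 / 2 * (L / mu) by field; rewrite Ln0 gt_eqF.
lra.
Qed.

End parameter_choice.

Section rounding.
Context {R : realType}.

Lemma max1ceil_gt0 (r : R) : (0 < max1ceil r)%N.
Proof.
rewrite /max1ceil absz_gt0 gt_eqF//.
by rewrite (@lt_le_trans _ _ 1%Z)// le_max lexx.
Qed.

Let max1ceilE (r : R) : (max1ceil r)%:R = (Num.max 1%Z (Num.ceil r))%:~R :> R.
Proof.
rewrite /max1ceil natr_absz ger0_norm// (@le_trans _ _ 1%Z)// le_max lexx//.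
Qed.

Lemma max1ceil_ge (r : R) : r <= (max1ceil r)%:R.
Proof.
by rewrite max1ceilE (le_trans (ceil_ge r))// ler_int le_max lexx orbT.
Qed.

Lemma max1ceil_le (r : R) : 0 <= r -> (max1ceil r)%:R <= 1 + r.
Proof.
move=> r0; rewrite max1ceilE; case: (leP 1%Z (Num.ceil r)) => _.
  have := ceilB1_lt r; rewrite intrD => H; move: H; rewrite /=; lra.
by rewrite lerDl.
Qed.

Lemma max1ceil0 : max1ceil (0 : R) = 1%N.
Proof. by rewrite /max1ceil ceil0. Qed.

End rounding.

Section counting.
Context {R : realType} {n p : nat} {S : Type}.
Variables (X : set 'rV[R]_n) (Y : set 'rV[R]_p).
Variable G : 'rV[R]_n * 'rV[R]_p -> S -> 'rV[R]_n * 'rV[R]_p.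
Variables (L h alpha k beta : R) (m : nat) (s : nat -> nat -> nat -> S).
Variables (x0 : 'rV[R]_n) (y0 : 'rV[R]_p).

Lemma calls_step b0 b1 b2 st :
  st_calls (spde_step X Y G L h alpha k beta b0 b1 b2 st) =
  (st_calls st + size b0 + size b1 + size b2)%N.
Proof. by case: st. Qed.

Lemma calls_run t :
  st_calls (spde X Y G L h alpha k beta m s x0 y0 t) = (3 * m * t)%N.
Proof.
elim: t => [|t IH]; first by rewrite muln0.
rewrite /= calls_step IH !size_mkseq mulnS [RHS]addnC -!addnA.
by congr (_ + _)%N; rewrite !mulSn mul0n addn0.
Qed.

End counting.

Section orders.
Context {R : realType}.
Variable c : R.
Hypothesis c_ge1 : 1 <= c.

(** With [q] for the square root of the condition number over the squared
    accuracy, [a] and [b] are at most [c * l * q] and [c * v * q], and both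
    bounds below only expand the product. *)
Lemma product_order (a b l v q : R) :
  0 <= a -> 0 <= b -> 0 <= l -> 0 <= v -> 0 <= q ->
  a <= c * (l * q) -> b <= c * (v * q) ->
  3 * (1 + a) * (1 + b) <= 3 * c ^+ 2 * (1 + (l + v) * q + l * v * q ^+ 2).
Proof.
move=> a0 b0 l0 v0 q0 al bv.
have ab := ler_pM a0 b0 al bv.
have c1 : 1 <= c ^+ 2 by exact: exprn_ege1.
have c2 : c <= c ^+ 2 by rewrite expr2 ler_peMl// (le_trans ler01).
have lq : 0 <= l * q by exact: mulr_ge0.
have vq : 0 <= v * q by exact: mulr_ge0.
have e1 := ler_wpM2r lq c2; have e2 := ler_wpM2r vq c2.
have -> : 3 * (1 + a) * (1 + b) = 3 * (1 + a + b + a * b) by ring.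
rewrite -[3 * c ^+ 2 * _]mulrA ler_wpM2l//.
have -> : c ^+ 2 * (1 + (l + v) * q + l * v * q ^+ 2) =
  c ^+ 2 + c ^+ 2 * (l * q) + c ^+ 2 * (v * q) + c * (l * q) * (c * (v * q)) by ring.
lra.
Qed.

Lemma factor_order (a l q : R) : 1 <= q -> 0 <= l -> a <= c * (l * q) ->
  1 + a <= (1 + c * l) * q.
Proof. by move=> q1 l0 al; rewrite mulrDl mul1r -mulrA lerD. Qed.

End orders.

(** The larger of the constants of the two prescribed numbers, times that of
    [inv_beta_le]. *)
Definition order_base (R : realType) : R := 384 * 10 ^+ 2 * (192 * 2 ^+ 12).

Lemma order_base_ge1 (R : realType) : 1 <= order_base R.
Proof.
rewrite /order_base -[1]mulr1; apply: ler_pM => //.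
  rewrite -[1]mulr1; apply: ler_pM => //; first by lra.
  by apply: exprn_ege1; lra.
rewrite -[1]mulr1; apply: ler_pM => //; first by lra.
by apply: exprn_ege1; lra.
Qed.

(** * The theorem *)

(** The average of the residuals along the trajectory is controlled by the energy
    gap over the number of iterations and by the variance of a batch, and the
    prescribed numbers make each contribution a fraction of the target. *)
Lemma average_le (R : realType) (L B sigma eps beta S T m : R) :
  0 < beta -> 0 < eps -> 0 < T -> 0 < m ->
  128 * L * B / (beta * eps ^+ 2) <= T ->
  384 * 10 ^+ 2 * sigma ^+ 2 / (beta * eps ^+ 2) <= m ->
  beta / 64 * S <= L * B + 60 * (T * (sigma ^+ 2 / m)) ->
  T^-1 * S <= eps ^+ 2.
Proof.
move=> b0 e0 T0 m0.
have be0 : 0 < beta * eps ^+ 2 by rewrite mulr_gt0 ?exprn_gt0.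
rewrite !ler_pdivrMr//.
set e := eps ^+ 2 in be0 *; set v := sigma ^+ 2 => TB mv.
have -> : 60 * (T * (v / m)) = 60 * T * (v / m) by ring.
have vm : 384 * 10 ^+ 2 * (v / m) <= beta * e.
  by rewrite mulrA ler_pdivrMr// [leRHS]mulrC.
move=> HS; rewrite mulrC ler_pdivrMr//.
have e0' : 0 <= e by exact: sqr_ge0.
rewrite -(ler_pM2l b0).
have := ler_wpM2l (ltW T0) vm.
have -> : T * (384 * 10 ^+ 2 * (v / m)) = 10 * (64 * (60 * T * (v / m))) by ring.
have -> : beta * (e * T) = T * (beta * e) by ring.
move: TB HS; have -> : T * (beta * e) = beta * e * T by ring.
have -> : beta / 64 * S = beta * S / 64 by ring.
have := mulr_ge0 (mulr_ge0 (ltW b0) e0') (ltW T0).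
have -> : 128 * L * B = 128 * (L * B) by ring.
move: (beta * e * T) (beta * S) (60 * T * (v / m)) (L * B) => x y z w; lra.
Qed.

Section mean_square.
Context {R : realType} {n p : nat} {dS : measure_display} {S : measurableType dS}.
Variables (D : probability S R) (f : 'rV[R]_n * 'rV[R]_p -> S -> R).
Variables (X : set 'rV[R]_n) (Y : set 'rV[R]_p) (L mu sigma Bbar eps : R).
Variables (x0 : 'rV[R]_n) (y0 : 'rV[R]_p).
Context {d : measure_display} {Omega : measurableType d}.
Variable P : probability Omega R.
Variables (s : nat -> nat -> nat -> {mfun Omega >-> S}) (J : {mfun Omega >-> nat}).

Local Notation F := (expected D f).
Local Notation T := (T_sc L mu Bbar eps).
Local Notation m := (m_sc L mu sigma eps).
Local Notation g := (momentum L mu).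

Let run w := spde X Y (sgrad f) L (h_sc L) (alpha_sc L mu) (k_sc L mu)
  (beta_sc L mu) m (fun t j i => s t j i w) x0 y0.

Lemma mean_square_residual :
  0 < eps -> standing_assumptions D f X Y L ->
  stochastic_oracle D f X Y sigma P -> 0 < mu -> mu <= L ->
  strongly_concave X Y F mu -> X x0 -> Y y0 ->
  initial_quantity X Y F L x0 y0 <= Bbar ->
  sampling_scheme P D m T s J ->
  ('E_P[fun w => residual_sq X Y F
      (st_x (run w (J w).+1), st_y (run w (J w).+1))] <= (eps ^+ 2)%:E)%E.
Proof.
move=> e0 SA oracleH mu0 muL SC Xx0 Yy0 HB SS.
have L0 := L_gt0 SA; have g0 := momentum_gt0 mu0 muL.
have g1 := momentum_le mu0 muL; have muE := mu_momentum mu0 muL.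
have hL := h_momentum mu0 muL; have alphaE := alpha_momentum mu0 muL.
have kE := k_momentum mu0 muL; have betaE := beta_momentum mu0 muL.
have b0 := beta_gt0 mu0 muL.
have H := standing_smooth_concave SA mu0 SC.
have T0 : (0 < T)%N := max1ceil_gt0 _; have m0 : (0 < m)%N := max1ceil_gt0 _.
have [law indep unif Jindep] := SS.
have known j (jT : (j < T)%N) := @residual_known R n p dS S D f X Y L mu g sigma d
  Omega P m T s H g0 g1 muE (h_sc L) (alpha_sc L mu) (k_sc L mu) (beta_sc L mu) hL
  alphaE kE betaE (sgrad_measurable SA) oracleH m0 law indep x0 y0 Xx0 Yy0 j.+1 jT.
have adm w t := @admissible_run R n p S X Y F (gradx F) (grady F) (sgrad f) L mu g
  H g0 g1 muE (h_sc L) (alpha_sc L mu) (k_sc L mu) (beta_sc L mu) hL alphaE kE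
  betaE m (fun t j i => s t j i w) x0 y0 Xx0 Yy0 t.
have low w : L * phi_inf X Y F <=
    state_energy X Y F (gradx F) (grady F) L g (run w T).
  have [Nx Ny] := adm w T; have [Xx _] := Nx; have [Yy _] := Ny.
  rewrite /state_energy.
  have E := energy_ge H g0 (st_z (run w T)) (st_v (run w T)) Xx Yy Nx Ny.
  apply: le_trans E.
  by apply: ler_wpM2l; [exact: ltW|exact: (envelope_phi_inf SA mu0 SC)].
have M := @mean_residual R n p dS S D f X Y L mu g sigma d Omega P m T s H g0 g1 muE
  (h_sc L) (alpha_sc L mu) (k_sc L mu) (beta_sc L mu) hL alphaE kE betaE
  (sgrad_measurable SA) oracleH m0 law indep x0 y0 Xx0 Yy0 _ low.
pose Q j w := residual_bound (gradx F) (grady F) (run w j.+1).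
have := @uniform_output R d Omega P T J (generated (sample_algebra s) (used m T))
  T0 (generated_sub_sigma_algebra (sample_sub_sigma_algebra s) _) unif Jindep Q
  (fun w => residual_sq X Y F (st_x (run w (J w).+1), st_y (run w (J w).+1)))
  known (fun w => residual_sq_ge0 D f X Y _).
move=> /(_ _)/le_trans; apply.
  move=> w JT; have [Nx Ny] := adm w (J w).+1.
  exact: residual_sq_le Nx Ny.
have T0' : 0 < T%:R :> R by rewrite ltr0n.
have m0' : 0 < m%:R :> R by rewrite ltr0n.
rewrite lee_fin; apply: (average_le b0 e0 T0' m0' (max1ceil_ge _) (max1ceil_ge _)).
apply: (le_trans M); rewrite lerD2r.
apply: (le_trans (initial_gap SA mu0 SC Xx0 Yy0 g0 g1)).
by rewrite ler_wpM2l ?(ltW L0).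
Qed.

End mean_square.

Section order_estimates.
Context {R : realType}.
Variables (L mu sigma Bbar eps : R).
Hypotheses (mu_gt0 : 0 < mu) (mu_le : mu <= L) (B_ge0 : 0 <= Bbar) (eps_gt0 : 0 < eps).

Local Notation c := (order_base R).
Let q : R := Num.sqrt (L / mu) / eps ^+ 2.

Let L_ge0 : 0 <= L. Proof. by rewrite ltW// (lt_le_trans mu_gt0). Qed.

Lemma rate_ge0 : 0 <= q.
Proof. by rewrite divr_ge0 ?sqrtr_ge0 ?sqr_ge0. Qed.

Lemma rate_sq : q ^+ 2 = L / mu / eps ^+ 4.
Proof.
by rewrite expr_div_n sqr_sqrtr ?divr_ge0 ?(ltW mu_gt0)// -exprM.
Qed.

Lemma rate_ge1 : eps < 1 -> 1 <= q.
Proof.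
move=> e1; rewrite ler_pdivlMr ?exprn_gt0// mul1r.
apply: (@le_trans _ _ 1); first by rewrite exprn_ile1// ltW.
by rewrite -sqrtr1 ler_wsqrtr// ler_pdivlMr// mul1r.
Qed.

Let inv_le : (beta_sc L mu * eps ^+ 2)^-1 <= 192 * 2 ^+ 12 * q.
Proof.
rewrite invfM /q mulrA ler_wpM2r ?invr_ge0 ?sqr_ge0//.
exact: inv_beta_le.
Qed.

Let b0 := beta_gt0 mu_gt0 mu_le.

Lemma iterations_order :
  0 <= 128 * L * Bbar / (beta_sc L mu * eps ^+ 2) <= c * (L * Bbar * q).
Proof.
have LB : 0 <= L * Bbar by exact: mulr_ge0.
apply/andP; split.
  apply: divr_ge0; first by rewrite -mulrA mulr_ge0.
  by rewrite mulr_ge0 ?sqr_ge0 ?(ltW b0).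
rewrite -[128 * L * _]mulrA -mulrA.
apply: (@le_trans _ _ (128 * (L * Bbar * (192 * 2 ^+ 12 * q)))).
  by rewrite ler_wpM2l// ler_wpM2l.
rewrite /order_base; set M := 192 * 2 ^+ 12.
have M0 : 0 <= M by rewrite mulr_ge0 ?exprn_ge0.
have := mulr_ge0 M0 (mulr_ge0 LB rate_ge0).
have -> : L * Bbar * (M * q) = M * (L * Bbar * q) by ring.
rewrite -[384 * 10 ^+ 2 * M * _]mulrA; move: (M * _) => z; lra.
Qed.

Lemma batch_order :
  0 <= 384 * 10 ^+ 2 * sigma ^+ 2 / (beta_sc L mu * eps ^+ 2)
    <= c * (sigma ^+ 2 * q).
Proof.
have t0 : 0 <= 384 * 10 ^+ 2 :> R.
  by apply: mulr_ge0; [exact: ler0n|exact/exprn_ge0/ler0n].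
apply/andP; split.
  apply: divr_ge0; first by rewrite mulr_ge0 ?sqr_ge0.
  by rewrite mulr_ge0 ?sqr_ge0 ?(ltW b0).
rewrite -mulrA /order_base -[384 * 10 ^+ 2 * _ * _]mulrA ler_wpM2l//.
rewrite [leRHS]mulrCA ler_wpM2l ?sqr_ge0//.
Qed.

End order_estimates.

Theorem theorem2 (R : realType) :
  exists (C : R) (C' eps0 : R -> R -> R -> R),
  [/\ 0 < C,
      forall L Bbar sigma, 0 < C' L Bbar sigma,
      forall L Bbar sigma, 0 < eps0 L Bbar sigma &
  forall (n p : nat) (X : set 'rV[R]_n) (Y : set 'rV[R]_p)
    (dS : measure_display) (S : measurableType dS) (D : probability S R)
    (f : 'rV[R]_n * 'rV[R]_p -> S -> R)
    (L mu sigma Bbar eps : R) (x0 : 'rV[R]_n) (y0 : 'rV[R]_p)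
    (d : measure_display) (Omega : measurableType d) (P : probability Omega R)
    (s : nat -> nat -> nat -> {mfun Omega >-> S}) (J : {mfun Omega >-> nat}),
  let F := expected D f in
  let kappa := L / mu in
  let T := T_sc L mu Bbar eps in
  let m := m_sc L mu sigma eps in
  let run (w : Omega) (t : nat) :=
    spde X Y (sgrad f) L (h_sc L) (alpha_sc L mu) (k_sc L mu) (beta_sc L mu)
      m (fun t j i => s t j i w) x0 y0 t in
  let out (w : Omega) := (st_x (run w (J w).+1), st_y (run w (J w).+1)) in
  let N (w : Omega) := st_calls (run w T) in
  let a := 128 * L * Bbar / (beta_sc L mu * eps ^+ 2) in
  let b := 384 * 10 ^+ 2 * sigma ^+ 2 / (beta_sc L mu * eps ^+ 2) in
  0 < eps ->
  standing_assumptions D f X Y L ->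
  0 <= sigma ->
  stochastic_oracle D f X Y sigma P ->
  0 < mu -> mu <= L ->
  strongly_concave X Y F mu ->
  X x0 -> Y y0 ->
  initial_quantity X Y F L x0 y0 <= Bbar ->
  sampling_scheme P D m T s J ->
  [/\ ('E_P[fun w => residual_sq X Y F (out w)] <= (eps ^+ 2)%:E)%E,
      forall w, (N w)%:R <= 3 * (1 + a) * (1 + b),
      3 * (1 + a) * (1 + b) <=
        C * (1 + (L * Bbar + sigma ^+ 2) * Num.sqrt kappa / eps ^+ 2
               + L * Bbar * sigma ^+ 2 * kappa / eps ^+ 4),
      0 < sigma -> eps < eps0 L Bbar sigma ->
        [/\ T%:R <= C' L Bbar sigma * (Num.sqrt kappa / eps ^+ 2),
            m%:R <= C' L Bbar sigma * (Num.sqrt kappa / eps ^+ 2) &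
            forall w, (N w)%:R <= C' L Bbar sigma * (kappa / eps ^+ 4)] &
      sigma = 0 -> m = 1%N /\
        (eps < eps0 L Bbar sigma ->
         forall w, (N w)%:R <= C' L Bbar sigma * (Num.sqrt kappa / eps ^+ 2))]].

Proof.
(* The second witness dominates each of the bounds for fixed data, because the
   rate [q] is at least 1 below accuracy 1. *)
pose c := order_base R; have c1 := order_base_ge1 R.
exists (3 * c ^+ 2), (fun L B sigma => 3 * (1 + c * `|L * B|) * (1 + c * sigma ^+ 2)),
  (fun _ _ _ => 1).
have c0 : 0 <= c by exact: le_trans ler01 c1.
split=> //.
- by rewrite mulr_gt0// exprn_gt0// (lt_le_trans _ c1).
- move=> L B sigma.
  by rewrite !mulr_gt0// ltr_wpDr// mulr_ge0// sqr_ge0.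
move=> n p X Y dS S D f L mu sigma Bbar eps x0 y0 d Omega P s J F kappa T m run out N a b.
move=> e0 SA s0 oracleH mu0 muL SC Xx0 Yy0 HB SS.
have B0 : 0 <= Bbar := le_trans (initial_quantity_ge0 SA y0 Xx0) HB.
have /andP[a0 ale] := iterations_order eps mu0 muL B0.
have /andP[b0 ble] := batch_order sigma eps mu0 muL.
rewrite -/a in a0 ale; rewrite -/b in b0 ble.
pose q := Num.sqrt kappa / eps ^+ 2.
rewrite -/kappa -/q -/c in ale ble.
have q0 : 0 <= q := rate_ge0 L mu eps.
have q2 : q ^+ 2 = kappa / eps ^+ 4 := rate_sq eps mu0 muL.
have L0 := ltW (L_gt0 SA).
have LB0 : 0 <= L * Bbar by exact: mulr_ge0.
have v0 : 0 <= sigma ^+ 2 := sqr_ge0 _.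
have Tle : T%:R <= 1 + a := max1ceil_le a0.
have mle : m%:R <= 1 + b := max1ceil_le b0.
have Nle w : (N w)%:R <= 3 * (1 + a) * (1 + b).
  rewrite /N /run calls_run -/m -/T natrM natrM mulrAC.
  by rewrite ler_pM ?ler_wpM2l ?mulr_ge0.
have fa q1 := factor_order q1 LB0 ale.
have fb q1 := factor_order q1 v0 ble.
have ca : 1 <= 1 + c * (L * Bbar) by rewrite lerDl mulr_ge0.
have cb : 1 <= 1 + c * sigma ^+ 2 by rewrite lerDl mulr_ge0.
have ca0 := le_trans ler01 ca; have cb0 := le_trans ler01 cb.
split.
- exact: (mean_square_residual e0 SA oracleH mu0 muL SC Xx0 Yy0 HB SS).
- exact: Nle.
- apply: (le_trans (product_order c1 a0 b0 LB0 v0 q0 ale ble)).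
  by rewrite q2 !mulrA.
- move=> _ e1; have q1 : 1 <= q := rate_ge1 mu0 muL e0 e1.
  rewrite -/q -q2 (ger0_norm LB0); split.
  + apply: (le_trans Tle); apply: (le_trans (fa q1)); rewrite ler_wpM2r//.
    rewrite -[leLHS]mulr1 ler_pM//; first lra.
  + apply: (le_trans mle); apply: (le_trans (fb q1)); rewrite ler_wpM2r//.
    rewrite -[leLHS]mul1r ler_pM//; lra.
  + move=> w; apply: (le_trans (Nle w)).
    have -> : 3 * (1 + c * (L * Bbar)) * (1 + c * sigma ^+ 2) * q ^+ 2 =
      3 * ((1 + c * (L * Bbar)) * q) * ((1 + c * sigma ^+ 2) * q) by ring.
    have A1 : 0 <= 1 + a by lra.
    have B1 : 0 <= 1 + b by lra.
    apply: ler_pM => //; [by rewrite mulr_ge0|by rewrite ler_wpM2l// fa|exact: fb].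
- move=> sigma0.
  have bE : b = 0 by rewrite /b sigma0 expr0n /= mulr0 mul0r.
  split; first by rewrite /m /m_sc -/b bE max1ceil0.
  move=> e1 w; have q1 : 1 <= q := rate_ge1 mu0 muL e0 e1.
  apply: (le_trans (Nle w)).
  rewrite bE addr0 mulr1 -/q (ger0_norm LB0) sigma0 expr0n /= mulr0 addr0 mulr1.
  by rewrite -[leRHS]mulrA ler_wpM2l// fa.
Qed.
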